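(* Let $R$ be a $\phi$-ring. The following statements are equivalent: (1) $R$ is a strongly $\phi$-ring and a $\phi$-PvMR; (2) $\phi\text{-}w\text{-w.gl.dim}(R)\leq 1$; (3) every submodule of a strongly $\phi$-$w$-flat $R$-module is strongly $\phi$-$w$-flat; (4) every submodule of a $w$-flat $R$-module is strongly $\phi$-$w$-flat; (5) every submodule of a flat $R$-module is strongly $\phi$-$w$-flat; (6) every ideal of $R$ is strongly $\phi$-$w$-flat; (7) every nonnil ideal of $R$ is $w$-flat; (8) every finite type nonnil ideal of $R$ is $w$-flat.
   Context: All rings are commutative with $1\neq 0$ and all modules are unitary. $\mathrm{Nil}(R)$ is the nilradical of $R$, $\mathrm{Z}(R)$ the set of all zero-divisors of $R$, and $\mathrm{T}(R)$ the localization of $R$ at the set of all regular elements (non-zero-divisors). A prime ideal $P$ of $R$ is divided prime if $P\subsetneq (x)$ for every $x\in R\setminus P$. A $\phi$-ring is a ring $R$ for which $\mathrm{Nil}(R)$ is a divided prime ideal. A strongly $\phi$-ring is a $\phi$-ring with $\mathrm{Z}(R)=\mathrm{Nil}(R)$. An ideal is nonnil if it contains a non-nilpotent element. An $R$-module $T$ is $\phi$-torsion if for every $x\in T$ there is a nonnil ideal $I$ of $R$ with $Ix=0$. A GV-ideal of $R$ is a finitely generated ideal $J$ such that the natural homomorphism $R\to \operatorname{Hom}_R(J,R)$, $r\mapsto (x\mapsto rx)$, is an isomorphism; $\mathrm{GV}(R)$ is the set of GV-ideals. A module $M$ is GV-torsion if every $x\in M$ satisfies $Jx=0$ for some $J\in\mathrm{GV}(R)$;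 it is GV-torsion free if $Jx=0$ with $J\in \mathrm{GV}(R)$, $x\in M$ implies $x=0$. A GV-torsion free module $M$ is a $w$-module if every $x$ in its injective envelope $E(M)$ with $Jx\subseteq M$ for some $J\in\mathrm{GV}(R)$ lies in $M$; the $w$-envelope $M_w$ is the smallest $w$-module (inside $E(M)$) containing $M$. For an ideal $I$ of $R$, $I_w=\{x\in R\mid Jx\subseteq I \text{ for some } J\in \mathrm{GV}(R)\}$. A $w$-ideal is an ideal that is a $w$-module, and $w\text{-}\mathrm{Max}(R)$ is the set of maximal (proper) $w$-ideals; these are prime. A sequence of module homomorphisms $A\to B\to C$ is $w$-exact if $A_{\mathfrak p}\to B_{\mathfrak p}\to C_{\mathfrak p}$ is exact for every $\mathfrak p\in w\text{-}\mathrm{Max}(R)$. An $R$-module $M$ is of finite type if there is a homomorphism $g:F\to M$ with $F$ finitely generated free such that $F\to M\to 0$ is $w$-exact. An $R$-module $M$ is $w$-flat if $\operatorname{Tor}_1^R(N,M)$ is GV-torsion for every $R$-module $N$ (equivalently, $M_{\mathfrak m}$ is flat over $R_{\mathfrak m}$ for all $\mathfrak m\in w\text{-}\mathrm{Max}(R)$). For a ring $R$ with $\mathrm{Nil}(R)$ prime (in particular for a $\phi$-ring), an $R$-module $M$ is strongly $\phi$-$w$-flat if $\operatorname{Tor}_n^R(T,M)$ is GV-torsion for every $\phi$-torsion $R$-module $T$ and every $n\ge 1$. For an $R$-module $M$ write $\phi_s\text{-}w\text{-fd}_R(M)\le n$ if there is a $w$-exact sequence $0\to F_n\to\cdots\to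 F_1\to F_0\to M\to 0$ with every $F_i$ strongly $\phi$-$w$-flat; $\phi_s\text{-}w\text{-fd}_R(M)$ is the least such $n$, or $\infty$ if none exists. The $\phi$-$w$-weak global dimension is $\phi\text{-}w\text{-w.gl.dim}(R)=\sup\{\phi_s\text{-}w\text{-fd}_R(M)\mid M \text{ an } R\text{-module}\}$. For a $\phi$-ring $R$ there is a ring homomorphism $\phi:\mathrm{T}(R)\to R_{\mathrm{Nil}(R)}$, $\phi(a/b)=a/b$ for $a\in R$ and $b\in R$ regular; $\phi(R)$ is the image of $R$. For a ring $S$ and an ideal (or fractional ideal) $I$ of $S$, $I^{-1}=\{x\in \mathrm{T}(S)\mid Ix\subseteq S\}$. A nonnil ideal $I$ of the $\phi$-ring $R$ is $\phi$-$w$-invertible if $(\phi(I)\phi(I)^{-1})_W=\phi(R)$, where $W$ is the $w$-operation of the ring $\phi(R)$. A $\phi$-ring $R$ is a $\phi$-PvMR ($\phi$-Prüfer $v$-multiplication ring) if every finitely generated nonnil ideal of $R$ is $\phi$-$w$-invertible. *)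

(* Defs.v *)
From HB Require Import structures.
From mathcomp Require Import all_boot all_algebra.
From mathcomp Require Import all_classical.
From mathcomp Require Import freeg.
From mathcomp Require Import ring.

Set Implicit Arguments.
Unset Strict Implicit.
Unset Printing Implicit Defensive.

Import GRing.Theory.
Local Open Scope ring_scope.
Local Open Scope classical_set_scope.
Local Open Scope quotient_scope.

(* A submodule of V is a term of the library type submodClosed V, i.e. a
   boolean predicate closed under the module operations; Prop-valued
   conditions are turned into boolean ones by the classical `[< _ >]. *)
Notation ideal R := (submodClosed (R : comNzRingType)^o).

Section Submodules.
Variables (R : comNzRingType) (V : lmodType R).

Record submod (N : submodClosed V) :=
  Submod { submod_val : V; submod_valP : submod_val \in N }.
HB.instance Definition _ (N : submodClosed V) :=
  [isSub of submod N for @submod_val N].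
HB.instance Definition _ (N : submodClosed V) := [Choice of submod N by <:].
HB.instance Definition _ (N : submodClosed V) :=
  GRing.SubChoice_isSubLmodule.Build R V _ (submod N)
    (GRing.submodClosedP N).

Definition submod_span (X : set V) : {pred V} :=
  fun x => `[< forall N : submodClosed V, (forall y, X y -> y \in N) -> x \in N >].

Lemma submod_span_closed X : submod_closed (submod_span X).
Proof.
split=> [|a x y /asboolP hx /asboolP hy]; apply/asboolP => N hN.
  exact: rpred0.
by rewrite rpredD ?rpredZ ?hx ?hy.
Qed.
HB.instance Definition _ X :=
  GRing.isSubmodClosed.Build R V (submod_span X) (submod_span_closed X).

Definition fg_submod (N : submodClosed V) :=
  exists s : seq V, N =i submod_span [set` s].

(* submodClosed is also meant for semimodules, hence does not inherit from
   zmodClosed in the library. *)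
Definition submod_pred (N : submodClosed V) : {pred V} := N.
HB.instance Definition _ (N : submodClosed V) :=
  GRing.isZmodClosed.Build V (submod_pred N)
    (GRing.submod_closedB (GRing.submodClosedP N)).

Definition lmod_quot (N : submodClosed V) := Quotient.quot (submod_pred N).
HB.instance Definition _ (N : submodClosed V) := GRing.Zmodule.on (lmod_quot N).

Section Quotient.
Variable N : submodClosed V.

Definition lmod_pi (x : V) : lmod_quot N := \pi_(Quotient.quot (submod_pred N)) x.

Lemma lmod_pi_additive : zmod_morphism lmod_pi.
Proof. by move=> x y; rewrite /lmod_pi piE. Qed.

Lemma lmod_pi_eq x y : lmod_pi x = lmod_pi y <-> x - y \in N.
Proof.
rewrite -[x - y \in N]/(x - y \in submod_pred N) Quotient.idealrBE.
by split=> [/eqP|/eqP].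
Qed.

Lemma lmod_pi_surj (z : lmod_quot N) : exists x, z = lmod_pi x.
Proof. by exists (repr z); rewrite /lmod_pi reprK. Qed.

Definition lmod_quot_scale (a : R) (z : lmod_quot N) : lmod_quot N :=
  lmod_pi (a *: repr (z : (Quotient.quot (submod_pred N)))).

Lemma lmod_quot_scaleE a x : lmod_quot_scale a (lmod_pi x) = lmod_pi (a *: x).
Proof.
apply/lmod_pi_eq; rewrite -scalerBr; apply: rpredZ.
by apply/lmod_pi_eq; rewrite /lmod_pi reprK.
Qed.

Let piD x y : lmod_pi (x + y) = lmod_pi x + lmod_pi y.
Proof. by rewrite /lmod_pi piE. Qed.

Fact lmod_quot_scaleA a b z :
  lmod_quot_scale a (lmod_quot_scale b z) = lmod_quot_scale (a * b) z.
Proof. by case: (lmod_pi_surj z) => x ->; rewrite !lmod_quot_scaleE scalerA. Qed.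
Fact lmod_quot_scale1 : left_id 1 lmod_quot_scale.
Proof.
by move=> z; case: (lmod_pi_surj z) => x ->; rewrite lmod_quot_scaleE scale1r.
Qed.
Fact lmod_quot_scaleDr : right_distributive lmod_quot_scale +%R.
Proof.
move=> a z t; case: (lmod_pi_surj z) (lmod_pi_surj t) => x -> [y ->].
by rewrite -piD !lmod_quot_scaleE -piD scalerDr.
Qed.
Fact lmod_quot_scaleDl z : {morph lmod_quot_scale^~ z : a b / a + b}.
Proof.
move=> a b; case: (lmod_pi_surj z) => x ->.
by rewrite !lmod_quot_scaleE -piD scalerDl.
Qed.
HB.instance Definition _ := GRing.Zmodule_isLmodule.Build R (lmod_quot N)
  lmod_quot_scaleA lmod_quot_scale1 lmod_quot_scaleDr lmod_quot_scaleDl.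

Lemma lmod_pi_linear : linear lmod_pi.
Proof. by move=> a x y; rewrite piD -lmod_quot_scaleE. Qed.
HB.instance Definition _ :=
  GRing.isLinear.Build R V (lmod_quot N) *:%R lmod_pi lmod_pi_linear.

End Quotient.
End Submodules.

Arguments lmod_pi {R V} N x.

Section FreeModule.
Variables (R : comNzRingType) (K : choiceType) (M : lmodType R) (f : K -> M).

Definition free_lift : {freeg K / R} -> M := fglift f.

Lemma free_liftU k : free_lift << k >> = f k.
Proof. by rewrite /free_lift liftU scale1r. Qed.

Lemma free_lift_linear : linear free_lift.
Proof.
have fD x y : free_lift (x + y) = free_lift x + free_lift y.
  have fB := lift_is_additive f; have f0 : fglift f 0 = 0.
    by rewrite -(subrr 0) fB subrr.
  by rewrite -[y in LHS]opprK /free_lift fB -[- y]sub0r fB f0 sub0r opprK.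
have f0 : free_lift 0 = 0 by apply: (addrI (free_lift 0)); rewrite -fD !addr0.
move=> a x y; rewrite fD; congr (_ + _).
have fsum (r : seq K) (F : K -> {freeg K / R}) :
    free_lift (\sum_(k <- r) F k) = \sum_(k <- r) free_lift (F k).
  by elim: r => [|k r IH]; rewrite ?big_nil // !big_cons fD IH.
rewrite -[in RHS](freeg_sumE x) fsum [in LHS]/GRing.scale /= /fgscale fsum.
by rewrite scaler_sumr; apply: eq_bigr => k _; rewrite /free_lift !liftU scalerA.
Qed.
HB.instance Definition _ :=
  GRing.isLinear.Build R {freeg K / R} M *:%R free_lift free_lift_linear.

End FreeModule.

Section LinearMaps.
Variables (R : comNzRingType) (A B C : lmodType R).

Definition lker (f : {linear A -> B}) : {pred A} := fun x => f x == 0.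

Lemma lker_closed (f : {linear A -> B}) : submod_closed (lker f).
Proof.
split=> [|a x y /eqP fx /eqP fy]; apply/eqP; first exact: raddf0.
by rewrite linearP fx fy scaler0 addr0.
Qed.
HB.instance Definition _ f :=
  GRing.isSubmodClosed.Build R A (lker f) (lker_closed f).

Definition limg_in (f : {linear A -> B}) (Z : submodClosed B) :
  {pred submod Z} := fun z => `[< exists x, f x = val z >].

Lemma limg_in_closed f Z : submod_closed (@limg_in f Z).
Proof.
split=> [|a z t /asboolP[x fx] /asboolP[y fy]]; apply/asboolP.
  by exists 0; rewrite !raddf0.
by exists (a *: x + y); rewrite !linearP fx fy.
Qed.
HB.instance Definition _ f Z :=
  GRing.isSubmodClosed.Build R (submod Z) (@limg_in f Z) (limg_in_closed f Z).

(* Z / (Z \cap im f): the homology at B of a complex A -> B -> C, for Z the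
   kernel of B -> C. *)
Definition homology (f : {linear A -> B}) (Z : submodClosed B) : lmodType R :=
  lmod_quot (@limg_in f Z).

End LinearMaps.

Definition exact_at (A B C : zmodType) (f : A -> B) (g : B -> C) :=
  range f = [set y | g y = 0].

Section Tensor.
Variables (R : comNzRingType) (A B : lmodType R).

Local Notation tensor_free := {freeg (A * B)%type / R}.

Definition tensor_rel : set tensor_free := fun z =>
  [\/ exists a a' b, z = << (a + a', b) >> - << (a, b) >> - << (a', b) >>,
      exists a b b', z = << (a, b + b') >> - << (a, b) >> - << (a, b') >>,
      exists r a b, z = << (r *: a, b) >> - r *: << (a, b) >> |
      exists r a b, z = << (a, r *: b) >> - r *: << (a, b) >>].

Definition tensor : lmodType R := lmod_quot (submod_span tensor_rel).

Definition tmul (a : A) (b : B) : tensor :=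
  lmod_pi (submod_span tensor_rel) << (a, b) >>.

Lemma tmulDl a a' b : tmul (a + a') b = tmul a b + tmul a' b.
Proof.
rewrite /tmul -raddfD; apply/lmod_pi_eq/asboolP => N; apply.
by rewrite opprD addrA; constructor 1; exists a, a', b.
Qed.

Lemma tmulDr a b b' : tmul a (b + b') = tmul a b + tmul a b'.
Proof.
rewrite /tmul -raddfD; apply/lmod_pi_eq/asboolP => N; apply.
by rewrite opprD addrA; constructor 2; exists a, b, b'.
Qed.

Lemma tmulZl r a b : tmul (r *: a) b = r *: tmul a b.
Proof.
rewrite /tmul -linearZ; apply/lmod_pi_eq/asboolP => N; apply.
by constructor 3; exists r, a, b.
Qed.

Lemma tmulZr r a b : tmul a (r *: b) = r *: tmul a b.
Proof.
rewrite /tmul -linearZ; apply/lmod_pi_eq/asboolP => N; apply.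
by constructor 4; exists r, a, b.
Qed.

End Tensor.

(* f \otimes id_M *)
Section TensorMap.
Variables (R : comNzRingType) (A B M : lmodType R) (f : {linear A -> B}).

Let g (p : A * M) : tensor B M := tmul (f p.1) p.2.

Definition tensor_map (z : tensor A M) : tensor B M :=
  free_lift g (repr (z : Quotient.quot _)).

Lemma tensor_map_pi x :
  tensor_map (lmod_pi (submod_span (@tensor_rel R A M)) x) = free_lift g x.
Proof.
rewrite /tensor_map; set y := repr _.
have /lmod_pi_eq : lmod_pi (submod_span (@tensor_rel R A M)) y =
                   lmod_pi (submod_span (@tensor_rel R A M)) x.
  by rewrite /lmod_pi reprK.
move=> /asboolP /(_ (lker (free_lift g))) yx.
apply/eqP; rewrite -subr_eq0 -raddfB; apply: yx => z rz.
apply/eqP; case: rz => -[r [a [b ->]]]; rewrite !raddfB /=; try rewrite linearZ /=;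
  rewrite !free_liftU /g /=.
- by rewrite linearD tmulDl -addrA -opprD subrr.
- by rewrite tmulDr -addrA -opprD subrr.
- by rewrite linearZ tmulZl subrr.
- by rewrite tmulZr subrr.
Qed.

Lemma tensor_map_tmul a m : tensor_map (tmul a m) = tmul (f a) m.
Proof. by rewrite tensor_map_pi free_liftU. Qed.

Lemma tensor_map_linear : linear tensor_map.
Proof.
move=> r z t; case: (lmod_pi_surj z) (lmod_pi_surj t) => x -> [y ->].
by rewrite -linearP !tensor_map_pi linearP.
Qed.
HB.instance Definition _ :=
  GRing.isLinear.Build R (tensor A M) (tensor B M) *:%R tensor_map
    tensor_map_linear.

End TensorMap.

Arguments tensor_map {R A B} M f z.

(* The canonical free resolution ... -> F_2 -> F_1 -> F_0 -> T -> 0 of T: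
   K_0 = T, F_n is the free module on the set K_n, and K_(n+1) is the kernel
   of the canonical surjection F_n -> K_n. *)
Section Tor.
Variables (R : comNzRingType).

Definition free_cover (A : lmodType R) : {freeg A / R} -> A := free_lift id.
HB.instance Definition _ A := GRing.Linear.on (@free_cover A).

Fixpoint syzygy (T : lmodType R) (n : nat) : lmodType R :=
  if n is n'.+1 then submod (lker (@free_cover (syzygy T n'))) else T.

Definition resolution (T : lmodType R) (n : nat) : lmodType R :=
  {freeg (syzygy T n) / R}.

Definition resolution_d (T : lmodType R) (n : nat) :
    resolution T n.+1 -> resolution T n :=
  fun x => val (free_cover x : submod (lker (@free_cover (syzygy T n)))).

Lemma resolution_d_linear T n : linear (@resolution_d T n).
Proof. by move=> a x y; rewrite /resolution_d !linearP. Qed.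
HB.instance Definition _ T n :=
  GRing.isLinear.Build R (resolution T n.+1) (resolution T n) *:%R
    (@resolution_d T n) (@resolution_d_linear T n).

Definition Tor_cycles (T M : lmodType R) (n : nat) :
    submodClosed (tensor (resolution T n) M) :=
  if n is n'.+1 then lker (tensor_map M (@resolution_d T n'))
  else submod_span setT.

Definition Tor (n : nat) (T M : lmodType R) : lmodType R :=
  homology (tensor_map M (@resolution_d T n)) (Tor_cycles T M n).

Definition flat (M : lmodType R) :=
  forall (A B : lmodType R) (f : {linear A -> B}),
    injective f -> injective (tensor_map M f).

End Tor.

Section Localization.
Variable R : comNzRingType.

(* 0 is excluded so that localized rings are nontrivial. *)
Record mulset := MulSet {
  mulset_pred :> {pred R};
  mulset1 : 1 \in mulset_pred;
  mulsetM : {in mulset_pred &, forall s t, s * t \in mulset_pred};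
  mulset0 : 0 \notin mulset_pred }.

Record denom (S : mulset) := Denom { dval : R; dvalP : dval \in S }.
HB.instance Definition _ (S : mulset) := [isSub of denom S for @dval S].
HB.instance Definition _ (S : mulset) := [Choice of denom S by <:].

Definition denom1 S : denom S := Denom (mulset1 S).
Definition denomM S (s t : denom S) : denom S :=
  Denom (mulsetM (dvalP s) (dvalP t)).

Section Module.
Variables (S : mulset) (M : lmodType R).

Definition frac_eqv (p q : M * denom S) : bool :=
  `[< exists u : denom S, (dval u * dval q.2) *: p.1 = (dval u * dval p.2) *: q.1 >].

Lemma frac_eqv_refl : reflexive frac_eqv.
Proof. by move=> p; apply/asboolP; exists (denom1 S). Qed.
Lemma frac_eqv_sym : symmetric frac_eqv.
Proof. by move=> p q; apply/asboolP/asboolP => -[u eu]; exists u. Qed.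
Lemma frac_eqv_trans : transitive frac_eqv.
Proof.
move=> [y t] [x s] [z r] /asboolP[u /= eu] /asboolP[v /= ev].
apply/asboolP; exists (denomM t (denomM u v)) => /=.
transitivity ((dval v * dval r) *: ((dval u * dval t) *: x)).
  by rewrite scalerA; congr (_ *: _); ring.
rewrite eu scalerA; transitivity ((dval u * dval s) *: ((dval v * dval r) *: y)).
  by rewrite scalerA; congr (_ *: _); ring.
by rewrite ev scalerA; congr (_ *: _); ring.
Qed.
Canonical frac_eqv_equiv :=
  EquivRel frac_eqv frac_eqv_refl frac_eqv_sym frac_eqv_trans.

(* The module of fractions S^-1 M *)
Definition loc := {eq_quot frac_eqv}.
HB.instance Definition _ := Choice.on loc.

Definition frac (m : M) (s : denom S) : loc := \pi_({eq_quot frac_eqv}) (m, s).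

Lemma fracP m s n t :
  frac m s = frac n t <-> exists u : denom S, (dval u * dval t) *: m = (dval u * dval s) *: n.
Proof.
split=> [/eqquotP/asboolP //|h].
exact/eqquotP/asboolP.
Qed.

Lemma frac_surj (x : loc) : exists m s, x = frac m s.
Proof.
exists (repr (x : {eq_quot frac_eqv})).1, (repr (x : {eq_quot frac_eqv})).2.
by rewrite /frac -surjective_pairing reprK.
Qed.

Lemma frac_repr m s (p := repr (frac m s : {eq_quot frac_eqv})) :
  exists u : denom S, (dval u * dval s) *: p.1 = (dval u * dval p.2) *: m.
Proof. by apply/fracP; rewrite /frac -surjective_pairing reprK. Qed.

Definition loc0 : loc := frac 0 (denom1 S).
Definition locN (x : loc) : loc :=
  let p := repr (x : {eq_quot frac_eqv}) in frac (- p.1) p.2.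
Definition locD (x y : loc) : loc :=
  let p := repr (x : {eq_quot frac_eqv}) in
  let q := repr (y : {eq_quot frac_eqv}) in
  frac (dval q.2 *: p.1 + dval p.2 *: q.1) (denomM p.2 q.2).

Lemma locNE m s : locN (frac m s) = frac (- m) s.
Proof.
rewrite /locN; case: (frac_repr m s) => u /=; set p := repr _ => e.
by apply/fracP; exists u; rewrite !scalerN e.
Qed.

Lemma locDE m s n t :
  locD (frac m s) (frac n t) = frac (dval t *: m + dval s *: n) (denomM s t).
Proof.
rewrite /locD; case: (frac_repr m s) (frac_repr n t) => u /=.
set p := repr _ => eu [v]; set q := repr _ => ev.
apply/fracP; exists (denomM u v) => /=; rewrite !scalerDr !scalerA.
congr (_ + _).
  transitivity ((dval v * dval q.2 * dval t) *: ((dval u * dval s) *: p.1)).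
    by rewrite scalerA; congr (_ *: _); ring.
  by rewrite eu scalerA; congr (_ *: _); ring.
transitivity ((dval u * dval p.2 * dval s) *: ((dval v * dval t) *: q.1)).
  by rewrite scalerA; congr (_ *: _); ring.
by rewrite ev scalerA; congr (_ *: _); ring.
Qed.

Fact locDA : associative locD.
Proof.
move=> x y z; case: (frac_surj x) (frac_surj y) (frac_surj z).
move=> m [s ->] [n [t ->]] [k [r ->]]; rewrite !locDE.
apply/fracP; exists (denom1 S); rewrite /= !(scalerDr, scalerA) addrA.
by congr (_ *: _ + _ *: _ + _ *: _); ring.
Qed.

Fact locDC : commutative locD.
Proof.
move=> x y; case: (frac_surj x) (frac_surj y) => m [s ->] [n [t ->]].
rewrite !locDE addrC; apply/fracP; exists (denom1 S) => /=.
by congr (_ *: _); ring.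
Qed.

Fact loc0D : left_id loc0 locD.
Proof.
move=> x; case: (frac_surj x) => m [s ->]; rewrite locDE scaler0 add0r.
by apply/fracP; exists (denom1 S); rewrite /= scalerA; congr (_ *: _); ring.
Qed.

Fact locND : left_inverse loc0 locN locD.
Proof.
move=> x; case: (frac_surj x) => m [s ->]; rewrite locNE locDE.
by rewrite scalerN addNr; apply/fracP; exists (denom1 S); rewrite !scaler0.
Qed.
HB.instance Definition _ := GRing.isZmodule.Build loc locDA locDC loc0D locND.

Lemma fracD m s n t :
  frac m s + frac n t = frac (dval t *: m + dval s *: n) (denomM s t).
Proof. exact: locDE. Qed.

Lemma frac0 s : frac 0 s = 0.
Proof. by apply/fracP; exists (denom1 S); rewrite !scaler0. Qed.

End Module.

Arguments frac {S M} m s.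

Definition loc_scale (S : mulset) (M : lmodType R)
    (a : loc S R^o) (x : loc S M) : loc S M :=
  let p := repr (a : {eq_quot @frac_eqv S R^o}) in
  let q := repr (x : {eq_quot @frac_eqv S M}) in
  frac ((p.1 : R) *: q.1) (denomM p.2 q.2).

Lemma loc_scaleE (S : mulset) (M : lmodType R) (r : R) (s : denom S) (m : M) (t : denom S) :
  loc_scale (frac (r : R^o) s) (frac m t) = frac (r *: m) (denomM s t).
Proof.
rewrite /loc_scale; case: (frac_repr (r : R^o) s) (frac_repr m t) => u /=.
set p := repr _ => eu [v]; set q := repr _ => ev.
apply/fracP; exists (denomM u v) => /=; rewrite !scalerA.
transitivity ((dval u * dval s * (p.1 : R)) *: ((dval v * dval t) *: q.1)).
  by rewrite scalerA; congr (_ *: _); ring.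
have -> : dval u * dval s * (p.1 : R) = dval u * dval p.2 * r by exact: eu.
by rewrite ev scalerA; congr (_ *: _); ring.
Qed.

Section Scale.
Variables (S : mulset) (M : lmodType R).
Implicit Types (a b : loc S R^o) (x y : loc S M).

Fact loc_scaleA a b x : loc_scale a (loc_scale b x) = loc_scale (loc_scale a b) x.
Proof.
case: (frac_surj a) (frac_surj b) (frac_surj x).
move=> r [s ->] [r' [s' ->]] [m [t ->]]; rewrite (loc_scaleE r' s' m t) (loc_scaleE r s (r' *: m)).
rewrite (@loc_scaleE S R^o r s r' s') loc_scaleE.
apply/fracP; exists (denom1 S); rewrite /= !scalerA; congr (_ *: _).
by rewrite /GRing.scale /=; ring.
Qed.

Fact loc_scale1 : left_id (frac (1 : R^o) (denom1 S)) (@loc_scale S M).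
Proof.
move=> x; case: (frac_surj x) => m [t ->]; rewrite loc_scaleE scale1r.
by apply/fracP; exists (denom1 S); congr (_ *: _); rewrite /=; ring.
Qed.

Fact loc_scaleDr : right_distributive (@loc_scale S M) +%R.
Proof.
move=> a x y; case: (frac_surj a) (frac_surj x) (frac_surj y).
move=> r [s ->] [m [t ->]] [n [t' ->]]; rewrite fracD !loc_scaleE fracD.
apply/fracP; exists (denom1 S); rewrite /= !(scalerDr, scalerA).
by congr (_ *: _ + _ *: _); ring.
Qed.

Fact loc_scaleDl x : {morph (@loc_scale S M)^~ x : a b / a + b}.
Proof.
move=> a b; case: (frac_surj a) (frac_surj b) (frac_surj x).
move=> r [s ->] [r' [s' ->]] [m [t ->]]; rewrite fracD !loc_scaleE fracD.
apply/fracP; exists (denom1 S); rewrite /= !(scalerDr, scalerA) -!scalerDl.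
by congr (_ *: _); rewrite /GRing.scale /=; ring.
Qed.

End Scale.

(* The ring of fractions S^-1 R *)
Definition ring_loc (S : mulset) := loc S R^o.
HB.instance Definition _ (S : mulset) := GRing.Zmodule.on (ring_loc S).

Section RingLoc.
Variable S : mulset.

Definition rfrac (r : R) (s : denom S) : ring_loc S := frac (r : R^o) s.
Definition rmul (a b : ring_loc S) : ring_loc S := loc_scale a b.

Lemma rfracP r s r' s' : rfrac r s = rfrac r' s' <->
  exists u : denom S, dval u * dval s' * r = dval u * dval s * r'.
Proof. exact: fracP. Qed.

Lemma rmulE r s r' s' :
  rmul (rfrac r s) (rfrac r' s') = rfrac (r * r') (denomM s s').
Proof. exact: loc_scaleE. Qed.

Fact rmulA : associative rmul. Proof. exact: loc_scaleA. Qed.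
Fact rmulC : commutative rmul.
Proof.
move=> a b; case: (frac_surj a) (frac_surj b) => r [s ->] [r' [s' ->]].
rewrite !rmulE; apply/rfracP; exists (denom1 S) => /=; ring.
Qed.
Fact rmul1 : left_id (rfrac 1 (denom1 S)) rmul.
Proof. exact: loc_scale1. Qed.
Fact rmulDl : left_distributive rmul +%R.
Proof. by move=> a b c; exact: loc_scaleDl. Qed.
Fact ring_loc_neq0 : rfrac 1 (denom1 S) != 0 :> ring_loc S.
Proof.
apply/eqP => /rfracP[u /=]; rewrite mulr0 !mulr1 => u0.
by have /negP := mulset0 S; apply; rewrite -u0 dvalP.
Qed.
HB.instance Definition _ := GRing.Zmodule_isComNzRing.Build (ring_loc S)
  rmulA rmulC rmul1 rmulDl ring_loc_neq0.

HB.instance Definition _ (M : lmodType R) :=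
  GRing.Zmodule_isLmodule.Build (ring_loc S) (loc S M)
    (@loc_scaleA S M) (@loc_scale1 S M) (@loc_scaleDr S M) (@loc_scaleDl S M).

Definition rloc (r : R) : ring_loc S := rfrac r (denom1 S).

End RingLoc.
End Localization.

Section LocMap.
Variables (R : comNzRingType) (S : mulset R).

Definition loc_map (M N : lmodType R) (f : {linear M -> N}) (x : loc S M) :
    loc S N :=
  let p := repr (x : {eq_quot @frac_eqv R S M}) in frac (f p.1) p.2.

Lemma loc_mapE (M N : lmodType R) (f : {linear M -> N}) m (s : denom S) :
  loc_map f (frac m s) = frac (f m) s.
Proof.
rewrite /loc_map; case: (frac_repr m s) => u; set p := repr _ => e.
by apply/fracP; exists u; rewrite -!linearZ e.
Qed.

Lemma fracZ (M : lmodType R) (r : R) (s : denom S) (m : M) (t : denom S) :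
  rfrac r s *: frac m t = frac (r *: m) (denomM s t).
Proof. exact: loc_scaleE. Qed.

Lemma loc_map_linear (M N : lmodType R) (f : {linear M -> N}) : linear (loc_map f).
Proof.
move=> a x y; case: (frac_surj a) (frac_surj x) (frac_surj y).
move=> r [s ->] [m [t ->]] [n [t' ->]].
rewrite -[frac r s]/(@rfrac R S r s) fracZ fracD !loc_mapE.
by rewrite fracZ fracD linearD !(linearZ_LR f).
Qed.
HB.instance Definition _ (M N : lmodType R) (f : {linear M -> N}) :=
  GRing.isLinear.Build (ring_loc S) (loc S M) (loc S N) *:%R (loc_map f)
    (loc_map_linear f).

Variables (T : mulset R) (ST : {subset S <= T}).

(* S^-1 R -> T^-1 R, a/s |-> a/s *)
Definition ring_loc_incl (a : ring_loc S) : ring_loc T :=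
  let p := repr (a : {eq_quot @frac_eqv R S R^o}) in
  @rfrac R T p.1 (Denom (ST (dvalP p.2))).

Lemma ring_loc_inclE r s :
  ring_loc_incl (rfrac r s) = rfrac r (Denom (ST (dvalP s))).
Proof.
rewrite /ring_loc_incl; case: (frac_repr (r : R^o) s) => u; set p := repr _ => e.
by apply/rfracP; exists (Denom (ST (dvalP u))).
Qed.

Lemma ring_loc_incl_additive : zmod_morphism ring_loc_incl.
Proof.
have inclD a b : ring_loc_incl (a + b) = ring_loc_incl a + ring_loc_incl b.
  case: (frac_surj a) (frac_surj b) => r [s ->] [r' [s' ->]].
  rewrite fracD !ring_loc_inclE /rfrac fracD; apply/fracP.
  by exists (denom1 T).
have incl0 : ring_loc_incl 0 = 0.
  by apply: (addrI (ring_loc_incl 0)); rewrite -inclD !addr0.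
move=> a b; rewrite inclD; congr (_ + _).
by apply: (addrI (ring_loc_incl b)); rewrite -inclD !subrr.
Qed.

Lemma ring_loc_incl_multiplicative : monoid_morphism ring_loc_incl.
Proof.
split; first by rewrite ring_loc_inclE; apply/rfracP; exists (denom1 T).
move=> a b; case: (frac_surj a) (frac_surj b) => r [s ->] [r' [s' ->]].
rewrite [_ * _]rmulE !ring_loc_inclE [RHS]rmulE.
by apply/rfracP; exists (denom1 T).
Qed.
HB.instance Definition _ := GRing.isZmodMorphism.Build
  (ring_loc S) (ring_loc T) ring_loc_incl ring_loc_incl_additive.
HB.instance Definition _ := GRing.isMonoidMorphism.Build
  (ring_loc S) (ring_loc T) ring_loc_incl ring_loc_incl_multiplicative.

End LocMap.

Section Ideals.
Variable R : comNzRingType.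

Definition nilradical : {pred R^o} := fun x => `[< exists n, (x : R) ^+ n = 0 >].

Lemma nilradical_closed : submod_closed nilradical.
Proof.
split=> [|a x y /asboolP[m xm] /asboolP[n yn]]; apply/asboolP.
  by exists 1; rewrite expr1.
exists (m + n); rewrite exprDn big1 // => i _.
have [ni|ni] := leqP n i.
  by rewrite -(subnK ni) [(y : R) ^+ _]exprD yn !mulr0 mul0rn.
have mi : (m <= m + n - i)%N by rewrite -addnBA ?leq_addr // ltnW.
by rewrite -(subnK mi) exprMn [(x : R) ^+ _]exprD xm !(mulr0, mul0r) mul0rn.
Qed.
HB.instance Definition _ :=
  GRing.isSubmodClosed.Build R R^o nilradical nilradical_closed.

Definition prime_ideal (P : ideal R) :=
  (1 : R) \notin P /\ prime_idealr_closed (P : {pred R}).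

Definition divided_prime (P : ideal R) :=
  prime_ideal P /\
  forall x : R, x \notin P -> [set` P] `<` [set r * x | r in [set: R]].

Definition phi_ring := divided_prime nilradical.

Definition zero_divisors : set R := [set x | exists2 y, y != 0 & x * y = 0].

Definition strongly_phi_ring := phi_ring /\ zero_divisors = [set` nilradical].

Definition nonnil (I : ideal R) := exists2 x : R, x \in I & x \notin nilradical.

Definition regular : {pred R} := fun x => `[< ~ zero_divisors x >].

Lemma regularP x : x \in regular <-> (forall y, x * y = 0 -> y = 0).
Proof.
split=> [/asboolP h y xy|h]; last first.
  by apply/asboolP => -[y y0 /h]; exact/eqP.
by apply: contra_notP h => /eqP y0; exists y.
Qed.

Lemma regular1 : 1 \in regular.
Proof. by apply/regularP => y; rewrite mul1r. Qed.
Lemma regularM : {in regular &, forall s t, s * t \in regular}.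
Proof.
move=> s t /regularP hs /regularP ht; apply/regularP => y.
by rewrite -mulrA => /hs/ht.
Qed.
Lemma regular0 : 0 \notin regular.
Proof.
apply/negP => /regularP /(_ 1 (mul0r _)) /eqP.
by rewrite (negPf (oner_neq0 _)).
Qed.
Definition regulars : mulset R := MulSet regular1 regularM regular0.

(* T(R) *)
Definition total_ring : comNzRingType := ring_loc regulars.

Section PrimeComplement.
Variables (P : ideal R) (prP : prime_ideal P).

Definition prime_compl_pred : {pred R} := [pred x : R | x \notin P].
Lemma prime_compl1 : 1 \in prime_compl_pred.
Proof. by case: prP. Qed.
Lemma prime_complM :
  {in prime_compl_pred &, forall s t, s * t \in prime_compl_pred}.
Proof.
move=> s t; rewrite !inE => /negPf sP /negPf tP; apply/negP.
by case: prP => _ /[apply]; rewrite sP tP.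
Qed.
Lemma prime_compl0 : 0 \notin prime_compl_pred.
Proof. by rewrite inE negbK; exact: rpred0. Qed.
Definition prime_compl : mulset R :=
  MulSet prime_compl1 prime_complM prime_compl0.

End PrimeComplement.

End Ideals.

Arguments nilradical R : clear implicits.
Arguments regulars R : clear implicits.

Section PhiMap.
Variables (R : comNzRingType) (prN : prime_ideal (nilradical R)).

Lemma regular_nonnil : {subset regulars R <= prime_compl prN}.
Proof.
move=> x /regularP hx; rewrite inE; apply/negP => /asboolP[n].
elim: n => [/eqP|n IH]; first by rewrite expr0 (negPf (oner_neq0 _)).
by rewrite exprS => /hx.
Qed.

(* phi : T(R) -> R_Nil(R) *)
Definition phi : total_ring R -> ring_loc (prime_compl prN) :=
  ring_loc_incl regular_nonnil.
HB.instance Definition _ := GRing.RMorphism.on phi.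

Lemma phiE (a : R) (b : denom (regulars R)) :
  phi (rfrac a b) = rfrac a (Denom (regular_nonnil (dvalP b))).
Proof. exact: ring_loc_inclE. Qed.

End PhiMap.

Section PhiImage.
Variables (R : comNzRingType) (prN : prime_ideal (nilradical R)).

Definition phi_image : {pred ring_loc (prime_compl prN)} :=
  fun y => `[< exists a : R, y = phi prN (rloc (regulars R) a) >].

Lemma rlocB (S : mulset R) (a b : R) : rloc S (a - b) = rloc S a - rloc S b.
Proof.
have rlocD x y : rloc S (x + y) = rloc S x + rloc S y.
  rewrite [RHS]fracD; apply/rfracP; exists (denom1 S) => /=.
  by rewrite /GRing.scale /=; ring.
by apply: (addIr (rloc S b)); rewrite -rlocD !subrK.
Qed.

Lemma rlocM (S : mulset R) (a b : R) : rloc S (a * b) = rloc S a * rloc S b.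
Proof.
by rewrite [RHS]rmulE; apply/rfracP; exists (denom1 S) => /=; ring.
Qed.

Lemma phi_image_closed : subring_closed phi_image.
Proof.
split=> [|x y /asboolP[a ->] /asboolP[b ->]|x y /asboolP[a ->] /asboolP[b ->]];
  apply/asboolP.
- by exists 1; rewrite -[rloc _ _]/(1 : total_ring R) rmorph1.
- by exists (a - b); rewrite rlocB rmorphB.
- by exists (a * b); rewrite rlocM rmorphM.
Qed.

(* The ring phi(R) *)
Record phiR := PhiR { phiR_val : ring_loc (prime_compl prN);
                      phiR_valP : phiR_val \in phi_image }.
HB.instance Definition _ := [isSub of phiR for phiR_val].
HB.instance Definition _ := [Choice of phiR by <:].
HB.instance Definition _ :=
  GRing.SubChoice_isSubComNzRing.Build _ _ phiR phi_image_closed.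

(* The ideal phi(I) of phi(R) *)
Definition phi_ideal (I : ideal R) : set phiR :=
  [set y | exists2 a : R, a \in I & phiR_val y = phi prN (rloc (regulars R) a)].

End PhiImage.

Arguments phi_ideal {R} prN I _.

Section Gv.
Variable R : comNzRingType.

Definition mul_hom (J : ideal R) (r : R) : submod J -> R^o :=
  fun x => r * (val x : R).

Lemma mul_hom_linear J r : linear (@mul_hom J r).
Proof.
by move=> a x y; rewrite /mul_hom linearP /= mulrDr {1}/GRing.scale /= mulrCA.
Qed.
HB.instance Definition _ J r :=
  GRing.isLinear.Build R (submod J) R^o *:%R (@mul_hom J r) (mul_hom_linear r).

Definition GV_ideal (J : ideal R) :=
  fg_submod J /\
  bijective (fun r : R => @mul_hom J r : {linear submod J -> R^o}).

Definition GV_torsion (M : lmodType R) :=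
  forall x : M, exists2 J : ideal R, GV_ideal J &
    forall r : R, r \in J -> r *: x = 0.

Definition GV_torsion_free (M : lmodType R) :=
  forall (J : ideal R) (x : M), GV_ideal J ->
    (forall r : R, r \in J -> r *: x = 0) -> x = 0.

Definition injective_module (E : lmodType R) :=
  forall (A B : lmodType R) (f : {linear A -> B}) (g : {linear A -> E}),
    injective f -> exists h : {linear B -> E}, forall x, h (f x) = g x.

(* (E, i) is an injective envelope of M: E is an injective essential
   extension of i(M) *)
Definition injective_envelope (M E : lmodType R) (i : {linear M -> E}) :=
  [/\ injective i, injective_module E &
      forall N : submodClosed E, (exists2 x, x \in N & x != 0) ->
        exists2 m, i m \in N & i m != 0].

Definition w_module (M : lmodType R) :=
  GV_torsion_free M /\
  exists (E : lmodType R) (i : {linear M -> E}), injective_envelope i /\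
    forall (x : E) (J : ideal R), GV_ideal J ->
      (forall r : R, r \in J -> range i (r *: x)) -> range i x.

Definition w_ideal (I : ideal R) := w_module (submod I).

Definition w_Max (P : ideal R) :=
  [/\ w_ideal P, (1 : R) \notin P &
      forall Q : ideal R, w_ideal Q -> (1 : R) \notin Q ->
        {subset P <= Q} -> Q =i P].

(* I_w, for an ideal I given as a set *)
Definition w_op (I : set R) : set R :=
  [set x | exists2 J : ideal R, GV_ideal J & forall r, r \in J -> I (r * x)].

(* I^-1 *)
Definition ideal_inv (I : set R) : set (total_ring R) :=
  [set x | forall a, I a -> range (rloc (regulars R)) (rloc (regulars R) a * x)].

(* The ideal I I^-1 of R: sums of products inside T(R), pulled back to R *)
Definition ideal_mul_inv (I : set R) : set R :=
  [set s | exists (n : nat) (a : 'I_n -> R) (b : 'I_n -> total_ring R),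
     [/\ forall i, I (a i), forall i, ideal_inv I (b i) &
         rloc (regulars R) s = \sum_(i < n) rloc (regulars R) (a i) * b i]].

Definition w_invertible (I : set R) := w_op (ideal_mul_inv I) = [set: R].

(* The maximal w-ideals are automatically prime, so that hP only serves to
   name the multiplicative set R \ P. *)
Definition w_exact (A B C : lmodType R) (f : {linear A -> B})
    (g : {linear B -> C}) :=
  forall (P : ideal R) (hP : prime_ideal P), w_Max P ->
    exact_at (@loc_map R (prime_compl hP) A B f)
             (@loc_map R (prime_compl hP) B C g).

Definition finite_type (M : lmodType R) :=
  exists (n : nat) (g : {linear 'rV[R]_n -> M}),
    w_exact g (\0 : {linear M -> 'rV[R]_0}).

Definition w_flat (M : lmodType R) :=
  forall N : lmodType R, GV_torsion (Tor 1 N M).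

Definition phi_torsion (T : lmodType R) :=
  forall x : T, exists2 I : ideal R, nonnil I &
    forall r : R, r \in I -> r *: x = 0.

Definition strongly_phi_w_flat (M : lmodType R) :=
  forall T : lmodType R, phi_torsion T ->
    forall n : nat, (1 <= n)%N -> GV_torsion (Tor n T M).

(* There is a w-exact sequence
   0 -> F_n -> ... -> F_1 -> F_0 -> M -> 0 with all F_i strongly phi-w-flat;
   the left 0 is F_(n+1), and the F_i with i > n+1 are irrelevant. *)
Definition phi_w_resolution (M : lmodType R) (n : nat) :=
  exists (F : nat -> lmodType R) (d : forall i, {linear F i.+1 -> F i})
         (e : {linear F 0 -> M}),
    [/\ forall i, (i <= n)%N -> strongly_phi_w_flat (F i),
        forall x : F n.+1, x = 0,
        w_exact e (\0 : {linear M -> 'rV[R]_0}),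
        w_exact (d 0) e &
        forall i, (i < n)%N -> w_exact (d i.+1) (d i)].

End Gv.

(* Extended natural numbers, None being infinity *)
Definition enat_le (m n : option nat) : bool :=
  match m, n with
  | _, None => true
  | None, Some _ => false
  | Some m, Some n => (m <= n)%N
  end.

Definition enat_inf (A : set nat) : option nat :=
  if pselect (exists n, `[< A n >]) is left h then Some (ex_minn h) else None.

Definition phi_s_w_fd (R : comNzRingType) (M : lmodType R) : option nat :=
  enat_inf (phi_w_resolution M).

(* The supremum of the phi_s_w_fd M is the least of their upper bounds *)
Definition phi_w_wgldim (R : comNzRingType) : option nat :=
  enat_inf [set n | forall M : lmodType R, enat_le (phi_s_w_fd M) (Some n)].

Definition phi_PvMR (R : comNzRingType) (hR : phi_ring R) :=
  forall I : ideal R, nonnil I -> fg_submod I ->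
    w_invertible (phi_ideal (proj1 hR) I).

(* Main.v *)
From HB Require Import structures.
From mathcomp Require Import all_boot all_order all_algebra.
From mathcomp Require Import all_classical.
From mathcomp Require Import freeg ring.
Require Import Defs.

(** Call a module GV-torsion if each of its elements is killed by a GV-ideal, and
    let the closure of a submodule N consist of the elements that some GV-ideal
    multiplies into N.  This closure is idempotent and preserved by linear maps
    ([w_closure_trans], [w_closure_map]), so everything can be done globally, up
    to closure, instead of after localization.  Localization at the maximal
    w-ideals only occurs in w-exact sequences, and [w_closure_local] shows that it
    measures the same thing; for this there must be enough maximal w-ideals
    ([w_Max_exists]), and since a w-ideal is defined through an injective
    envelope, the existence of envelopes ([injective_envelope_exists]) is needed.

    The key notion is that of a module M without nonnil torsion: r m GV-torsion
    and r nonnil imply m GV-torsion.  It visibly passes to submodules.  Suppose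
    (1).  Then nonnil elements are regular, R is isomorphic to phi(R), and every
    finitely generated nonnil ideal I has a w-dense trace ideal I I^-1.  Under
    these conditions M has no nonnil torsion iff it is strongly phi-w-flat.  One
    direction looks at Tor_1(R/xR, M), the x-torsion of M
    ([Tor1_nonnil_torsion_free]).  For the other one, let T = F/K be phi-torsion
    with F free: density of traces permits Gaussian elimination on the
    coordinates of the elements of K, and shows that K (x) M -> F (x) M is
    injective up to GV-torsion ([eliminate]), so that Tor_1(T, M) is GV-torsion;
    then Tor_n(T, M) = Tor_(n-1)(T, K') for a submodule K' of a free module, which
    is without nonnil torsion as well ([torsion_free_strongly]).  Since flat,
    w-flat and strongly phi-w-flat modules all have no nonnil torsion, (1) implies
    (3), (4), (5); and it implies (2) because in 0 -> K -> F -> M -> 0 with F free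
    both K and F have no nonnil torsion.  Dense traces also make every nonnil
    ideal w-flat, by a direct computation ([nonnil_w_flat]), which is (7).

    Conversely, (3), (4) and (5) imply (6) because R is flat, and (2) implies (6)
    by dimension shifting, Tor_n(T, J) = Tor_(n+1)(T, R/J)
    ([wgldim_all_ideals]).  Finally (6) and (8) both imply (1).  Either of them
    says that J (x) I -> R is injective up to GV-torsion when I is finitely
    generated and nonnil and J is any ideal: its kernel is Tor_1(R/I, J) as well
    as Tor_1(R/J, I).  Principal ideals J and I then show that nonnil elements are
    regular ([gv_flat_pair_regular]), and the equational criterion of flatness,
    applied to the relations a m_i = m_i a between the generators m_i of I and a
    nonnil a in I, produces elements of I^-1 showing that I I^-1 is w-dense
    ([gv_flat_mul_inv]). *)

Set Implicit Arguments.
Unset Strict Implicit.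
Unset Printing Implicit Defensive.

Import Order.TTheory GRing.Theory Num.Theory.
Local Open Scope ring_scope.
Local Open Scope classical_set_scope.

(** * Submodules and linear maps *)

Section Submodules.
Variables (R : comNzRingType) (V : lmodType R).

Definition to_submod (P : {pred V}) (hP : submod_closed P) : submodClosed V :=
  HB.pack P (GRing.isSubmodClosed.Build R V P hP).

Lemma submod_subr (N : submodClosed V) x y : x \in N -> y \in N -> x - y \in N.
Proof.
move=> xN yN; have [_ hN] := GRing.submodClosedP N.
by rewrite -scaleN1r addrC hN.
Qed.

Lemma mem_span (X : set V) x : X x -> x \in submod_span X.
Proof. by move=> Xx; apply/asboolP => N; apply. Qed.

Lemma span_ind (X : set V) (Q : V -> Prop) :
  (forall x, X x -> Q x) -> Q 0 -> (forall a x y, Q x -> Q y -> Q (a *: x + y)) ->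
  forall x, x \in submod_span X -> Q x.
Proof.
move=> hX h0 hQ x /asboolP hx.
have cQ : submod_closed (fun x => `[< Q x >]).
  by split=> [|a y z /asboolP Qy /asboolP Qz]; apply/asboolP => //; apply: hQ.
by have /asboolP := hx (to_submod cQ) (fun y Xy => asboolT (hX y Xy)).
Qed.

Lemma span_sub (X : set V) (N : submodClosed V) :
  (forall x, X x -> x \in N) -> {subset submod_span X <= N}.
Proof. by move=> h x /asboolP; apply. Qed.

Lemma zero_submod_closed : submod_closed (pred1 (0 : V)).
Proof.
split=> [|a x y]; first exact: eqxx.
by rewrite !inE => /eqP -> /eqP ->; rewrite scaler0 addr0.
Qed.
Definition zero_submod : submodClosed V := to_submod zero_submod_closed.

Lemma mem_zero_submod x : x \in zero_submod <-> x = 0.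
Proof. by split=> [/eqP|->] //; exact: eqxx. Qed.

Definition to_linear (W : lmodType R) (f : V -> W) (hf : linear f) :
  {linear V -> W} := HB.pack f (GRing.isLinear.Build R V W *:%R f hf).

Lemma linear_ext (W : lmodType R) (f g : {linear V -> W}) : f =1 g -> f = g.
Proof.
case: f => f [[fa] [fb]]; case: g => g [[ga] [gb]] /= fg.
have {fg} fg : f = g by apply/funext.
subst g; congr GRing.Linear.Pack; congr GRing.Linear.Class.
  by congr Algebra.isNmodMorphism.Axioms_; exact: Prop_irrelevance.
by congr GRing.isScalable.Axioms_; exact: Prop_irrelevance.
Qed.

End Submodules.

Section Images.
Variables (R : comNzRingType) (A B : lmodType R).

Definition limg (f : {linear A -> B}) : {pred B} := fun y => `[< exists x, f x = y >].
Lemma limg_closed f : submod_closed (limg f).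
Proof.
split=> [|a _ _ /asboolP[x <-] /asboolP[y <-]]; apply/asboolP.
  by exists 0; rewrite raddf0.
by exists (a *: x + y); rewrite linearP.
Qed.
HB.instance Definition _ f := GRing.isSubmodClosed.Build R B (limg f) (limg_closed f).

Lemma limgP (f : {linear A -> B}) y : y \in limg f <-> exists x, f x = y.
Proof. by split=> /asboolP. Qed.

Lemma mem_limg (f : {linear A -> B}) x : f x \in limg f.
Proof. by apply/limgP; exists x. Qed.

Lemma mem_lker (f : {linear A -> B}) x : x \in lker f <-> f x = 0.
Proof. by split=> /eqP. Qed.

Definition preim_submod_pred (f : {linear A -> B}) (N : submodClosed B) : {pred A} :=
  fun x => f x \in N.
Lemma preim_submod_closed f (N : submodClosed B) : submod_closed (preim_submod_pred f N).
Proof.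
split=> [|a x y hx hy]; first by change (f 0 \in N); rewrite raddf0 rpred0.
by change (f (a *: x + y) \in N); rewrite linearP rpredD ?rpredZ.
Qed.
Definition preim_submod (f : {linear A -> B}) (N : submodClosed B) : submodClosed A :=
  to_submod (preim_submod_closed f N).

Lemma mem_preim_submod f (N : submodClosed B) x : (x \in preim_submod f N) = (f x \in N).
Proof. by []. Qed.

End Images.

Definition scale_at (R : comNzRingType) (V : lmodType R) (v : V) : R^o -> V :=
  fun r => r *: v.
Lemma scale_at_linear (R : comNzRingType) (V : lmodType R) (v : V) : linear (scale_at v).
Proof. by move=> a x y; rewrite /scale_at scalerDl scalerA. Qed.
HB.instance Definition _ (R : comNzRingType) (V : lmodType R) (v : V) :=
  GRing.isLinear.Build R R^o V *:%R (scale_at v) (scale_at_linear v).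

(** * The Gabriel topology of GV-ideals *)

Section GV.
Variable R : comNzRingType.
Implicit Types I J G : ideal R.

(** Bijectivity of R -> Hom(J, R), free of equalities between bundled maps. *)
Lemma GV_idealP J : GV_ideal J <->
  [/\ fg_submod J, forall r : R, (forall x, x \in J -> r * x = 0) -> r = 0 &
      forall f : {linear submod J -> R^o}, exists r : R, forall x, f x = r * val x].
Proof.
have mul_homE (r s : R) : (@mul_hom R J r : {linear submod J -> R^o}) = (@mul_hom R J s) <->
    forall x, x \in J -> r * x = s * x.
  split=> [rs x xJ|rs]; last by apply: linear_ext => x; apply: rs (valP x).
  exact: (congr1 (fun f : {linear submod J -> R^o} => f (Submod xJ)) rs).
split=> [[fg [inv invK Kinv]]|[fg inj surj]]; split=> //.
- move=> r hr; rewrite -[r]invK -[RHS]invK; congr inv.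
  by apply/mul_homE => x /hr ->; rewrite mul0r.
- move=> f; exists (inv f) => x.
  by have /(congr1 (fun f : {linear submod J -> R^o} => f x)) /= <- := Kinv f.
have [inv invP] := choice surj.
exists inv => [r|f]; last by apply: linear_ext => x; exact: esym (invP f x).
apply/subr0_eq/inj => x xJ; rewrite mulrBl; apply/eqP; rewrite subr_eq0; apply/eqP.
by have := invP (@mul_hom R J r) (Submod xJ).
Qed.

Lemma GV_ann J (r : R) : GV_ideal J -> (forall x : R, x \in J -> r * x = 0) -> r = 0.
Proof. by move=> /GV_idealP[_ h _]; apply: h. Qed.

Definition ideal1 : ideal R := submod_span [set 1 : R^o].

Lemma GV_ideal1 : GV_ideal ideal1.
Proof.
have one1 : (1 : R^o) \in ideal1 by exact: mem_span.
apply/GV_idealP; split=> [|r /(_ _ one1)|f]; last 2 first.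
- by rewrite mulr1.
- exists (f (Submod one1)) => x.
  have xE : x = (val x : R) *: Submod one1.
    by apply: val_inj; rewrite linearZ /= [RHS]mulr1.
  by rewrite {1}xE linearZ /= mulrC.
exists [:: 1] => x; congr (_ \in submod_span _).
by apply/seteqP; split=> y /=; rewrite inE => /eqP.
Qed.

Definition ideal_mul I J : ideal R :=
  submod_span [set z : R^o | exists x y : R, [/\ x \in I, y \in J & z = x * y]].

(** A map f on I * J is multiplication by a scalar r_x in the second variable,
    for each fixed x in I; and x |-> r_x is itself multiplication by a scalar. *)
Lemma GV_mul I J : GV_ideal I -> GV_ideal J ->
  GV_ideal (ideal_mul I J).
Proof.
move=> gI gJ; have [[s sI] annI homI] := (GV_idealP I).1 gI.
have [[t tJ] annJ homJ] := (GV_idealP J).1 gJ.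
rewrite /ideal_mul; set X := (X in submod_span X).
have XP (x y : R) : x \in I -> y \in J -> (x * y : R^o) \in submod_span X.
  by move=> xI yJ; apply: mem_span; exists x, y.
apply/GV_idealP; split.
- exists [seq x * y : R^o | x <- s, y <- t] => z; apply/idP/idP; last first.
    apply: span_sub => {}z /= /allpairsP[[x y] /= [xs yt ->]].
    by apply: XP; rewrite ?sI ?tJ; apply: mem_span.
  apply: span_sub => {}z [x [y [+ + ->]]]; rewrite sI tJ => xI yJ.
  pose P (x y : R^o) : Prop := ((x : R) * y : R^o) \in
    submod_span [set` [seq x * y : R^o | x <- s, y <- t]].
  change (P x y); move: x xI; apply: (span_ind (V := R^o) (Q := P^~ y)) => [x /= xs| |a x x' hx hx'].
  + move: y yJ; apply: (span_ind (V := R^o) (Q := P x)) => [y yt| |a y y' hy hy'].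
    * by apply: mem_span; apply/allpairsP; exists (x, y).
    * by rewrite /P mulr0 rpred0.
    * rewrite /P mulrDr rpredD //.
      rewrite -[_ * _]/((x : R) * (a * (y : R))) mulrCA.
      exact: (rpredZ a hy).
  + by rewrite /P mul0r rpred0.
  + rewrite /P mulrDl rpredD // -mulrA.
    exact: (rpredZ a hx).
- move=> r hr; apply: annI => x xI; apply: annJ => y yJ.
  by rewrite -mulrA; apply: hr; apply: XP.
move=> f.
have hx (x : submod I) : exists r : R, forall y : submod J,
    f (Submod (XP _ _ (valP x) (valP y))) = r * val y.
  have lin : linear (fun y : submod J => f (Submod (XP _ _ (valP x) (valP y)))).
    move=> a y y'; rewrite -linearP; congr (f _); apply: val_inj.
    rewrite -[LHS]/((val x : R) * (a * (val y : R) + val y')).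
    by rewrite -[RHS]/(a * ((val x : R) * val y) + (val x : R) * val y'); ring.
  by have [r] := homJ (to_linear lin); exists r.
have [h hP] := choice hx.
have hlin : linear (h : submod I -> R^o).
  move=> a x x'; apply/subr0_eq/annJ => y yJ.
  have hE w : h w * y = f (Submod (XP _ _ (valP w) yJ)).
    by rewrite -[y]/(val (Submod yJ)) -hP; congr (f _); apply: val_inj.
  rewrite mulrBl; apply/eqP; rewrite subr_eq0 hE; apply/eqP.
  transitivity ((a * h x + h x') * y); last by [].
  rewrite [RHS]mulrDl -[X in _ = X + _]mulrA !hE.
  rewrite -[RHS]/(a *: f (Submod (XP _ _ (valP x) yJ)) + f (Submod (XP _ _ (valP x') yJ))).
  rewrite -linearP; congr (f _).
  apply: val_inj; rewrite -[LHS]/((a * (val x : R) + val x') * y).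
  by rewrite -[RHS]/(a * ((val x : R) * y) + (val x' : R) * y); ring.
have [r hr] := homI (to_linear hlin).
exists r => z; suff [hz] : exists hz : val z \in submod_span X, f (Submod hz) = r * val z.
  by move=> <-; congr (f _); apply: val_inj.
case: z => z zX /=; move: z zX; apply: span_ind.
- move=> z [x [y [xI yJ ->]]]; exists (XP _ _ xI yJ).
  transitivity (h (Submod xI) * y); last by rewrite [X in X * y](hr (Submod xI)) mulrA.
  rewrite -[y in RHS]/(val (Submod yJ)) -hP; congr (f _); exact: val_inj.
- by exists (rpred0 _); rewrite mulr0 -[RHS](raddf0 f); congr (f _); apply: val_inj.
- move=> a x y [hx1 Ex] [hy1 Ey].
  have hxy : a *: x + y \in submod_span X by rewrite rpredD ?rpredZ.
  exists hxy; have -> : Submod hxy = a *: Submod hx1 + Submod hy1.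
    by apply: val_inj; rewrite linearP.
  by rewrite linearP Ex Ey mulrDr; congr (_ + _); rewrite {1}/GRing.scale /= mulrCA.
Qed.

Lemma GV_inter I J : GV_ideal I -> GV_ideal J ->
  exists2 G, GV_ideal G & forall r, r \in G -> r \in I /\ r \in J.
Proof.
move=> gI gJ; exists (ideal_mul I J); first exact: GV_mul.
apply: span_ind => [z [x [y [xI yJ ->]]]||a x y [xI xJ] [yI yJ]].
- split; last exact: (rpredZ x yJ).
  by rewrite mulrC; apply: (rpredZ y xI).
- by rewrite !rpred0.
- by rewrite !rpredD ?rpredZ.
Qed.

End GV.

Section Closure.
Variable R : comNzRingType.

(** The preimage in V of the GV-torsion submodule of V / N; for an ideal of R it
    is the w-operation. *)
Definition w_closure (V : lmodType R) (N : submodClosed V) : {pred V} :=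
  fun v => `[< exists2 J : ideal R, GV_ideal J & forall r : R, r \in J -> r *: v \in N >].

Lemma w_closure_closed (V : lmodType R) (N : submodClosed V) : submod_closed (w_closure N).
Proof.
split=> [|a x y /asboolP[I gI xI] /asboolP[J gJ yJ]]; apply/asboolP.
  by exists (ideal1 R) => [|r _]; [exact: GV_ideal1 | rewrite scaler0 rpred0].
have [G gG GIJ] := GV_inter gI gJ; exists G => // r /GIJ[rI rJ].
by rewrite scalerDr scalerA mulrC -scalerA rpredD ?yJ // rpredZ ?xI.
Qed.
HB.instance Definition _ (V : lmodType R) (N : submodClosed V) :=
  GRing.isSubmodClosed.Build R V (w_closure N) (w_closure_closed N).

Lemma w_closureP (V : lmodType R) (N : submodClosed V) v : v \in w_closure N <->
  exists2 J : ideal R, GV_ideal J & forall r : R, r \in J -> r *: v \in N.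
Proof. by split=> /asboolP. Qed.

Lemma sub_w_closure (V : lmodType R) (N : submodClosed V) : {subset N <= w_closure N}.
Proof.
move=> x xN; apply/w_closureP; exists (ideal1 R) => [|r _].
  exact: GV_ideal1.
exact: rpredZ.
Qed.

(** For each of the finitely many generators g of J there is a GV-ideal H_g with
    H_g g v in N; the product of J and of all the H_g multiplies v into N. *)
Lemma w_closure_trans (V : lmodType R) (N : submodClosed V) (J : ideal R) v : GV_ideal J ->
  (forall r : R, r \in J -> r *: v \in w_closure N) -> v \in w_closure N.
Proof.
move=> gJ JN; have [[s sJ] _] := gJ.
have {JN} sN : forall r : R^o, r \in s -> (r : R) *: v \in w_closure N.
  by move=> r rs; apply: JN; rewrite sJ; apply: mem_span.
have [H gH HN] : exists2 H : ideal R, GV_ideal H &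
    forall h r : R, h \in H -> (r : R^o) \in s -> (h * r) *: v \in N.
  elim: s sN {sJ} => [_|x s IH sN].
    by exists (ideal1 R) => //; exact: GV_ideal1.
  have [|H gH HN] := IH; first by move=> r rs; rewrite sN ?inE ?rs ?orbT.
  have /w_closureP[K gK KN] := sN x (mem_head _ _).
  have [G gG GHK] := GV_inter gH gK; exists G => // h r /GHK[hH hK].
  rewrite inE => /predU1P[->|]; last exact: HN.
  by rewrite -scalerA; apply: KN.
apply/w_closureP; exists (ideal_mul H J); first exact: GV_mul.
apply: (span_ind (Q := fun r : R^o => (r : R) *: v \in N)) => [_ [h [r [hH + ->]]]| |a x y hx hy].
- rewrite sJ; move: r.
  apply: (span_ind (Q := fun r : R^o => (h * (r : R)) *: v \in N)) => [r rs| |a x y hx hy]; first exact: HN.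
  + by rewrite mulr0 scale0r rpred0.
  + have -> : h * (a *: x + y) = a * (h * (x : R)) + h * (y : R).
      by rewrite -[a *: x]/(a * (x : R)); ring.
    by rewrite scalerDl -[(a * _) *: v]scalerA rpredD // rpredZ.
- by rewrite scale0r rpred0.
- by rewrite scalerDl -[(a * _) *: v]scalerA rpredD // rpredZ.
Qed.

Lemma w_closure_idem (V : lmodType R) (N N' : submodClosed V) : {subset N' <= w_closure N} ->
  {subset w_closure N' <= w_closure N}.
Proof. by move=> h v /w_closureP[J gJ JN]; apply: (w_closure_trans gJ) => r /JN/h. Qed.

Lemma w_closure_map (V W : lmodType R) (f : {linear V -> W}) (N : submodClosed V)
    (N' : submodClosed W) : (forall x, x \in N -> f x \in w_closure N') ->
  forall x, x \in w_closure N -> f x \in w_closure N'.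
Proof.
move=> h x /w_closureP[J gJ JN]; apply: (w_closure_trans gJ) => r /JN /h.
by rewrite linearZ.
Qed.

(** Membership in a closure may be checked on a w-dense set of multiples. *)
Lemma w_closure_dense (V : lmodType R) (C : ideal R) (N : submodClosed V) v :
  (1 : R^o) \in w_closure C -> (forall r : R, r \in C -> r *: v \in w_closure N) ->
  v \in w_closure N.
Proof.
move=> C1 CN; rewrite -[v]scale1r.
exact: (@w_closure_map R^o V (scale_at v) C N CN _ C1).
Qed.

Local Notation gv_null V := (w_closure (zero_submod V)).

Lemma gv_null_map (V W : lmodType R) (f : {linear V -> W}) x :
  x \in gv_null V -> f x \in gv_null W.
Proof.
apply: (w_closure_map (f := f)) => {}x /mem_zero_submod ->.
by rewrite raddf0; exact: rpred0.
Qed.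

Lemma gv_null_sub (V : lmodType R) (N : submodClosed V) :
  {subset gv_null V <= w_closure N}.
Proof. by apply: w_closure_idem => x /mem_zero_submod ->; exact: rpred0. Qed.

Lemma GV_torsionP (V : lmodType R) : GV_torsion V <-> forall x : V, x \in gv_null V.
Proof.
split=> h x.
  by have [J gJ Jx] := h x; apply/w_closureP; exists J => // r /Jx/mem_zero_submod.
have /w_closureP[J gJ Jx] := h x; exists J => // r /Jx.
by move/mem_zero_submod.
Qed.

Lemma gv_null_ring (x : R^o) : x \in gv_null R^o -> x = 0.
Proof.
move=> /w_closureP[J gJ Jx]; apply: (GV_ann gJ) => r /Jx/mem_zero_submod.
by rewrite mulrC.
Qed.

Lemma gv_null_quot (V : lmodType R) (N : submodClosed V) x :
  lmod_pi N x \in gv_null (lmod_quot N) <-> x \in w_closure N.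
Proof.
split=> /w_closureP[J gJ JN]; apply/w_closureP; exists J => // r /JN.
  by rewrite -linearZ => /mem_zero_submod; rewrite -[0](linear0 (lmod_pi N))=> /lmod_pi_eq; rewrite subr0.
move=> rx; rewrite -linearZ; apply/mem_zero_submod.
by rewrite -[RHS](linear0 (lmod_pi N)); apply/lmod_pi_eq; rewrite subr0.
Qed.

End Closure.

Notation gv_null V := (w_closure (zero_submod V)).

(** * Zorn's lemma for substructures *)

Section Zorn.
Variables (T : Type) (P : set (set T)) (A0 : set T).

Lemma Zorn_above : P A0 ->
  (forall F : set (set T), F !=set0 -> F `<=` P -> total_on F subset ->
     P (\bigcup_(X in F) X)) ->
  exists A, [/\ P A, A0 `<=` A & forall B, P B -> A `<=` B -> B `<=` A].
Proof.
move=> PA0 chain; have [|A [PA maxA]] := @Zorn_bigcup T [set X | P (A0 `|` X)].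
  move=> F FP totF; have [F0|/set0P F0] := eqVneq F set0.
    by rewrite /= F0 bigcup_set0 setU0.
  rewrite /=; have -> : A0 `|` \bigcup_(X in F) X =
      \bigcup_(Y in [set A0 `|` X | X in F]) Y.
    rewrite bigcup_image; apply/seteqP; split=> x.
      have [X FX] := F0; move=> [A0x|[Y FY Yx]]; first by exists X => //; left.
      by exists Y => //; right.
    by move=> [X FX [A0x|Xx]]; [left | right; exists X].
  apply: chain; first by have [X FX] := F0; exists (A0 `|` X), X.
    by move=> _ [X FX <-]; apply: FP.
  move=> _ _ [X FX <-] [Y FY <-].
  by have [XY|YX] := totF X Y FX FY; [left|right]; apply: setUS.
exists (A0 `|` A); split=> [//|x|B PB AB]; first by left.
apply: contrapT => nBA; apply: (maxA (B : set T)); last first.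
  rewrite /=; suff -> : A0 `|` B = B by [].
  by apply/seteqP; split=> x; [move=> [|//] A0x; apply: AB; left | right].
split=> [x Ax|BA]; first by apply: AB; right.
by apply: nBA => x /BA; right.
Qed.

(** A union of a chain of sets closed under a binary operation is closed. *)
Lemma chain_closed (op : T -> T -> T) (F : set (set T)) : total_on F subset ->
  (forall X, F X -> forall x y, X x -> X y -> X (op x y)) ->
  forall x y, (\bigcup_(X in F) X) x -> (\bigcup_(X in F) X) y ->
    (\bigcup_(X in F) X) (op x y).
Proof.
move=> totF opF x y [X FX Xx] [Y FY Yy].
have [XY|YX] := totF X Y FX FY; first by exists Y => //; apply: opF => //; apply: XY.
by exists X => //; apply: opF => //; apply: YX.
Qed.

End Zorn.

Definition is_submod (R : comNzRingType) (V : lmodType R) (X : set V) :=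
  X 0 /\ forall a x y, X x -> X y -> X (a *: x + y).

Section ToSubmod.
Variables (R : comNzRingType) (V : lmodType R).

Lemma is_submod_closed (X : set V) : is_submod X -> submod_closed (fun x => `[< X x >]).
Proof.
by move=> [X0 XD]; split=> [|a x y /asboolP Xx /asboolP Xy]; apply/asboolP; auto.
Qed.
Definition submod_of_set (X : set V) (hX : is_submod X) : submodClosed V :=
  to_submod (is_submod_closed hX).
Lemma mem_submod_of_set X (hX : is_submod X) x : x \in submod_of_set hX <-> X x.
Proof. by split=> /asboolP. Qed.

Lemma chain_is_submod (F : set (set V)) : F !=set0 ->
  (forall X, F X -> is_submod X) -> total_on F subset ->
  is_submod (\bigcup_(X in F) X).
Proof.
move=> [X FX] hF totF; split=> [|a]; first by exists X => //; case: (hF X FX).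
by apply: (chain_closed (op := fun x y => a *: x + y) totF) => Y /hF[_ h]; apply: h.
Qed.

Lemma submod_is_submod (N : submodClosed V) : is_submod [set` N].
Proof.
split=> [|a x y /= xN yN] /=; first exact: rpred0.
by rewrite rpredD // rpredZ.
Qed.

End ToSubmod.

(** * Injective envelopes *)

Lemma int_subgroup_generator (P : int -> Prop) : P 0 ->
  (forall q a b, P a -> P b -> P (b - q * a)) ->
  exists k : nat, forall n : int, P n <-> exists q, n = q * k%:Z.
Proof.
move=> P0 PB; pose pos k := (0 < k)%N && `[< P k%:Z >].
have PN a : P a -> P (- a) by move=> Pa; have := PB 1 a 0 Pa P0; rewrite mul1r sub0r.
have Pabs n : P n -> P `|n|%N%:Z.
  by have [n0|/ltW n0] := leP 0 n; [rewrite gez0_abs | rewrite lez0_abs // => /PN].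
have [expos|nopos] := pselect (exists k, pos k); last first.
  exists 0%N => n; split=> [Pn|[q ->]]; last by rewrite mulr0.
  exists 0; rewrite mul0r; apply: contrapT => /eqP n0; case: nopos; exists `|n|%N.
  by rewrite /pos absz_gt0 n0; apply/asboolP; exact: Pabs.
case: (ex_minnP expos) => k /andP[k0 /asboolP Pk] kmin.
exists k => n; split=> [Pn|[q ->]]; last first.
  by have := PB (- q) _ _ Pk P0; rewrite mulNr opprK add0r.
exists (n %/ k%:Z)%Z; rewrite [LHS](divz_eq n k%:Z).
suff -> : (n %% k%:Z)%Z = 0 by rewrite addr0.
have r0 : 0 <= (n %% k%:Z)%Z by rewrite modz_ge0 // -lt0n.
have Pr : P (n %% k%:Z)%Z by exact: PB.
apply: contrapT => /eqP rn0; have : pos `|(n %% k%:Z)%Z|%N.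
  by rewrite /pos absz_gt0 rn0; apply/asboolP; exact: Pabs.
move=> /kmin; rewrite leqNgt => /negP; apply.
by rewrite -ltz_nat gez0_abs // ltz_mod // -lt0n.
Qed.

Section Divisible.
Variables (B D : lmodType int).
Hypothesis divD : forall (n : nat) (d : D), (0 < n)%N -> exists d', n%:Z *: d' = d.

Definition functional (G : set (B * D)) := forall d, G (0, d) -> d = 0.

(** A partial linear map extends to one more point b as soon as the value
    chosen there is compatible with the values at the multiples of b. *)
Lemma functional_adjoin (G : set (B * D)) (b : B) (d : D) : is_submod G ->
  (forall (n : int) e, G (n *: b, e) -> e = n *: d) -> functional G ->
  exists G', [/\ is_submod G', functional G', G `<=` G' & G' (b, d)].
Proof.
move=> [G0 GD] bd fG.
exists [set p | exists (n : int) q, G q /\ p = q + n *: (b, d)]; split.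
- split=> [|a _ _ [n [q [Gq ->]]] [m [r [Gr ->]]]].
    by exists 0, 0; rewrite scale0r addr0.
  exists (a * n + m), (a *: q + r); split; first exact: GD.
  by rewrite scalerDl scalerDr scalerA addrACA.
- move=> e [n [[x y] [Gxy [/esym/eqP xE ->]]]].
  have {xE} xE : x = (- n) *: b by apply/eqP; rewrite scaleNr -addr_eq0.
  rewrite {}xE in Gxy; rewrite (bd _ _ Gxy).
  by rewrite scaleNr addNr.
- by move=> p Gp; exists 0, p; rewrite scale0r addr0.
- by exists 1, 0; rewrite scale1r add0r.
Qed.

(** The integers n such that the value at n b is prescribed are the multiples of
    some k; divide the value at k b by k. *)
Lemma functional_value (G : set (B * D)) b : is_submod G -> functional G ->
  exists d, forall (n : int) e, G (n *: b, e) -> e = n *: d.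
Proof.
move=> [G0 GD] fG.
have Guniq x e e' : G (x, e) -> G (x, e') -> e = e'.
  move=> Ge Ge'; apply/subr0_eq/fG; have := GD (-1) _ _ Ge' Ge.
  by rewrite scaleN1r -[_ + _]/(- x + x, - e' + e) addNr addrC.
have [||k kP] := @int_subgroup_generator (fun n => exists e, G (n *: b, e)).
- by exists 0; rewrite scale0r.
- move=> q n m [e Ge] [e' Ge']; exists (- q *: e + e').
  have := GD (- q) _ _ Ge Ge'; congr G; congr (_, _) => /=.
  by rewrite scalerA -scalerDl; congr (_ *: _); ring.
have [e Gk] : exists e, G (k%:Z *: b, e) by apply/kP; exists 1; rewrite mul1r.
have [d dE] : exists d, k%:Z *: d = e.
  have [k0|k0] := posnP k; last exact: divD.
  by exists 0; rewrite scaler0; apply/esym/fG; move: Gk; rewrite k0 scale0r.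
exists d => n e' Gn; have /kP[q nE] : exists e, G (n *: b, e) by exists e'.
rewrite nE -scalerA dE; apply: Guniq Gn _.
have := GD q _ _ Gk G0; rewrite addr0; congr G; congr (_, _) => /=.
by rewrite nE scalerA.
Qed.

Lemma divisible_extend (G : set (B * D)) : is_submod G -> functional G ->
  exists h : {linear B -> D}, forall b d, G (b, d) -> h b = d.
Proof.
move=> sG fG.
have [|F F0 FP totF|H [[sH fH] GH maxH]] :=
    @Zorn_above _ [set X : set (B * D) | is_submod X /\ functional X] G.
- by [].
- split; first by apply: chain_is_submod => // X /FP[].
  by move=> d [X FX Xd]; have [_] := FP X FX; apply.
have exd b : exists d, H (b, d).
  have [d hd] := functional_value b sH fH.
  have [H' [sH' fH' HH' H'b]] := functional_adjoin sH hd fH.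
  by exists d; apply: (maxH H').
have [h hP] := choice exd.
have [H0 HD] := sH.
have hE b d : H (b, d) -> h b = d.
  move=> Hd; apply/subr0_eq/fH; have := HD (-1) _ _ Hd (hP b).
  by rewrite scaleN1r -[_ + _]/(- b + b, - d + h b) addNr addrC.
have lin : linear h by move=> a x y; apply: hE; apply: (HD a (x, h x) (y, h y)).
by exists (to_linear lin) => b d /GH; apply: hE.
Qed.

End Divisible.

Definition QmodZ : lmodType int := lmod_quot (submod_span [set (1 : rat) : zmodule rat]).

Lemma QmodZ_divisible (n : nat) (d : QmodZ) : (0 < n)%N -> exists d', n%:Z *: d' = d.
Proof.
move=> n0; have [x ->] := lmod_pi_surj d.
exists (lmod_pi _ (((x : rat) / n%:R : rat) : zmodule rat)).
rewrite -linearZ; congr (lmod_pi _ _); rewrite scalezrE -mulrzr.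
by rewrite divfK // pnatr_eq0 -lt0n.
Qed.

Lemma QmodZ_eq0 (x : rat) :
  lmod_pi (submod_span [set (1 : rat) : zmodule rat]) (x : zmodule rat) = 0 ->
  exists n : int, x = n%:~R.
Proof.
rewrite -[0](linear0 (lmod_pi _)) => /lmod_pi_eq; rewrite subr0.
apply: (span_ind (V := zmodule rat)
  (Q := fun x : rat => exists n : int, x = n%:~R)) => [_ ->| |a y z [n ->] [m ->]].
- by exists 1.
- by exists 0.
- exists (a * n + m); rewrite rmorphD rmorphM /= scalezrE; congr (_ + _).
  by rewrite mulrzl.
Qed.

Lemma character_neq0 (M : lmodType int) (x : M) : x != 0 ->
  exists h : {linear M -> QmodZ}, h x != 0.
Proof.
move=> x0; pose z := submod_span [set (1 : rat) : zmodule rat].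
have inv_neq0 k : (1 < k)%N -> lmod_pi z ((k%:R^-1 : rat) : zmodule rat) != 0.
  move=> k1; apply/eqP => /QmodZ_eq0[n nE].
  have k0 : (k%:R : rat) != 0 by rewrite pnatr_eq0 -lt0n ltnW.
  have : (1 : rat) = (n * k%:Z)%:~R by rewrite rmorphM /= -nE mulVf.
  move/eqP; rewrite -[1]/(1%:~R) eqr_int => /eqP /(congr1 absz); rewrite abszM /=.
  by move/esym/eqP; rewrite muln_eq1 => /andP[_ /eqP ke]; rewrite ke in k1.
pose G : set (M * QmodZ) := [set (0, 0)].
have sG : is_submod G.
  split=> // a _ _ -> ->; change ((a *: 0 + 0, a *: 0 + 0) = (0, 0) :> M * QmodZ).
  by rewrite !scaler0 !addr0.
have fG : functional G by move=> d [].
have [d [d0 hd]] : exists d : QmodZ, d != 0 /\ forall n : int, n *: x = 0 -> n *: d = 0.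
  have [||k kP] := @int_subgroup_generator (fun n => n *: x = 0).
  - exact: scale0r.
  - by move=> q n m nx mx; rewrite scalerBl -scalerA nx mx scaler0 subrr.
  have kx : k%:Z *: x = 0 by apply/kP; exists 1; rewrite mul1r.
  have k1 : k != 1%N by apply: contra x0 => /eqP k1; rewrite -[x]scale1r -[1]/(1%:Z) -k1 kx.
  (* An element of infinite order may be sent anywhere. *)
  pose c := if k == 0%N then 2%N else k.
  have c1 : (1 < c)%N by rewrite /c; case: (k) k1 => [|[|]].
  exists (lmod_pi z ((c%:R^-1 : rat) : zmodule rat)); split; first exact: inv_neq0.
  move=> n /kP[q ->]; have [->|k0] := eqVneq k 0%N; first by rewrite mulr0 scale0r.
  rewrite /c (negPf k0) -linearZ -[RHS](linear0 (lmod_pi z)); apply/lmod_pi_eq.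
  rewrite subr0 -scalerA; apply: rpredZ; rewrite scalezrE.
  by rewrite -mulrzr mulVf ?pnatr_eq0 //; exact: mem_span.
have [|G' [sG' fG' _ G'x]] := functional_adjoin (b := x) (d := d) sG _ fG.
  by move=> n e [nx ->]; rewrite hd.
have [h hP] := divisible_extend QmodZ_divisible sG' fG'.
by exists h; rewrite (hP _ _ G'x).
Qed.

(** The coinduced module Hom_Z(R, D)^I. *)
Section Coinduced.
Variables (R : comNzRingType) (I : Type) (D : lmodType int).

Record coinduced := Coinduced {
  coind_fun : I -> R -> D;
  coind_funD : forall i a b, coind_fun i (a + b) = coind_fun i a + coind_fun i b }.

HB.instance Definition _ := gen_eqMixin coinduced.
HB.instance Definition _ := gen_choiceMixin coinduced.

Lemma coinduced_ext f g : (forall i r, coind_fun f i r = coind_fun g i r) -> f = g.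
Proof.
case: f => f fD; case: g => g gD /= fg.
have e : f = g by apply/funext => i; apply/funext => r.
by subst g; congr Coinduced; exact: Prop_irrelevance.
Qed.

Definition coind0 : coinduced.
Proof. by exists (fun _ _ => 0) => i a b; rewrite addr0. Defined.
Definition coindN (f : coinduced) : coinduced.
Proof. by exists (fun i r => - coind_fun f i r) => i a b; rewrite coind_funD opprD. Defined.
Definition coindD (f g : coinduced) : coinduced.
Proof.
exists (fun i r => coind_fun f i r + coind_fun g i r) => i a b.
by rewrite !coind_funD addrACA.
Defined.
Definition coindZ (c : R) (f : coinduced) : coinduced.
Proof. by exists (fun i r => coind_fun f i (r * c)) => i a b; rewrite mulrDl coind_funD. Defined.

Fact coindDA : associative coindD.
Proof. by move=> f g h; apply: coinduced_ext => i r /=; rewrite addrA. Qed.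
Fact coindDC : commutative coindD.
Proof. by move=> f g; apply: coinduced_ext => i r /=; rewrite addrC. Qed.
Fact coind0D : left_id coind0 coindD.
Proof. by move=> f; apply: coinduced_ext => i r /=; rewrite add0r. Qed.
Fact coindND : left_inverse coind0 coindN coindD.
Proof. by move=> f; apply: coinduced_ext => i r /=; rewrite addNr. Qed.
HB.instance Definition _ := GRing.isZmodule.Build coinduced coindDA coindDC coind0D coindND.

Fact coindZA a b f : coindZ a (coindZ b f) = coindZ (a * b) f.
Proof. by apply: coinduced_ext => i r /=; rewrite mulrA. Qed.
Fact coindZ1 : left_id 1 coindZ.
Proof. by move=> f; apply: coinduced_ext => i r /=; rewrite mulr1. Qed.
Fact coindZDr : right_distributive coindZ +%R.
Proof. by move=> a f g; apply: coinduced_ext. Qed.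
Fact coindZDl f : {morph coindZ^~ f : a b / a + b}.
Proof. by move=> a b; apply: coinduced_ext => i r /=; rewrite mulrDr coind_funD. Qed.
HB.instance Definition _ := GRing.Zmodule_isLmodule.Build R coinduced
  coindZA coindZ1 coindZDr coindZDl.

(** By adjunction, extending an R-linear map to the coinduced module amounts to
    extending its components at 1 as additive maps to D. *)
Lemma coinduced_injective :
  (forall (n : nat) (d : D), (0 < n)%N -> exists d', n%:Z *: d' = d) ->
  injective_module coinduced.
Proof.
move=> divD A B f g injf.
have ext i : exists h : {linear zmodule B -> D}, forall a, h (f a) = coind_fun (g a) i 1.
  pose G : set (zmodule B * D) := [set p | exists a, p = (f a, coind_fun (g a) i 1)].
  have gN a : coind_fun (g (- a)) i 1 = - coind_fun (g a) i 1 by rewrite raddfN.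
  have gMn a n : coind_fun (g (a *+ n)) i 1 = coind_fun (g a) i 1 *+ n.
    by elim: n => [|n IH]; rewrite ?mulr0n ?raddf0 // !mulrS raddfD /= IH.
  have gMz a (n : int) : coind_fun (g (a *~ n)) i 1 = coind_fun (g a) i 1 *~ n.
    by case: n => n; rewrite ?NegzE ?mulrNz ?gN ?gMn.
  have sG : is_submod G.
    split; first by exists 0; rewrite !raddf0.
    move=> n _ _ [a ->] [b ->]; exists (a *~ n + b).
    change ((n *: (f a : zmodule B) + f b,
             n *: coind_fun (g a) i 1 + coind_fun (g b) i 1) =
            (f (a *~ n + b), coind_fun (g (a *~ n + b)) i 1)).
    congr (_, _); first by rewrite raddfD raddfMz scalezrE.
    by rewrite raddfD /= gMz -[n in LHS]intz scaler_int.
  have fG : functional G.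
    move=> d [a [fa0 ->]]; have -> : a = 0 by apply: injf; rewrite raddf0 -fa0.
    by rewrite raddf0.
  have [h hP] := divisible_extend divD sG fG.
  by exists h => a; apply: hP; exists a.
have [h hP] := choice ext.
pose H b := @Coinduced (fun i r => h i (r *: b)) (fun i a a' =>
  etrans (congr1 (h i) (scalerDl b a a')) (raddfD (h i) _ _)).
have lin : linear H.
  move=> a b b'; apply: coinduced_ext => i r /=.
  by rewrite scalerDr scalerA raddfD.
exists (to_linear lin) => a; apply: coinduced_ext => i r /=.
by rewrite -linearZ hP linearZ /= mul1r.
Qed.

End Coinduced.

Lemma enough_injectives (R : comNzRingType) (M : lmodType R) :
  exists (E : lmodType R) (i : {linear M -> E}), injective i /\ injective_module E.
Proof.
have hx (x : M) : exists h : {linear zmodule M -> QmodZ}, x != 0 -> h x != 0.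
  have [->|x0] := eqVneq x 0; last first.
    by have [h h0] := @character_neq0 (zmodule M) x x0; exists h.
  by exists \0.
have [h hP] := choice hx.
pose j m := @Coinduced R M QmodZ (fun x r => h x (r *: m)) (fun x a a' =>
  etrans (congr1 (h x) (scalerDl m a a')) (raddfD (h x) _ _)).
have lin : linear j.
  move=> a b b'; apply: coinduced_ext => i r /=.
  by rewrite scalerDr scalerA raddfD.
exists (coinduced R M QmodZ : lmodType R), (to_linear lin); split.
  apply: raddf_inj => x /(congr1 (fun f => coind_fun f x 1)) /= /eqP.
  by rewrite scale1r => hx0; apply/eqP; apply: contraTT hx0 => /hP.
exact: coinduced_injective QmodZ_divisible.
Qed.

(** Inside an injective E, take X maximal among the essential extensions of A,
    then Y maximal among the submodules meeting X trivially.  Then X is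
    essential in E / Y, so E / Y -> E extending X -> E has an essential
    extension of X as its image; this is X by maximality, hence X is a direct
    summand of E and injective. *)
Lemma essential_retract (R : comNzRingType) (E : lmodType R) (A : submodClosed E) :
  injective_module E ->
  exists (X : submodClosed E) (p : {linear E -> submod X}),
    [/\ {subset A <= X}, forall x : submod X, p (val x) = x &
        forall x, x \in X -> x != 0 -> exists r : R, r *: x \in A /\ r *: x != 0].
Proof.
move=> injE.
pose ess (X : set E) := is_submod X /\
  forall x, X x -> x != 0 -> exists r : R, r *: x \in A /\ r *: x != 0.
have [|F F0 FP totF|S [[sS essS] AS maxS]] := @Zorn_above _ (ess : set (set E)) [set` A].
- split; first exact: submod_is_submod.
  by move=> x xA x0; exists 1; rewrite scale1r.
- split; first by apply: chain_is_submod => // X /FP[].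
  by move=> x [X FX Xx]; have [_ h] := FP X FX; exact: h.
pose X := submod_of_set sS.
have XP x : x \in X <-> S x := mem_submod_of_set sS x.
pose dis (Y : set E) := is_submod Y /\ forall y, Y y -> S y -> y = 0.
have [|F F0 FP totF|T [[sT disT] _ maxT]] := @Zorn_above _ (dis : set (set E)) [set 0].
- split; last by move=> y ->.
  by split=> // a _ _ -> ->; rewrite scaler0 addr0.
- split; first by apply: chain_is_submod => // Y /FP[].
  by move=> y [Y FY Yy]; have [_ h] := FP Y FY; exact: h.
pose Y := submod_of_set sT.
have YP y : y \in Y <-> T y := mem_submod_of_set sT y.
pose f := (lmod_pi Y \o (val : submod X -> E) : {linear submod X -> lmod_quot Y}).
have injf : injective f.
  apply: raddf_inj => x /=; rewrite -[0](linear0 (lmod_pi Y)) => /lmod_pi_eq.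
  by rewrite subr0 => /YP/disT h; apply: val_inj; apply: h; apply/XP; exact: valP.
have [h hP] := injE _ _ f (val : {linear submod X -> E}) injf.
pose h' := (h \o lmod_pi Y : {linear E -> E}).
have h'X x : S x -> h' x = x by move=> /XP xX; have := hP (Submod xX).
have ess_h' : ess (range h').
  split=> [|_ [e _ <-] he0].
    split; first by exists 0; rewrite ?raddf0.
    by move=> a _ _ [x _ <-] [y _ <-]; exists (a *: x + y); rewrite ?linearP.
  have [r [y [Yy Sx x0]]] : exists (r : R) y, [/\ T y, S (y + r *: e) & y + r *: e != 0].
    apply: contrapT => no; have sT0 := sT.1; have sTD := sT.2.
    pose T' : set E := [set z | exists (r : R) y, T y /\ z = y + r *: e].
    have Te : T e.
      apply: (maxT T'); last by exists 1, 0; rewrite add0r scale1r.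
        split.
          split=> [|a _ _ [r [y [Ty ->]]] [s [z [Tz ->]]]].
            by exists 0, 0; rewrite scale0r addr0.
          exists (a * r + s), (a *: y + z); split; first exact: sTD.
          by rewrite scalerDl scalerDr scalerA addrACA.
        move=> _ [r [y [Ty ->]]] Sz; apply: contrapT => /eqP z0.
        by apply: no; exists r, y.
      by move=> y Ty; exists 0, y; rewrite scale0r addr0.
    case/negP: he0; rewrite /h' /=.
    have -> : lmod_pi Y e = 0.
      by rewrite -[RHS](linear0 (lmod_pi Y)); apply/lmod_pi_eq; rewrite subr0; apply/YP.
    by rewrite raddf0.
  have [s [sA s0]] := essS _ Sx x0.
  exists (s * r); rewrite -scalerA.
  suff -> : r *: (h \o lmod_pi Y) e = y + r *: e by [].
  rewrite -[RHS](h'X _ Sx) [RHS]linearD linearZ; suff -> : h' y = 0 by rewrite add0r.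
  rewrite /h' /=; suff -> : lmod_pi Y y = 0 by rewrite raddf0.
  by rewrite -[RHS](linear0 (lmod_pi Y)); apply/lmod_pi_eq; rewrite subr0; apply/YP.
have h'S e : h' e \in X.
  apply/XP; apply: (maxS (range h')) => // x Sx.
  by exists x => //; apply: h'X.
pose p e := Submod (h'S e).
have plin : linear p by move=> a x y; apply: val_inj; rewrite /= linearP linearP.
exists X, (to_linear plin); split.
- by move=> x xA; apply/XP; apply: AS.
- by move=> x; apply: val_inj; apply: h'X; apply/XP; exact: valP.
- by move=> x /XP; apply: essS.
Qed.

Lemma injective_envelope_exists (R : comNzRingType) (M : lmodType R) :
  exists (E : lmodType R) (i : {linear M -> E}), injective_envelope i.
Proof.
have [E [i [injI injE]]] := enough_injectives M.
have [X [p [iX pK ess]]] := essential_retract (limg i) injE.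
have iM m : i m \in X by apply: iX; exact: mem_limg.
pose j m := Submod (iM m).
have jlin : linear j by move=> a x y; apply: val_inj; rewrite /= !linearP.
exists (submod X), (to_linear jlin); split.
- by move=> x y /(congr1 val); apply: injI.
- move=> A B f g injf.
  have [h hP] := injE _ _ f ((val : submod X -> E) \o g : {linear A -> E}) injf.
  by exists (p \o h : {linear B -> submod X}) => x; rewrite /= hP /= pK.
- move=> N [x xN x0].
  have [|r [/limgP[m im] rx0]] := ess (val x) (valP x).
    by apply: contraNneq x0 => x0; apply/eqP/val_inj.
  have jm : j m = r *: x by apply: val_inj; rewrite [RHS]linearZ; exact: im.
  by exists m; rewrite /= jm ?rpredZ.
Qed.

(** * Maximal w-ideals *)

Section WMax.
Variable R : comNzRingType.
Implicit Types I J P : ideal R.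

(** If J x lies in P, extend P -> E(P) to h : R -> E(P); then h x is the image of
    some p in P, and J (x - p) = 0. *)
Lemma w_ideal_closed P (x : R^o) : w_ideal P -> x \in w_closure P -> x \in P.
Proof.
move=> [tfP [E [i [[injI injE ess] wE]]]] /w_closureP[J gJ JxP].
have [h hP] := injE _ _ (val : {linear submod P -> R^o}) i val_inj.
have [p _ ip] : range i (h x).
  apply: (wE _ J gJ) => r /JxP rx; exists (Submod rx) => //.
  by rewrite -hP -linearZ.
suff -> : x = val p by exact: valP.
apply/subr0_eq/(GV_ann gJ) => r rJ.
have rxp : r *: (x - val p) \in P.
  rewrite scalerBr; apply: submod_subr; first exact: JxP.
  by apply: rpredZ; exact: valP.
have : Submod rxp = 0.
  by apply: injI; rewrite -hP /= linearZ linearB /= -ip hP subrr scaler0 raddf0.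
by move/(congr1 val) => /= e; rewrite mulrC; exact: e.
Qed.

(** An element of E(P) multiplied into P by a GV-ideal J gives a map J -> P,
    which is multiplication by an element of R; this lies in the closure of P. *)
Lemma closed_w_ideal P : (forall x : R^o, x \in w_closure P -> x \in P) -> w_ideal P.
Proof.
move=> clP; split=> [J x gJ Jx|].
  apply: val_inj; apply/(GV_ann gJ) => r /Jx /(congr1 val).
  by rewrite linearZ mulrC.
have [E [i envi]] := injective_envelope_exists (submod P); exists E, i; split=> //.
have [injI injE ess] := envi => x J gJ JxP.
have tfE (y : E) : (forall r : R, r \in J -> r *: y = 0) -> y = 0.
  move=> Jy; apply: contrapT => /eqP y0.
  have [|m /limgP[r rm] m0] := ess (limg (scale_at y : {linear R^o -> E})).
    by exists y => //; apply/limgP; exists 1; rewrite /= /scale_at scale1r.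
  case/negP: m0; suff -> : m = 0 by rewrite raddf0.
  apply: val_inj; apply/(GV_ann gJ) => s sJ.
  have : s *: m = 0.
    apply: injI; rewrite linearZ -rm raddf0 /= /scale_at scalerA mulrC -scalerA.
    by rewrite Jy // scaler0.
  by move=> /(congr1 val); rewrite linearZ /= mulrC.
have hx (j : submod J) : exists p : submod P, i p = val j *: x.
  by have [p _ ip] := JxP _ (valP j); exists p.
have [k kP] := choice hx.
have klin : linear (fun j => val (k j) : R^o).
  move=> a b c; rewrite -linearP; congr (val _); apply: injI.
  by rewrite linearP !kP linearP scalerDl scalerA.
have [_ _ homJ] := (GV_idealP J).1 gJ.
have [s sP] := homJ (to_linear klin).
have sPP : (s : R^o) \in P.
  apply: clP; apply/w_closureP; exists J => // r rJ.
  rewrite -[r *: _]/(r * s) mulrC -(sP (Submod rJ)) /=; exact: valP.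
exists (Submod sPP) => //; apply/subr0_eq/tfE => r rJ.
rewrite scalerBr -[r *: x]/(val (Submod rJ) *: x) -kP -linearZ -raddfB.
suff -> : r *: Submod sPP - k (Submod rJ) = 0 by rewrite raddf0.
apply: val_inj; rewrite linearB linearZ /=; have /= -> := sP (Submod rJ).
by rewrite [s * r]mulrC subrr.
Qed.

(** The ideals that are not w-dense are inductively ordered because GV-ideals
    are finitely generated; a maximal one is a prime maximal w-ideal. *)
Lemma w_Max_exists I : (1 : R^o) \notin w_closure I ->
  exists P, [/\ prime_ideal P, w_Max P & {subset I <= P}].
Proof.
move=> I1.
have denseP J : (1 : R^o) \in w_closure J <->
    exists2 G : ideal R, GV_ideal G & {subset G <= J}.
  by split=> [/w_closureP|] [G gG GJ]; [|apply/w_closureP]; exists G => // r /GJ;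
    rewrite -[r *: _]/(r * 1) mulr1.
pose nd (X : set R^o) := is_submod X /\
  forall G : ideal R, GV_ideal G -> ~ (forall r : R, r \in G -> X r).
have [|F F0 FP totF|S [[sS ndS] IS maxS]] := @Zorn_above _ (nd : set (set R^o)) [set` I].
- split=> [|G gG GI]; first exact: submod_is_submod.
  by move/negP: I1; apply; apply/denseP; exists G.
- split=> [|G gG GF]; first by apply: chain_is_submod => // X /FP[].
  have [[s sG] _] := gG.
  have [X FX Xs] : exists2 X, F X & forall r, r \in s -> X r.
    have : forall r, r \in s -> (\bigcup_(X in F) X) r.
      by move=> r rs; apply: GF; rewrite sG; apply: mem_span.
    elim: s {sG} => [_|x s IH xsF]; first by have [X FX] := F0; exists X.
    have [|X FX Xs] := IH; first by move=> r rs; apply: xsF; rewrite inE rs orbT.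
    have [Y FY Yx] := xsF x (mem_head _ _).
    have [XY|YX] := totF X Y FX FY.
      by exists Y => // r; rewrite inE => /predU1P[-> //|/Xs]; apply: XY.
    by exists X => // r; rewrite inE => /predU1P[->|/Xs //]; apply: YX.
  have [[X0 XD] ndX] := FP X FX; apply: (ndX G gG) => r; rewrite sG.
  by apply: span_ind => // a x y; apply: XD.
pose P := submod_of_set sS.
have PP x : x \in P <-> S x := mem_submod_of_set sS x.
have P1 : (1 : R^o) \notin w_closure P.
  by apply/negP => /denseP[G gG GP]; apply: (ndS G gG) => r /GP/PP.
have maxP J : {subset P <= J} -> (1 : R^o) \notin w_closure J -> {subset J <= P}.
  move=> PJ J1 x xJ; apply/PP; apply: (maxS [set` J]) => //.
    split=> [|G gG GJ]; first exact: submod_is_submod.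
    by move/negP: J1; apply; apply/denseP; exists G.
  by move=> y /PP/PJ.
have clP (x : R^o) : x \in w_closure P -> x \in P.
  apply: (maxP (w_closure P : ideal R)); first exact: sub_w_closure.
  by apply: contra P1; apply: w_closure_idem.
have notP1 : (1 : R^o) \notin P by apply: contra P1; exact: sub_w_closure.
exists P; split.
- split=> // a b abP; apply/orP; have [aP|aP] := boolP ((a : R^o) \in P); [by left|right].
  pose Q := preim_submod (scale_at (b : R^o)) P.
  have QP (x : R) : ((x : R^o) \in Q) = ((x * b : R^o) \in P) by [].
  suff : (1 : R^o) \in Q by rewrite QP mul1r.
  have clQ (x : R^o) : x \in w_closure Q -> x \in Q.
    move=> xQ; rewrite mem_preim_submod; apply: clP.
    by apply: w_closure_map xQ => y yQ; apply: sub_w_closure.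
  apply: contraT => Q1; suff : (a : R^o) \in P by rewrite (negPf aP).
  apply: (maxP Q); last by rewrite QP.
    by move=> x xP; rewrite QP mulrC; apply: (rpredZ b xP).
  by apply: contra Q1; apply: clQ.
- split=> //; first exact: closed_w_ideal.
  move=> Q wQ Q1 PQ x; apply/idP/idP; last exact: PQ.
  by apply: maxP => //; apply: contra Q1; apply: w_ideal_closed.
- by move=> x xI; apply/PP/IS.
Qed.

(** Otherwise the ideal of all r with r v in N is not w-dense, hence is contained
    in a maximal w-ideal. *)
Lemma w_closure_local (V : lmodType R) (N : submodClosed V) v :
  (forall P, prime_ideal P -> w_Max P ->
     exists2 r : R, (r : R^o) \notin P & r *: v \in N) -> v \in w_closure N.
Proof.
move=> loc; pose C := preim_submod (scale_at v) N.
suff C1 : (1 : R^o) \in w_closure C.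
  by apply: (w_closure_dense C1) => r rC; apply: sub_w_closure.
apply: contraT => /w_Max_exists[P [prP wP CP]].
by have [r /negP rP rv] := loc P prP wP; case: rP; apply: CP.
Qed.

End WMax.

(** * Free modules and tensor products *)

Section FreeModules.
Variables (R : comNzRingType) (S : choiceType).
Implicit Types x y : {freeg S / R}.

Lemma freeg_ind (Q : {freeg S / R} -> Prop) :
  (forall s, Q << s >>) -> Q 0 -> (forall a x y, Q x -> Q y -> Q (a *: x + y)) ->
  forall x, Q x.
Proof.
move=> QU Q0 QD x; rewrite -(freeg_sumE x).
elim: (dom x) => [|s r IH]; first by rewrite big_nil.
rewrite big_cons; suff -> : << coeff s x *g s >> = coeff s x *: << s >> by apply: QD.
by apply/eqP/freeg_eqP => t; rewrite coeffZ !coeffU mul1r.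
Qed.

Lemma free_lift_ext (V : lmodType R) (f g : {linear {freeg S / R} -> V}) :
  (forall s, f << s >> = g << s >>) -> f =1 g.
Proof.
move=> fg; apply: freeg_ind => [//||a x y Ex Ey]; first by rewrite !raddf0.
by rewrite !linearP Ex Ey.
Qed.

End FreeModules.

Section Tensor.
Variables (R : comNzRingType) (A B : lmodType R).

Definition bilinear (Q : lmodType R) (b : A -> B -> Q) :=
  (forall y, linear (b^~ y)) /\ (forall x, linear (b x)).

Lemma tmul_bilinear : bilinear (@tmul R A B).
Proof. by split=> [y|x] a u v; rewrite ?tmulDl ?tmulDr ?tmulZl ?tmulZr. Qed.

Lemma tensor_lift_exists (Q : lmodType R) (b : A -> B -> Q) : bilinear b ->
  exists h : {linear tensor A B -> Q}, forall x y, h (tmul x y) = b x y.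
Proof.
move=> [bl br]; pose g (p : A * B) := b p.1 p.2.
have lP y a u v : b (a *: u + v) y = a *: b u y + b v y := bl y a u v.
have rP x a u v : b x (a *: u + v) = a *: b x u + b x v := br x a u v.
have l0 y : b 0 y = 0.
  by apply: (addIr (b 0 y)); rewrite -[X in X + _]scale1r -lP scale1r !addr0 add0r.
have r0 x : b x 0 = 0.
  by apply: (addIr (b x 0)); rewrite -[X in X + _]scale1r -rP scale1r !addr0 add0r.
have kill x : x \in submod_span (@tensor_rel R A B) -> free_lift g x = 0.
  move=> /(span_sub (N := lker (free_lift g))) h; apply/mem_lker/h => {h}z rz.
  apply/mem_lker; case: rz => -[r [u [v ->]]]; rewrite !raddfB /=; try rewrite linearZ /=;
    rewrite !free_liftU /g /=.
  - by rewrite -[r]scale1r lP !scale1r addrAC addrK subrr.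
  - by rewrite -[u]scale1r rP !scale1r addrAC addrK subrr.
  - by rewrite -[r *: u]addr0 lP l0 addr0 subrr.
  - by rewrite -[r *: v]addr0 rP r0 addr0 subrr.
pose h (z : tensor A B) := free_lift g (repr (z : Quotient.quot _)).
have hE x : h (lmod_pi (submod_span (@tensor_rel R A B)) x) = free_lift g x.
  rewrite /h; set y := repr _; apply/subr0_eq; rewrite -raddfB; apply: kill.
  by apply/lmod_pi_eq; rewrite /lmod_pi reprK.
have hlin : linear h.
  move=> a z t; case: (lmod_pi_surj z) (lmod_pi_surj t) => x -> [y ->].
  by rewrite -linearP !hE linearP.
by exists (to_linear hlin) => x y /=; rewrite hE free_liftU.
Qed.

Definition tensor_lift (Q : lmodType R) (b : A -> B -> Q) (hb : bilinear b) :=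
  projT1 (cid (tensor_lift_exists hb)).

Lemma tensor_lift_tmul (Q : lmodType R) (b : A -> B -> Q) (hb : bilinear b) x y :
  tensor_lift hb (tmul x y) = b x y.
Proof. by rewrite /tensor_lift; case: cid. Qed.

Lemma tensor_ind (Q : tensor A B -> Prop) :
  (forall x y, Q (tmul x y)) -> Q 0 -> (forall a x y, Q x -> Q y -> Q (a *: x + y)) ->
  forall z, Q z.
Proof.
move=> QU Q0 QD z; have [x ->] := lmod_pi_surj z.
elim/freeg_ind: x => [[x y]||a x y Qx Qy]; first exact: QU.
  by rewrite raddf0.
by rewrite linearP; apply: QD.
Qed.

Lemma tensor_ext (Q : lmodType R) (f g : {linear tensor A B -> Q}) :
  (forall x y, f (tmul x y) = g (tmul x y)) -> f =1 g.
Proof.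
move=> fg; apply: tensor_ind => [//||a x y Ex Ey]; first by rewrite !raddf0.
by rewrite !linearP Ex Ey.
Qed.

Lemma tensor_img_sub (Q : lmodType R) (h : {linear tensor A B -> Q}) (N : submodClosed Q) :
  (forall x y, h (tmul x y) \in N) -> forall z, h z \in N.
Proof.
move=> hN; apply: tensor_ind => [//||a x y hx hy]; first by rewrite raddf0 rpred0.
by rewrite linearP; apply: rpredD => //; apply: rpredZ.
Qed.

Lemma tmul0r x : tmul x 0 = 0 :> tensor A B.
Proof. by rewrite -[0 in LHS](scale0r 0) tmulZr scale0r. Qed.

Lemma tmul0l y : tmul 0 y = 0 :> tensor A B.
Proof. by rewrite -[0 in LHS](scale0r 0) tmulZl scale0r. Qed.

Lemma tmul_sumr x (I : Type) (r : seq I) (P : pred I) (F : I -> B) :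
  tmul x (\sum_(i <- r | P i) F i) = \sum_(i <- r | P i) tmul x (F i) :> tensor A B.
Proof.
by apply: (big_morph (tmul x)) => [u v|]; [exact: tmulDr | exact: tmul0r].
Qed.

End Tensor.

Section BilinearTheory.
Variables (R : comNzRingType) (A B Q : lmodType R) (b : A -> B -> Q).
Hypothesis hb : bilinear b.

Lemma bilinearPl y a u v : b (a *: u + v) y = a *: b u y + b v y.
Proof. exact: hb.1. Qed.
Lemma bilinearPr x a u v : b x (a *: u + v) = a *: b x u + b x v.
Proof. exact: hb.2. Qed.

Definition bilin_l y : {linear A -> Q} := to_linear (hb.1 y).
Definition bilin_r x : {linear B -> Q} := to_linear (hb.2 x).

Lemma bilinear0l y : b 0 y = 0. Proof. exact: (raddf0 (bilin_l y)). Qed.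
Lemma bilinearZl a x y : b (a *: x) y = a *: b x y.
Proof. exact: (linearZ_LR (bilin_l y)). Qed.
Lemma bilinearZr a x y : b x (a *: y) = a *: b x y.
Proof. exact: (linearZ_LR (bilin_r x)). Qed.
Lemma bilinearBl x x' y : b (x - x') y = b x y - b x' y.
Proof. exact: (linearB (bilin_l y)). Qed.
Lemma bilinear_sumr x (I : Type) (r : seq I) (F : I -> B) :
  b x (\sum_(i <- r) F i) = \sum_(i <- r) b x (F i).
Proof. exact: (linear_sum (bilin_r x)). Qed.
Lemma bilinear_suml (I : Type) (r : seq I) (F : I -> A) y :
  b (\sum_(i <- r) F i) y = \sum_(i <- r) b (F i) y.
Proof. exact: (linear_sum (bilin_l y)). Qed.
End BilinearTheory.

Section TensorMapr.
Variables (R : comNzRingType) (A B C : lmodType R) (g : {linear B -> C}).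

Lemma tensor_mapr_bilinear : bilinear (fun (x : A) y => tmul x (g y)).
Proof. by split=> [y|x] a u v; rewrite ?linearP ?tmulDl ?tmulDr ?tmulZl ?tmulZr. Qed.

Definition tensor_mapr : {linear tensor A B -> tensor A C} :=
  tensor_lift tensor_mapr_bilinear.

Lemma tensor_mapr_tmul x y : tensor_mapr (tmul x y) = tmul x (g y).
Proof. exact: tensor_lift_tmul. Qed.

End TensorMapr.
Arguments tensor_mapr {R} A {B C} g.

Lemma tensor_map_mapr (R : comNzRingType) (A A' B C : lmodType R)
    (f : {linear A -> A'}) (g : {linear B -> C}) z :
  tensor_map C f (tensor_mapr A g z) = tensor_mapr A' g (tensor_map B f z).
Proof.
apply: (tensor_ext (f := (tensor_map C f \o tensor_mapr A g : {linear _ -> _}))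
                   (g := (tensor_mapr A' g \o tensor_map B f : {linear _ -> _}))).
by move=> x y /=; rewrite tensor_map_tmul !tensor_mapr_tmul tensor_map_tmul.
Qed.

Section FreeTensor.
Variables (R : comNzRingType) (S : choiceType) (M : lmodType R).
Local Notation F := {freeg S / R}.

Lemma tensor_freeg_span (z : tensor F M) :
  exists l : seq (S * M), z = \sum_(p <- l) tmul << p.1 >> p.2.
Proof.
elim/tensor_ind: z => [x m||a _ _ [l ->] [l' ->]].
- elim/freeg_ind: x => [s||a x y [l El] [l' El']]; first by exists [:: (s, m)]; rewrite big_seq1.
    by exists [::]; rewrite big_nil tmul0l.
  rewrite tmulDl tmulZl El El'.
  exists ([seq (p.1, a *: p.2) | p <- l] ++ l'); rewrite big_cat big_map scaler_sumr.
  by congr (_ + _); apply: eq_bigr => p _; rewrite tmulZr.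
- by exists [::]; rewrite big_nil.
- exists ([seq (p.1, a *: p.2) | p <- l] ++ l'); rewrite big_cat big_map scaler_sumr.
  by congr (_ + _); apply: eq_bigr => p _; rewrite tmulZr.
Qed.

Lemma tcoeff_bilinear s : bilinear (fun (x : F) (m : M) => coeff s x *: m).
Proof.
split=> [m|x] a u v; last by rewrite scalerDr !scalerA mulrC.
by rewrite coeffD coeffZ scalerDl scalerA.
Qed.
Definition tcoeff s : {linear tensor F M -> M} := tensor_lift (tcoeff_bilinear s).

Lemma tcoeff_tmul s x m : tcoeff s (tmul x m) = coeff s x *: m.
Proof. exact: tensor_lift_tmul. Qed.

Lemma tensor_freeg_coeff (z : tensor F M) :
  exists D : seq S, z = \sum_(s <- D) tmul << s >> (tcoeff s z).
Proof.
have [l ->] := tensor_freeg_span z.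
exists (undup (map fst l)).
under [RHS]eq_bigr => s _.
  rewrite linear_sum tmul_sumr.
  under eq_bigr => p _ do rewrite tcoeff_tmul coeffU mul1r tmulZr.
  over.
rewrite exchange_big big_seq [RHS]big_seq; apply: eq_bigr => p pl /=.
rewrite (bigD1_seq p.1) ?undup_uniq ?mem_undup ?map_f //= eqxx scale1r.
by rewrite big1 ?addr0 // => s sp; rewrite eq_sym (negPf sp) scale0r.
Qed.

End FreeTensor.
Arguments tcoeff {R S M} s.

Lemma tcoeff_mapr (R : comNzRingType) (S : choiceType) (M N : lmodType R)
    (g : {linear M -> N}) s (z : tensor {freeg S / R} M) :
  tcoeff s (tensor_mapr _ g z) = g (tcoeff s z).
Proof.
apply: (tensor_ext (f := (tcoeff s \o tensor_mapr _ g : {linear _ -> _}))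
                   (g := (g \o tcoeff s : {linear _ -> _}))).
by move=> x y /=; rewrite tensor_mapr_tmul !tcoeff_tmul linearZ.
Qed.

(** Exactness at B up to GV-torsion; w-exact sequences have this property. *)
Definition gv_exact (R : comNzRingType) (A B C : lmodType R)
    (f : {linear A -> B}) (g : {linear B -> C}) :=
  forall y, g y \in gv_null C -> y \in w_closure (limg f).

(** For F free, F (x) B is a direct sum of copies of B, functorially in B. *)
Lemma free_tensor_gv_exact (R : comNzRingType) (S : choiceType) (A B C : lmodType R)
    (f : {linear A -> B}) (g : {linear B -> C}) : gv_exact f g ->
  gv_exact (tensor_mapr {freeg S / R} f) (tensor_mapr {freeg S / R} g).
Proof.
move=> fg z gz; have [D ->] := tensor_freeg_coeff z.
apply: rpred_sum => s _.
apply: (w_closure_map (f := bilin_r (tmul_bilinear _ _) << s >>) (N := limg f)).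
  move=> _ /limgP[x <-] /=; rewrite -tensor_mapr_tmul; apply: sub_w_closure.
  exact: mem_limg.
by apply: fg; rewrite -tcoeff_mapr; apply: gv_null_map.
Qed.

Definition gv_injective (R : comNzRingType) (A B : lmodType R) (f : {linear A -> B}) :=
  forall x, f x \in gv_null B -> x \in gv_null A.

Definition gv_surjective (R : comNzRingType) (A B : lmodType R) (f : {linear A -> B}) :=
  forall y, y \in w_closure (limg f).

Lemma tensor_mapr0 (R : comNzRingType) (A B C : lmodType R) (z : tensor A B) :
  tensor_mapr A (\0 : {linear B -> C}) z = 0.
Proof.
apply: (tensor_ext (f := tensor_mapr A (\0 : {linear B -> C})) (g := \0)) => x y /=.
by rewrite tensor_mapr_tmul tmul0r.
Qed.

Lemma free_tensor_gv_injective (R : comNzRingType) (S : choiceType) (A B : lmodType R)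
    (f : {linear A -> B}) : gv_injective f -> gv_injective (tensor_mapr {freeg S / R} f).
Proof.
move=> injf z fz; have := @free_tensor_gv_exact R S A A B \0 f _ z fz.
have exf : gv_exact (\0 : {linear A -> A}) f by move=> x /injf; exact: gv_null_sub.
by move=> /(_ exf); apply: w_closure_idem => _ /limgP[y <-]; rewrite tensor_mapr0 rpred0.
Qed.

Lemma free_tensor_gv_surjective (R : comNzRingType) (S : choiceType) (A B : lmodType R)
    (f : {linear A -> B}) : gv_surjective f -> gv_surjective (tensor_mapr {freeg S / R} f).
Proof.
move=> surf z; apply: (@free_tensor_gv_exact R S A B B f \0) => [y _|]; first exact: surf.
by rewrite tensor_mapr0 rpred0.
Qed.

Lemma tensor_mapr_gv_null (R : comNzRingType) (A B C D : lmodType R)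
    (f : {linear B -> C}) (g : {linear C -> D}) : (forall x, g (f x) \in gv_null D) ->
  forall z, tensor_mapr A g (tensor_mapr A f z) \in gv_null (tensor A D).
Proof.
move=> gf; apply: (tensor_img_sub
  (h := (tensor_mapr A g \o tensor_mapr A f : {linear _ -> _}))) => x y /=.
rewrite !tensor_mapr_tmul.
exact: (gv_null_map (bilin_r (tmul_bilinear _ _) x) (gf y)).
Qed.

(** * Tor up to GV-torsion *)

(** Two chases in the long exact sequence of a short exact sequence of
    complexes, everything being exact up to GV-torsion. *)
Section LongExactSequence.
Variables (R : comNzRingType).

Definition null_homology (A B C : lmodType R) (f : {linear A -> B}) (g : {linear B -> C}) :=
  forall y, g y = 0 -> y \in w_closure (limg f).

Variables (A0 A1 A2 B0 B1 B2 B3 C1 C2 C3 : lmodType R).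
Variables (a0 : {linear A1 -> A0}) (a1 : {linear A2 -> A1}).
Variables (b0 : {linear B1 -> B0}) (b1 : {linear B2 -> B1}) (b2 : {linear B3 -> B2}).
Variables (c1 : {linear C2 -> C1}) (c2 : {linear C3 -> C2}).
Variables (f0 : {linear A0 -> B0}) (f1 : {linear A1 -> B1}) (f2 : {linear A2 -> B2}).
Variables (g1 : {linear B1 -> C1}) (g2 : {linear B2 -> C2}) (g3 : {linear B3 -> C3}).
Hypotheses (b01 : forall y, b0 (b1 y) = 0) (b12 : forall y, b1 (b2 y) = 0).
Hypotheses (fa0 : forall x, f0 (a0 x) = b0 (f1 x)) (fa1 : forall x, f1 (a1 x) = b1 (f2 x)).
Hypotheses (gb1 : forall y, g1 (b1 y) = c1 (g2 y)) (gb2 : forall y, g2 (b2 y) = c2 (g3 y)).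

Let closure_witness (V W : lmodType R) (h : {linear V -> W}) z (N : submodClosed W) :
  z \in w_closure (limg h) ->
  (forall r : R, forall x, h x = r *: z -> r *: z \in w_closure N) -> z \in w_closure N.
Proof.
move=> /w_closureP[G gG Gz] h1; apply: (w_closure_trans gG) => r /Gz /limgP[x].
exact: h1.
Qed.

Lemma null_homology_quot : gv_injective f0 -> gv_exact f1 g1 ->
  gv_surjective g2 -> (forall x, g2 (f2 x) \in gv_null C2) ->
  null_homology a1 a0 -> null_homology b2 b1 -> null_homology c2 c1.
Proof.
move=> injf fg surg gf nulA nulB z cz.
apply: (closure_witness (surg z)) => r y yE.
have {cz} cy : g1 (b1 y) = 0 by rewrite gb1 yE linearZ_LR cz scaler0.
rewrite -{}yE {z r}.
have /w_closureP[G gG Gy] : b1 y \in w_closure (limg f1) by apply: fg; rewrite cy rpred0.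
apply: (w_closure_trans gG) => r /Gy /limgP[x]; rewrite -!linearZ_LR {Gy gG cy}.
move: (r *: y) => {G r}{}y xE.
have xcl : x \in w_closure (limg a1).
  have /w_closureP[G gG Gx] : a0 x \in gv_null A0.
    by apply: injf; rewrite fa0 xE b01 rpred0.
  apply: (w_closure_trans gG) => r rG; apply: nulA; rewrite linearZ_LR.
  exact/mem_zero_submod/Gx.
have /w_closureP[G gG Gx] := xcl.
apply: (w_closure_trans gG) => r /Gx /limgP[u uE]; rewrite -linearZ_LR.
have /nulB ycl : b1 (r *: y - f2 u) = 0.
  by rewrite linearB linearZ_LR -xE -fa1 uE linearZ_LR subrr.
rewrite -[r *: y](subrK (f2 u)) linearD; apply: rpredD.
  apply: w_closure_map ycl => _ /limgP[t <-]; rewrite gb2.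
  by apply: sub_w_closure; exact: mem_limg.
exact: gv_null_sub.
Qed.

Lemma null_homology_sub : gv_injective f1 -> gv_exact f2 g2 ->
  gv_surjective g3 -> (forall x, g1 (f1 x) = 0) ->
  null_homology b1 b0 -> null_homology c2 c1 -> null_homology a1 a0.
Proof.
move=> injf fg surg gf nulB nulC z az.
have /nulB/w_closureP[G gG Gz] : b0 (f1 z) = 0 by rewrite -fa0 az raddf0.
apply: (w_closure_trans gG) => r /Gz /limgP[u].
rewrite -linearZ_LR {az Gz gG}; move: (r *: z) => {G r}{}z uE.
have /nulC/w_closureP[G gG Gu] : c1 (g2 u) = 0 by rewrite -gb1 uE gf.
apply: (w_closure_trans gG) => r /Gu /limgP[t]; rewrite -linearZ_LR {Gu gG}.
have {uE} : b1 (r *: u) = f1 (r *: z) by rewrite !linearZ_LR uE.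
move: (r *: z) (r *: u) => {G r}{}z {}u uE tE.
have /w_closureP[G gG Gt] := surg t.
apply: (w_closure_trans gG) => r /Gt /limgP[t'] {Gt gG} t'E.
have /w_closureP[H gH Hx] : r *: u - b2 t' \in w_closure (limg f2).
  by apply: fg; rewrite linearB linearZ_LR -tE gb2 t'E linearZ_LR subrr rpred0.
apply: (w_closure_trans gH) => s /Hx /limgP[x xE].
rewrite -[s *: (r *: z)](subrK (a1 x)); apply: rpredD; last first.
  by apply: sub_w_closure; exact: mem_limg.
apply/gv_null_sub/injf.
have -> : f1 (s *: (r *: z) - a1 x) = 0; last exact: rpred0.
rewrite linearB fa1 xE [b1 _]linearZ_LR [b1 _]linearB b12 subr0 [b1 _]linearZ_LR uE.
by rewrite [f1 (s *: _)]linearZ_LR [f1 (r *: _)]linearZ_LR subrr.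
Qed.

End LongExactSequence.

#[local] Opaque tensor tensor_map tmul.

Lemma tensor_map_comp0 (R : comNzRingType) (A B C M : lmodType R)
    (f : {linear A -> B}) (g : {linear B -> C}) : (forall x, g (f x) = 0) ->
  forall z, tensor_map M g (tensor_map M f z) = 0.
Proof.
move=> gf; apply: (tensor_ext (g := \0)
  (f := (tensor_map M g \o tensor_map M f : {linear _ -> _}))) => x m /=.
by rewrite !tensor_map_tmul gf tmul0l.
Qed.

(** The kernel of K (x) M -> F (x) M for a submodule K of a free module F, in
    terms of a free presentation d' of K: since K (x) M is the cokernel of
    d' (x) M, an element of it is GV-torsion iff every bilinear map sends it to
    a GV-torsion element. *)
Lemma presentation_null_homology (R : comNzRingType) (F F2 M : lmodType R)
    (K : submodClosed F) (d : {linear {freeg (submod K) / R} -> F})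
    (d' : {linear F2 -> {freeg (submod K) / R}}) :
  (forall x, d << x >> = val x) -> (forall x, d x = 0 <-> x \in limg d') ->
  null_homology (tensor_map M d') (tensor_map M d) <->
  forall l : seq (submod K * M),
    \sum_(p <- l) tmul (val p.1) p.2 = 0 :> tensor F M ->
  forall (Q : lmodType R) (b : submod K -> M -> Q),
    bilinear b -> \sum_(p <- l) b p.1 p.2 \in gv_null Q.
Proof.
move=> dU dexact.
have cover0 x : d x = 0 -> free_cover x = 0.
  move=> dx; apply: val_inj; rewrite -[RHS]dx.
  apply: (free_lift_ext (f := (val \o @free_cover R (submod K) : {linear _ -> _}))) => s /=.
  by rewrite dU /free_cover free_liftU.
have cover_d' x : free_cover (d' x) = 0.
  by apply/cover0/dexact; exact: mem_limg.
split=> [nul l dl Q b hb|kill].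
  pose z : tensor {freeg (submod K) / R} M := \sum_(p <- l) tmul << p.1 >> p.2.
  have /nul zcl : tensor_map M d z = 0.
    by rewrite /z linear_sum -[RHS]dl; apply: eq_bigr => p _; rewrite /= tensor_map_tmul dU.
  have hc : bilinear (fun (x : {freeg (submod K) / R}) (m : M) => b (free_cover x) m).
    split=> [m|x] a u v; last exact: bilinearPr.
    by rewrite linearP bilinearPl.
  have -> : \sum_(p <- l) b p.1 p.2 = tensor_lift hc z.
    rewrite /z linear_sum; apply: eq_bigr => p _.
    by rewrite tensor_lift_tmul /free_cover free_liftU.
  apply: w_closure_map zcl => _ /limgP[y <-]; apply: sub_w_closure; apply/mem_zero_submod.
  apply: (tensor_ext (g := \0) (f := (tensor_lift hc \o
    tensor_map M d' : {linear _ -> _}))) => x m /=.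
  by rewrite tensor_map_tmul tensor_lift_tmul cover_d' bilinear0l.
move=> z; have [l ->] := tensor_freeg_span z => dl.
set L := limg _.
pose b (x : submod K) (m : M) : lmod_quot L := lmod_pi L (tmul << x >> m).
have piL x : d x = 0 -> forall m, lmod_pi L (tmul x m) = 0.
  move=> /dexact/limgP[y <-] m; rewrite -[RHS](linear0 (lmod_pi L)); apply/lmod_pi_eq.
  by rewrite subr0; apply/limgP; exists (tmul y m); rewrite /= tensor_map_tmul.
have hb : bilinear b.
  split=> [m|x] a u v; last by rewrite /b tmulDr tmulZr linearP.
  rewrite /b -[<< a *: u + v >>](subrK (a *: << u >> + << v >>)) tmulDl linearD /=.
  rewrite piL; last by rewrite linearB linearP !dU linearP subrr.
  by rewrite add0r tmulDl tmulZl linearP.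
apply/gv_null_quot; rewrite linear_sum; apply: (kill _ _ _ b) => //.
rewrite -[RHS]dl linear_sum; apply: eq_bigr => p _.
by rewrite /= tensor_map_tmul dU.
Qed.

Section FreeComplex.
Variables (R : comNzRingType) (S0 S1 S2 S3 : choiceType).
Variables (d0 : {linear {freeg S1 / R} -> {freeg S0 / R}})
  (d1 : {linear {freeg S2 / R} -> {freeg S1 / R}})
  (d2 : {linear {freeg S3 / R} -> {freeg S2 / R}}).
Variables (A B C : lmodType R) (f : {linear A -> B}) (g : {linear B -> C}).

Lemma free_null_homology_quot : (forall x, d0 (d1 x) = 0) ->
  gv_injective f -> gv_exact f g -> gv_surjective g -> (forall x, g (f x) \in gv_null C) ->
  null_homology (tensor_map A d1) (tensor_map A d0) ->
  null_homology (tensor_map B d2) (tensor_map B d1) ->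
  null_homology (tensor_map C d2) (tensor_map C d1).
Proof.
move=> dd injf fg surg gf.
apply: (@null_homology_quot R _ _ _ _ _ _ _ _ _ _ _ _ _ _ _ _ _
  (tensor_mapr _ f) (tensor_mapr _ f) (tensor_mapr _ f)
  (tensor_mapr _ g) (tensor_mapr _ g) (tensor_mapr _ g)) => [x|x|x|x|x||||x].
- exact: tensor_map_comp0.
- exact: esym (tensor_map_mapr _ _ _).
- exact: esym (tensor_map_mapr _ _ _).
- exact: esym (tensor_map_mapr _ _ _).
- exact: esym (tensor_map_mapr _ _ _).
- exact: free_tensor_gv_injective.
- exact: free_tensor_gv_exact.
- exact: free_tensor_gv_surjective.
- exact: tensor_mapr_gv_null.
Qed.

Lemma free_null_homology_sub : (forall x, d1 (d2 x) = 0) ->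
  gv_injective f -> gv_exact f g -> gv_surjective g -> (forall x, g (f x) = 0) ->
  null_homology (tensor_map B d1) (tensor_map B d0) ->
  null_homology (tensor_map C d2) (tensor_map C d1) ->
  null_homology (tensor_map A d1) (tensor_map A d0).
Proof.
move=> dd injf fg surg gf.
apply: (@null_homology_sub R _ _ _ _ _ _ _ _ _ _ _ _ _ _ _ _ _
  (tensor_mapr _ f) (tensor_mapr _ f) (tensor_mapr _ f)
  (tensor_mapr _ g) (tensor_mapr _ g) (tensor_mapr _ g)) => [x|x|x|x|x||||x].
- exact: tensor_map_comp0.
- exact: esym (tensor_map_mapr _ _ _).
- exact: esym (tensor_map_mapr _ _ _).
- exact: esym (tensor_map_mapr _ _ _).
- exact: esym (tensor_map_mapr _ _ _).
- exact: free_tensor_gv_injective.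
- exact: free_tensor_gv_exact.
- exact: free_tensor_gv_surjective.
- apply: (tensor_ext (g := \0)
    (f := (tensor_mapr _ g \o tensor_mapr _ f : {linear _ -> _}))) => u v /=.
  by rewrite !tensor_mapr_tmul gf tmul0r.
Qed.

End FreeComplex.

Section Resolution.
Variable R : comNzRingType.
Implicit Types T M N : lmodType R.

Lemma resolution_dU T n (x : syzygy T n.+1) : @resolution_d R T n << x >> = val x.
Proof. by rewrite /resolution_d /free_cover free_liftU. Qed.

Lemma resolution_exact T n (x : resolution T n.+1) :
  @resolution_d R T n x = 0 <-> x \in limg (@resolution_d R T n.+1).
Proof.
split=> [dx|/limgP[y <-]]; last first.
  rewrite {1}/resolution_d; suff -> : free_cover (@resolution_d R T n.+1 y) = 0 by [].
  exact/mem_lker/valP.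
have xK : x \in lker (@free_cover R (syzygy T n.+1)) by apply/mem_lker/val_inj.
by apply/limgP; exists << Submod xK : syzygy T n.+2 >>; exact: resolution_dU.
Qed.

Lemma resolution_dd T n x : @resolution_d R T n (@resolution_d R T n.+1 x) = 0.
Proof. by apply/resolution_exact; exact: mem_limg. Qed.

(** The differential, with source and target displayed as free modules. *)
Definition resolution_map T n :
    {linear {freeg (syzygy T n.+1) / R} -> {freeg (syzygy T n) / R}} :=
  @resolution_d R T n : {linear resolution T n.+1 -> resolution T n}.

(** The index of Tor is n + 1. *)
Definition tor_null n T M :=
  null_homology (tensor_map M (resolution_map T n.+1)) (tensor_map M (resolution_map T n)).

Lemma Tor_GV_torsionP n T M : GV_torsion (Tor n.+1 T M) <-> tor_null n T M.
Proof.
have clE (z : submod (Tor_cycles T M n.+1)) :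
    z \in w_closure (limg_in (tensor_map M (@resolution_d R T n.+1)) (Z := Tor_cycles T M n.+1)) <->
    val z \in w_closure (limg (tensor_map M (@resolution_d R T n.+1))).
  by split=> /w_closureP[J gJ Jz]; apply/w_closureP; exists J => // r /Jz.
split=> [/GV_torsionP tor z dz|nul].
  have zZ : z \in Tor_cycles T M n.+1 by apply/mem_lker.
  by apply: (clE (Submod zZ)).1; apply/gv_null_quot; exact: tor.
apply/GV_torsionP => x; have [z ->] := lmod_pi_surj x.
apply/gv_null_quot/clE/nul; exact/mem_lker/(valP z).
Qed.

Lemma Tor1_GV_torsionP T M : GV_torsion (Tor 1 T M) <->
  forall l : seq (submod (lker (@free_cover R T)) * M),
    \sum_(p <- l) tmul (val p.1) p.2 = 0 :> tensor {freeg T / R} M ->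
  forall (Q : lmodType R) (b : submod (lker (@free_cover R T)) -> M -> Q),
    bilinear b -> \sum_(p <- l) b p.1 p.2 \in gv_null Q.
Proof.
have := @presentation_null_homology R {freeg T / R} (resolution T 2) M
  (lker (@free_cover R T))
  (@resolution_d R T 0 : {linear resolution T 1 -> resolution T 0})
  (@resolution_d R T 1 : {linear resolution T 2 -> resolution T 1})
  (@resolution_dU T 0) (@resolution_exact T 0).
move=> h; split=> [/Tor_GV_torsionP/h //|k]; exact/Tor_GV_torsionP/h.
Qed.

Lemma tor_null_quot n T (A B C : lmodType R) (f : {linear A -> B}) (g : {linear B -> C}) :
  gv_injective f -> gv_exact f g -> gv_surjective g -> (forall x, g (f x) \in gv_null C) ->
  tor_null n T A -> tor_null n.+1 T B -> tor_null n.+1 T C.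
Proof.
exact: (free_null_homology_quot (d0 := resolution_map T n) (d1 := resolution_map T n.+1)
  (d2 := resolution_map T n.+2) (@resolution_dd T n)).
Qed.

Lemma tor_null_sub n T (A B C : lmodType R) (f : {linear A -> B}) (g : {linear B -> C}) :
  gv_injective f -> gv_exact f g -> gv_surjective g -> (forall x, g (f x) = 0) ->
  tor_null n T B -> tor_null n.+1 T C -> tor_null n T A.
Proof.
exact: (free_null_homology_sub (d0 := resolution_map T n) (d1 := resolution_map T n.+1)
  (d2 := resolution_map T n.+2) (@resolution_dd T n.+1)).
Qed.

End Resolution.

(** * Flatness of R and acyclicity of free modules *)

Section Regular.
Variables (R : comNzRingType).

Lemma regular_bilinear (A : lmodType R) : bilinear (fun (x : A) (r : R^o) => (r : R) *: x).
Proof.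
split=> [r|x] a u v; last by rewrite scalerDl scalerA.
by rewrite scalerDr !scalerA mulrC.
Qed.
Definition tensor_regular (A : lmodType R) : {linear tensor A R^o -> A} :=
  tensor_lift (@regular_bilinear A).

Lemma tensor_regularK (A : lmodType R) (z : tensor A R^o) :
  z = tmul (tensor_regular A z) (1 : R^o).
Proof.
apply: (tensor_ext (f := idfun)
  (g := (bilin_l (@tmul_bilinear R A R^o) (1 : R^o) \o tensor_regular A : {linear _ -> _}))).
by move=> x r /=; rewrite /tensor_regular tensor_lift_tmul tmulZl -tmulZr [_ *: _]mulr1.
Qed.

Lemma tensor_regular_map (A B : lmodType R) (f : {linear A -> B}) z :
  tensor_regular B (tensor_map R^o f z) = f (tensor_regular A z).
Proof.
apply: (tensor_ext (f := (tensor_regular B \o tensor_map R^o f : {linear _ -> _}))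
                   (g := (f \o tensor_regular A : {linear _ -> _}))) => x r /=.
by rewrite tensor_map_tmul /tensor_regular !tensor_lift_tmul linearZ_LR.
Qed.

Lemma flat_regular : flat (R^o : lmodType R).
Proof.
move=> A B f injf z t zt; rewrite [z]tensor_regularK [t]tensor_regularK.
by congr tmul; apply: injf; rewrite -!tensor_regular_map zt.
Qed.

Lemma null_homology_regular (A B C : lmodType R) (f : {linear A -> B}) (g : {linear B -> C}) :
  (forall y, g y = 0 -> y \in limg f) ->
  null_homology (tensor_map R^o f) (tensor_map R^o g).
Proof.
move=> fg z gz; apply/sub_w_closure/limgP; have := tensor_regular_map g z.
rewrite gz raddf0 => /esym/fg/limgP[y fy].
exists (tmul y (1 : R^o)); rewrite [RHS]tensor_regularK -fy.
exact: tensor_map_tmul.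
Qed.

Lemma tor_null_regular n (T : lmodType R) : tor_null n T R^o.
Proof. by apply: null_homology_regular => y /resolution_exact. Qed.

Lemma swap_bilinear (A B : lmodType R) : bilinear (fun (x : A) (y : B) => tmul y x).
Proof. by split=> [y|x] a u v; rewrite ?tmulDl ?tmulDr ?tmulZl ?tmulZr. Qed.
Definition tensor_swap (A B : lmodType R) : {linear tensor A B -> tensor B A} :=
  tensor_lift (@swap_bilinear A B).

Lemma tensor_swap_tmul (A B : lmodType R) (x : A) (y : B) :
  tensor_swap A B (tmul x y) = tmul y x.
Proof. exact: tensor_lift_tmul. Qed.

Lemma tensor_swapK (A B : lmodType R) z : tensor_swap B A (tensor_swap A B z) = z.
Proof.
apply: (tensor_ext (f := (tensor_swap B A \o tensor_swap A B : {linear _ -> _}))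
  (g := idfun)) => x y /=.
by rewrite !tensor_swap_tmul.
Qed.

Lemma tensor_swap_map (A B M : lmodType R) (f : {linear A -> B}) z :
  tensor_swap B M (tensor_map M f z) = tensor_mapr M f (tensor_swap A M z).
Proof.
apply: (tensor_ext (f := (tensor_swap B M \o tensor_map M f : {linear _ -> _}))
  (g := (tensor_mapr M f \o tensor_swap A M : {linear _ -> _}))) => x y /=.
by rewrite tensor_map_tmul !tensor_swap_tmul tensor_mapr_tmul.
Qed.

Lemma gv_exact_of_exact (A B C : lmodType R) (f : {linear A -> B}) (g : {linear B -> C}) :
  (forall y, g y = 0 -> y \in limg f) -> gv_exact f g.
Proof.
move=> fg y /w_closureP[J gJ Jy]; apply/w_closureP; exists J => // r /Jy/mem_zero_submod.
by rewrite -linearZ_LR; apply: fg.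
Qed.

Lemma null_homology_free (A B C : lmodType R) (S : choiceType)
    (f : {linear A -> B}) (g : {linear B -> C}) :
  (forall y, g y = 0 -> y \in limg f) ->
  null_homology (tensor_map {freeg S / R} f) (tensor_map {freeg S / R} g).
Proof.
move=> /gv_exact_of_exact fg z gz; rewrite -[z]tensor_swapK.
apply: (w_closure_map (f := tensor_swap _ _) (N := limg (tensor_mapr {freeg S / R} f))).
  move=> _ /limgP[y <-]; rewrite -[y]tensor_swapK -tensor_swap_map tensor_swapK.
  by apply: sub_w_closure; exact: mem_limg.
apply: (free_tensor_gv_exact fg).
by rewrite -tensor_swap_map gz raddf0 rpred0.
Qed.

Lemma tor_null_free n (T : lmodType R) (S : choiceType) : tor_null n T {freeg S / R}.
Proof. by apply: null_homology_free => y /resolution_exact. Qed.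

Lemma gv_injective_val (M : lmodType R) (N : submodClosed M) :
  gv_injective (val : {linear submod N -> M}).
Proof.
(* Equality in a submodule is, by computation, equality of the values. *)
by move=> x /w_closureP[J gJ Jx]; apply/w_closureP; exists J.
Qed.

Lemma gv_surjective_of_surjective (A B : lmodType R) (f : {linear A -> B}) :
  (forall y, exists x, f x = y) -> gv_surjective f.
Proof. by move=> surf y; apply/sub_w_closure/limgP; apply: surf. Qed.

Lemma mem_limg_val (M : lmodType R) (N : submodClosed M) x :
  x \in N -> x \in limg (val : {linear submod N -> M}).
Proof. by move=> xN; apply/limgP; exists (Submod xN). Qed.

(** Dimension shifting along 0 -> K -> F -> M -> 0 with F free. *)
Lemma tor_null_syzygy n (T M : lmodType R) :
  tor_null n T (submod (lker (@free_cover R M))) -> tor_null n.+1 T M.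
Proof.
move=> nulK; apply: (tor_null_quot (f := (val : {linear submod (lker (@free_cover R M)) -> {freeg M / R}}))
  (g := (@free_cover R M : {linear {freeg M / R} -> M}))) => [||||//|].
- exact: gv_injective_val.
- by apply: gv_exact_of_exact => y y0; apply: mem_limg_val; apply/mem_lker.
- by apply: gv_surjective_of_surjective => y; exists << y >>; exact: free_liftU.
- by move=> x; have /mem_lker /= -> := valP x; exact: rpred0.
- exact: tor_null_free.
Qed.

End Regular.

(** * Modules without torsion up to GV-torsion *)

Section TorsionFree.
Variable R : comNzRingType.

Definition nonnil_regular := forall x : R, (x : R^o) \notin nilradical R ->
  forall y, x * y = 0 -> y = 0.

(** For strongly phi-rings that are phi-PvMRs this characterizes the strongly
    phi-w-flat modules, and it passes to submodules. *)
Definition nonnil_torsion_free (M : lmodType R) :=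
  forall (r : R) (m : M), (r : R^o) \notin nilradical R -> r *: m \in gv_null M -> m \in gv_null M.

Lemma nonnil_torsion_free_sub (M : lmodType R) (N : submodClosed M) :
  nonnil_torsion_free M -> nonnil_torsion_free (submod N).
Proof.
by move=> tfM r x rN rx; apply: gv_injective_val; apply: (tfM r).
Qed.

Lemma nonnil_torsion_freeW (M : lmodType R) :
  (forall (r : R) (m : M), (r : R^o) \notin nilradical R -> r *: m = 0 -> m \in gv_null M) ->
  nonnil_torsion_free M.
Proof.
move=> h r m rN /w_closureP[J gJ Jm]; apply: (w_closure_trans gJ) => s /Jm/mem_zero_submod sm.
by apply: (h r) => //; rewrite scalerA mulrC -scalerA.
Qed.

(** The trace ideal of I, generated by the values of the maps I -> R.  When I
    contains a regular element it is I I^-1. *)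
Definition trace_ideal (I : ideal R) : ideal R :=
  submod_span [set c : R^o | exists (h : {linear submod I -> R^o}) x, c = h x].

Definition trace_dense (I : ideal R) := (1 : R^o) \in w_closure (trace_ideal I).

Lemma ideal_hom_swap (I : ideal R) (h : {linear submod I -> R^o}) (x y : submod I) :
  (h x : R) * val y = h y * (val x : R).
Proof.
rewrite [LHS]mulrC [RHS]mulrC -[LHS]/((val y : R) *: h x) -[RHS]/((val x : R) *: h y).
rewrite -!linearZ_LR; congr (h _); apply: val_inj; rewrite !linearZ_LR.
exact: mulrC.
Qed.

Section Elimination.
Variables (S : choiceType) (K : submodClosed {freeg S / R}) (M Q : lmodType R).
Variables (b : submod K -> M -> Q) (hb : bilinear b).
Hypothesis tfM : nonnil_torsion_free M.
Hypothesis trR : forall I : ideal R, nonnil I -> fg_submod I -> trace_dense I.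
Hypothesis torK : forall s : S, exists2 r : R, (r : R^o) \notin nilradical R & r *: << s >> \in K.

(** Gaussian elimination of one coordinate s after the other.  The ideal I
    generated by the s-coordinates and by some nonnil r with r s in K has a dense
    trace, so it suffices to treat the multiples by h x, for a map h : I -> R and
    the s-coordinate x of some k in K.  As h x y = h y x, the element
    h x k_j - h (k_j s) k has no s-coordinate, and the correction k (x) t has a
    coefficient t killed by r up to GV-torsion. *)
Lemma eliminate (D : seq S) (l : seq (submod K * M)) :
  (forall p s, p \in l -> s \notin D -> coeff s (val p.1) = 0) ->
  (forall s, \sum_(p <- l) coeff s (val p.1) *: p.2 \in gv_null M) ->
  \sum_(p <- l) b p.1 p.2 \in gv_null Q.
Proof.
elim: D l => [|s D IH] l supp rel.
  rewrite big_seq big1 ?rpred0 // => p pl; suff -> : p.1 = 0 by rewrite bilinear0l.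
  by apply/val_inj/eqP/freeg_eqP => s; rewrite supp // raddf0.
have [r rN rK] := torK s.
pose cs (k : submod K) : R^o := coeff s (val k).
pose t : seq R^o := (r : R^o) :: [seq cs p.1 | p <- l].
pose I : ideal R := submod_span [set` t].
have It x : x \in t -> x \in I by move=> xt; apply: mem_span.
have rI : (r : R^o) \in I by apply: It; rewrite mem_head.
have Idense : trace_dense I by apply: trR; [exists r | exists t].
have [k [kI ksupp]] : exists k : submod I -> submod K, (forall x, cs (k x) = val x) /\
    forall x u, u \notin s :: D -> coeff u (val (k x)) = 0.
  suff /choice[k kP] : forall x : submod I, exists k : submod K, cs k = val x /\
      forall u, u \notin s :: D -> coeff u (val k) = 0.
    by exists k; split=> x; case: (kP x).
  case=> x xI /=; move: x xI; apply: (span_ind (Q := fun x : R^o => exists k : submod K,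
    cs k = x /\ forall u, u \notin s :: D -> coeff u (val k) = 0)) => [x|| a x y [k [<- ksupp]] [k' [<- ksupp']]].
  - rewrite /= inE => /predU1P[->|/mapP[p pl ->]].
      exists (Submod rK); rewrite /cs /= coeffZ coeffU eqxx !mulr1; split=> // u.
      rewrite inE negb_or => /andP[us _].
      by rewrite coeffZ coeffU eq_sym (negPf us) !mulr0.
    by exists p.1; split=> // u uD; apply: supp.
  - by exists 0; split=> [|u _]; rewrite /cs !raddf0.
  - exists (a *: k + k'); split=> [|u uD]; first by rewrite /cs linearP coeffD coeffZ.
    by rewrite linearP coeffD coeffZ ksupp // ksupp' // mulr0 addr0.
apply: (w_closure_dense Idense).
apply: (span_ind (Q := fun a : R^o => (a : R) *: (\sum_(p <- l) b p.1 p.2) \in gv_null Q))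
  => [_ [h [x ->]]||a x y hx hy].
- pose c (k' : submod K) : submod I := insubd 0 (cs k').
  have cE p : p \in l -> val (c p.1) = cs p.1.
    move=> pl; rewrite /c insubdK //; apply: It; rewrite in_cons; apply/orP; right.
    by apply/mapP; exists p.
  pose t' : M := \sum_(p <- l) (h (c p.1) : R) *: p.2.
  have t'0 : t' \in gv_null M.
    apply: (tfM rN); rewrite /t' scaler_sumr.
    have -> : \sum_(p <- l) r *: ((h (c p.1) : R) *: p.2) =
              (h (Submod rI) : R) *: \sum_(p <- l) coeff s (val p.1) *: p.2.
      rewrite scaler_sumr !big_seq; apply: eq_bigr => p pl; rewrite !scalerA.
      by rewrite -[coeff _ _]/(cs p.1) -cE // -ideal_hom_swap mulrC.
    exact: rpredZ.
  pose l' := [seq ((h x : R) *: p.1 - (h (c p.1) : R) *: k x, p.2) | p <- l].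
  have l'E : (h x : R) *: \sum_(p <- l) b p.1 p.2 = \sum_(p <- l') b p.1 p.2 + b (k x) t'.
    rewrite big_map /= (bilinear_sumr hb) -big_split scaler_sumr; apply: eq_bigr => p _ /=.
    by rewrite (bilinearBl hb) !(bilinearZl hb) (bilinearZr hb) subrK.
  have csE p u : coeff u (val ((h x : R) *: p.1 - (h (c p.1) : R) *: k x)) =
      (h x : R) * coeff u (val p.1) - (h (c p.1) : R) * coeff u (val (k x)).
    by rewrite !linearB /= coeffB !coeffZ.
  rewrite l'E; apply: rpredD; last exact: (gv_null_map (bilin_r hb (k x)) t'0).
  apply: IH => [_ u /mapP[p pl ->] uD|u] /=.
    rewrite csE; have [->|us] := eqVneq u s.
      have := ideal_hom_swap h x (c p.1); rewrite cE // => e.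
      by rewrite -[coeff s (val p.1)]/(cs p.1) e -kI subrr.
    have usD : u \notin s :: D by rewrite inE negb_or us.
    by rewrite supp // ksupp // !mulr0 subrr.
  rewrite big_map /=.
  have -> : \sum_(p <- l) coeff u (val ((h x : R) *: p.1 - (h (c p.1) : R) *: k x)) *: p.2 =
      (h x : R) *: (\sum_(p <- l) coeff u (val p.1) *: p.2) - coeff u (val (k x)) *: t'.
    rewrite !scaler_sumr -sumrB; apply: eq_bigr => p _.
    by rewrite csE scalerBl !scalerA [coeff u (val (k x)) * _]mulrC.
  by apply: submod_subr; apply: rpredZ.
- by rewrite scale0r rpred0.
- have -> : (a *: x + y : R^o) *: \sum_(p <- l) b p.1 p.2 =
      a *: ((x : R) *: \sum_(p <- l) b p.1 p.2) + (y : R) *: \sum_(p <- l) b p.1 p.2.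
    by rewrite scalerDl -scalerA.
  by apply: rpredD => //; apply: rpredZ.
Qed.

End Elimination.
End TorsionFree.

(** * Local exactness and exactness up to GV-torsion *)

Section WExact.
Variable R : comNzRingType.

Lemma w_exact_of_exact (A B C : lmodType R) (f : {linear A -> B}) (g : {linear B -> C}) :
  (forall y, g y = 0 <-> y \in limg f) -> w_exact f g.
Proof.
move=> fg P hP _; apply/seteqP; split=> y /=.
  move=> [x _ <-]; have [a [s ->]] := frac_surj x; rewrite !loc_mapE.
  by have /fg -> := mem_limg f a; rewrite frac0.
have [b [s ->]] := frac_surj y; rewrite loc_mapE -[RHS](frac0 _ s) => /fracP[u].
rewrite scaler0 -linearZ_LR => /fg/limgP[a fa].
exists (frac a (denomM (denomM u s) s)) => //; rewrite loc_mapE fa.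
by apply/fracP; exists (denom1 (prime_compl hP)); rewrite /= !scalerA; congr (_ *: _); ring.
Qed.

Lemma denom_notin (P : ideal R) (hP : prime_ideal P) (u : denom (prime_compl hP)) :
  (dval u : R^o) \notin P.
Proof. by have := dvalP u; rewrite inE. Qed.

Lemma w_exact_gv (A B C : lmodType R) (f : {linear A -> B}) (g : {linear B -> C}) :
  w_exact f g -> gv_exact f g /\ forall x, g (f x) \in gv_null C.
Proof.
move=> fg; split=> [y gy|x].
  have {gy} /w_closureP[J gJ Jy] := gy.
  apply: (w_closure_trans gJ) => r /Jy/mem_zero_submod; rewrite -linearZ_LR.
  move: (r *: y) => {r Jy gJ J}{}y gy; apply: w_closure_local => P hP wP.
  have := fg P hP wP => /seteqP[_ /(_ (frac y (denom1 (prime_compl hP))))] /=.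
  rewrite loc_mapE gy frac0 => /(_ erefl)[x _]; have [a [s ->]] := frac_surj x.
  rewrite loc_mapE => /fracP[u /= ua]; exists (dval (denomM u s)).
    exact: denom_notin.
  by apply/limgP; exists ((dval u * 1) *: a); rewrite linearZ_LR ua.
apply: w_closure_local => P hP wP.
have := fg P hP wP => /seteqP[/(_ (frac (f x) (denom1 (prime_compl hP)))) + _] /=.
have img : range (@loc_map R (prime_compl hP) A B f) (frac (f x) (denom1 (prime_compl hP))).
  by exists (frac x (denom1 (prime_compl hP))) => //; rewrite loc_mapE.
move=> /(_ img) gx0.
have : frac (g (f x)) (denom1 (prime_compl hP)) = frac 0 (denom1 (prime_compl hP)).
  by rewrite frac0 -gx0 /= loc_mapE.
move=> /fracP[u /= ux]; exists (dval u); first exact: denom_notin.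
by apply/mem_zero_submod; move: ux; rewrite scaler0 !mulr1.
Qed.

End WExact.

Lemma enat_inf_leP (A : set nat) n : enat_le (enat_inf A) (Some n) <->
  exists2 k, (k <= n)%N & A k.
Proof.
rewrite /enat_inf; case: pselect => [h|noA] /=.
  case: ex_minnP => m /asboolP Am mmin; split=> [mn|[k kn Ak]]; first by exists m.
  by apply: leq_trans kn; apply: mmin; apply/asboolP.
by split=> // -[k _ Ak]; case: noA; exists k; apply/asboolP.
Qed.

(** * Tor of cyclic modules *)

Section Ideals.
Variable R : comNzRingType.
Implicit Types I J : ideal R.

Lemma phi_torsion_quot I : nonnil I -> phi_torsion (lmod_quot I).
Proof.
move=> nI x; exists I => // r rI; have [y ->] := lmod_pi_surj x.
rewrite -linearZ_LR -[RHS](linear0 (lmod_pi I)); apply/lmod_pi_eq; rewrite subr0.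
by rewrite -[_ *: _]/(r * (y : R)) mulrC; apply: (rpredZ (y : R) rI).
Qed.

Lemma strongly_phi_w_flatP (M : lmodType R) : strongly_phi_w_flat M <->
  forall T, phi_torsion T -> forall n, tor_null n T M.
Proof.
split=> h T tT n; first exact/Tor_GV_torsionP/h.
by case: n => // n _; apply/Tor_GV_torsionP/h.
Qed.

(** Tor_1(R/I, M) is the kernel of I (x) M -> M: the kernel of the free cover
    F of R / I retracts onto I, by a map F -> R over R / I. *)
Lemma Tor1_quotient I (M : lmodType R) : GV_torsion (Tor 1 (lmod_quot I) M) ->
  forall l : seq (submod I * M), \sum_(p <- l) (val p.1 : R) *: p.2 = 0 ->
  forall (Q : lmodType R) (b : submod I -> M -> Q), bilinear b ->
    \sum_(p <- l) b p.1 p.2 \in gv_null Q.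
Proof.
move=> /Tor1_GV_torsionP tor l l0 Q b hb.
pose one : lmod_quot I := lmod_pi I (1 : R^o).
pose s (t : lmod_quot I) : R^o := if t == one then 1 else repr (t : Quotient.quot _).
have sK t : lmod_pi I (s t) = t.
  by rewrite /s; case: eqP => [->|_] //; rewrite /lmod_pi reprK.
pose e : {linear {freeg (lmod_quot I) / R} -> R^o} := free_lift s.
have eE : forall f, lmod_pi I (e f) = free_cover f.
  apply: (free_lift_ext (f := (lmod_pi I \o e : {linear _ -> _}))
    (g := (@free_cover R (lmod_quot I) : {linear _ -> _}))) => t /=.
  by rewrite /e /= /free_cover !free_liftU sK.
have eK (k : submod (lker (@free_cover R (lmod_quot I)))) : e (val k) \in I.
  rewrite -[e _]subr0; apply/lmod_pi_eq; rewrite eE linear0.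
  exact/mem_lker/(valP k).
have kI (x : submod I) : (val x : R) *: << one >> \in lker (@free_cover R (lmod_quot I)).
  apply/mem_lker; rewrite linearZ_LR /= /free_cover free_liftU /one -linearZ_LR.
  rewrite -[RHS](linear0 (lmod_pi I)); apply/lmod_pi_eq; rewrite subr0.
  by rewrite -[_ *: _]/(val x * 1 : R) mulr1; exact: valP.
pose b' k m := b (Submod (eK k)) m.
have hb' : bilinear b'.
  split=> [m|k] a u v; last by rewrite /b' (bilinearPr hb).
  by rewrite /b' -(bilinearPl hb); congr (b _ _); apply: val_inj; rewrite /= !linearP.
have e1 : e << one >> = 1 by rewrite /e /= free_liftU /s eqxx.
pose l' := [seq (Submod (kI p.1), p.2) | p <- l].
have -> : \sum_(p <- l) b p.1 p.2 = \sum_(p <- l') b' p.1 p.2.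
  rewrite big_map; apply: eq_bigr => p _; rewrite /b' /=; congr (b _ _); apply: val_inj => /=.
  by rewrite linearZ_LR e1 [RHS]mulr1.
apply: tor => //; rewrite big_map /=.
under eq_bigr => p _ do rewrite tmulZl -tmulZr.
by rewrite -tmul_sumr l0 tmul0r.
Qed.

Lemma flat_nonnil_torsion_free (M : lmodType R) :
  nonnil_regular R -> flat M -> nonnil_torsion_free M.
Proof.
move=> reg flM; apply: nonnil_torsion_freeW => x m xN xm.
pose f : {linear R^o -> R^o} := scale_at (x : R^o).
have injf : injective f.
  by apply: raddf_inj => y; rewrite /= /scale_at => yx; apply: (reg x xN); rewrite mulrC.
have m0 : tmul (1 : R^o) m = 0 :> tensor R^o M.
  apply: (flM _ _ f injf); rewrite tensor_map_tmul raddf0.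
  by rewrite /= /scale_at scale1r -[x]mulr1 -[x * 1]/(x *: (1 : R^o)) tmulZl -tmulZr xm tmul0r.
suff -> : m = 0 by exact: rpred0.
have := congr1 (tensor_regular M \o tensor_swap R^o M) m0.
by rewrite /= tensor_swap_tmul raddf0 raddf0 /tensor_regular tensor_lift_tmul scale1r.
Qed.

Lemma mem_span1 (x z : R) : (z : R^o) \in submod_span [set x : R^o] <-> exists a, z = a * x.
Proof.
split=> [|[a ->]]; last by apply: (rpredZ (a : R)); exact: mem_span.
apply: (span_ind (Q := fun z : R^o => exists a : R, (z : R) = a * x)) => [_ ->||a u v].
- by exists 1; rewrite mul1r.
- by exists 0; rewrite mul0r.
- by move=> [c ->] [d ->]; exists (a * c + d); rewrite mulrDl -mulrA.
Qed.

Lemma span1_fg (x : R) : fg_submod (submod_span [set x : R^o]).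
Proof.
exists [:: x : R^o] => z; congr (_ \in submod_span _).
by apply/seteqP; split=> y /=; rewrite inE => /eqP.
Qed.

Lemma Tor1_nonnil_torsion_free (M : lmodType R) :
  nonnil_regular R -> (forall I, nonnil I -> GV_torsion (Tor 1 (lmod_quot I) M)) ->
  nonnil_torsion_free M.
Proof.
move=> reg tor; apply: nonnil_torsion_freeW => x m xN xm.
pose I : ideal R := submod_span [set x : R^o].
have xI : (x : R^o) \in I by exact: mem_span.
have nI : nonnil I by exists x.
have /choice[c cP] : forall y : submod I, exists a : R, (val y : R) = a * x.
  by move=> y; apply/mem_span1; exact: valP.
have cuniq a (y : submod I) : (val y : R) = a * x -> c y = a.
  rewrite cP => e; apply/subr0_eq/(reg x xN).
  by rewrite mulrBr ![x * _]mulrC e subrr.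
have hb : bilinear (fun y (m : M) => c y *: m).
  split=> [u|y] a v w; last by rewrite scalerDr !scalerA mulrC.
  rewrite scalerA -scalerDl; congr (_ *: _); apply: cuniq.
  by rewrite linearP mulrDl -mulrA -!cP.
have c1 : c (Submod xI) = 1 by apply: cuniq; rewrite mul1r.
have := Tor1_quotient (tor I nI) (l := [:: (Submod xI, m)]).
by rewrite big_seq1 => /(_ xm _ _ hb); rewrite big_seq1 /= c1 scale1r.
Qed.

End Ideals.

(** * Invertibility and traces *)

(** For a regular, c lies in I I^-1, the elements of I^-1 being written p_i / a. *)
Definition mul_inv_witness (R : comNzRingType) (I : ideal R) (a c : R) :=
  exists (n : nat) (m p : 'I_n -> R),
    [/\ forall i, (m i : R^o) \in I, c * a = \sum_(i < n) m i * p i &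
        forall i (x : R), (x : R^o) \in I -> exists y, p i * x = a * y].

Section Rloc.
Variables (R : comNzRingType).

Lemma rloc_zmod_morphism : zmod_morphism (@rloc R (regulars R)).
Proof. exact: rlocB. Qed.
Lemma rloc_monoid_morphism : monoid_morphism (@rloc R (regulars R)).
Proof. by split=> // x y; rewrite rlocM. Qed.
Definition rloc_rmorphism : {rmorphism R -> total_ring R} :=
  HB.pack (@rloc R (regulars R))
    (GRing.isZmodMorphism.Build _ _ _ rloc_zmod_morphism)
    (GRing.isMonoidMorphism.Build _ _ _ rloc_monoid_morphism).

Lemma rloc_inj : injective rloc_rmorphism.
Proof.
move=> x y /rfracP[u /=]; rewrite mulr1 => e; apply/subr0_eq.
have /regularP := dvalP u; apply; rewrite mulrBr; apply/eqP; rewrite subr_eq0; exact/eqP.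
Qed.
End Rloc.

Section RingIsomorphism.
Variables (R R' : comNzRingType) (e : {rmorphism R -> R'}) (e' : {rmorphism R' -> R}).
Hypotheses (eK : cancel e e') (e'K : cancel e' e).

Definition preim_ideal_pred (J : ideal R') : {pred R^o} := fun x : R => (e x : R'^o) \in J.
Lemma preim_ideal_closed J : submod_closed (preim_ideal_pred J).
Proof.
split=> [|a x y hx hy]; first by change ((e 0 : R'^o) \in J); rewrite rmorph0 rpred0.
change ((e (a * (x : R) + y) : R'^o) \in J); rewrite rmorphD rmorphM.
by apply: rpredD => //; apply: (rpredZ (e a) hx).
Qed.
Definition preim_ideal (J : ideal R') : ideal R := to_submod (preim_ideal_closed J).

Lemma mem_preim_ideal (J : ideal R') (x : R) :
  ((x : R^o) \in preim_ideal J) = ((e x : R'^o) \in J).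
Proof. by []. Qed.

Lemma preim_ideal_GV (J : ideal R') : GV_ideal J -> GV_ideal (preim_ideal J).
Proof.
move=> /GV_idealP[[s sJ] annJ homJ]; apply/GV_idealP; split.
- exists [seq e' x : R^o | x <- s] => x; rewrite mem_preim_ideal.
  apply/idP/idP; last first.
    apply: (span_ind (Q := fun x : R^o => (e x : R'^o) \in J)) => [_ /= /mapP[y ys ->]||a y z hy hz].
    + by rewrite e'K sJ; apply: mem_span.
    + by rewrite rmorph0 rpred0.
    + rewrite -[a *: y + z]/(a * (y : R) + z : R) rmorphD rmorphM.
      by apply: rpredD => //; apply: (rpredZ (e a) hy).
  rewrite sJ -{2}[x]eK; move: (e x : R'^o).
  apply: (span_ind (Q := fun x : R'^o => (e' x : R^o) \in submod_span [set` [seq e' x : R^o | x <- s]])).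
  + by move=> y ys; apply: mem_span; apply: map_f.
  + by rewrite rmorph0 rpred0.
  + move=> a y z hy hz; rewrite -[a *: y + z]/(a * (y : R') + z : R') rmorphD rmorphM.
    by apply: rpredD => //; apply: (rpredZ (e' a) hy).
- move=> r hr; rewrite -[r]eK; suff -> : e r = 0 by rewrite rmorph0.
  apply: annJ => x xJ; rewrite -[x in LHS]e'K -rmorphM hr ?rmorph0 //.
  by rewrite mem_preim_ideal e'K.
- move=> f.
  have mem' (x : submod J) : (e' (val x) : R^o) \in preim_ideal J.
    by rewrite mem_preim_ideal e'K; exact: valP.
  have lin : linear (fun x => e (f (Submod (mem' x))) : R'^o).
    move=> a x y; rewrite -[a]e'K -[RHS]/(e (e' a) * e _ + e _) -rmorphM -rmorphD.
    congr (e _); rewrite -[RHS](linearP f); congr (f _); apply: val_inj.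
    rewrite -[LHS]/(e' (e (e' a) * (val x : R') + val y)).
    by rewrite rmorphD rmorphM !eK.
  have [r rP] := homJ (to_linear lin); exists (e' r) => x.
  have xJ : (e (val x) : R'^o) \in J := valP x.
  have xE : x = Submod (mem' (Submod xJ)) by apply: val_inj; rewrite /= eK.
  have {}rP : e (f (Submod (mem' (Submod xJ)))) = r * e (val x) := rP (Submod xJ).
  by rewrite [in LHS]xE -[LHS]eK rP rmorphM eK.
Qed.

End RingIsomorphism.

Section InvertibleTrace.
Variables (R R' : comNzRingType) (e : {rmorphism R -> R'}) (e' : {rmorphism R' -> R}).
Hypotheses (eK : cancel e e') (e'K : cancel e' e).
Variable I : ideal R.
Local Notation X := [set e x | x in [set x : R | (x : R^o) \in I]].

(** An element b of I^-1 acts on I as a linear map to R. *)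
Lemma invertible_trace_dense : w_invertible X -> trace_dense I.
Proof.
move=> inv; have : w_op (ideal_mul_inv X) 1 by rewrite inv.
move=> [J gJ JX]; apply/w_closureP; exists (preim_ideal e J); first exact: (preim_ideal_GV eK e'K gJ).
move=> r rJ; rewrite -[r *: _]/(r * 1) mulr1; rewrite mem_preim_ideal in rJ.
have := JX _ rJ; rewrite mulr1 => -[n [a [b [aX binv rE]]]].
have /choice[x xP] : forall i, exists x : submod I, e (val x) = a i.
  by move=> i; have [x xI <-] := aX i; exists (Submod (xI : (x : R^o) \in I)).
have /choice[h hP] : forall i, exists h : submod I -> R, forall y,
    rloc_rmorphism R' (e (h y)) = rloc_rmorphism R' (e (val y)) * b i.
  move=> i; suff /choice[h hP] : forall y : submod I, exists z : R,
    rloc_rmorphism R' (e z) = rloc_rmorphism R' (e (val y)) * b i by exists h.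
  move=> y; have [|z _ zE] := binv i (e (val y)); first by exists (val y) => //; exact: valP.
  by exists (e' z); rewrite e'K.
have hlin i : linear (h i : submod I -> R^o).
  move=> c y z; apply: (can_inj eK); apply: (@rloc_inj R').
  transitivity (rloc_rmorphism R' (e (val (c *: y + z))) * b i); first exact: hP.
  rewrite -[val _]/(c * (val y : R) + val z).
  rewrite -[RHS]/(rloc_rmorphism R' (e (c * h i y + h i z))).
  have := hP i y; have := hP i z; move: (h i y) (h i z) => u v.
  by rewrite !rmorphD !rmorphM => -> ->; ring.
have -> : r = \sum_(i < n) h i (x i).
  apply: (can_inj eK); apply: (@rloc_inj R'); rewrite [LHS]rE !rmorph_sum.
  by apply: eq_bigr => i _; rewrite -xP; exact: esym (hP i (x i)).
apply: rpred_sum => i _; apply: mem_span; exists (to_linear (hlin i)), (x i).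
by [].
Qed.

Lemma trace_invertible (a : R) (C : ideal R) :
  (forall y, a * y = 0 -> y = 0) -> (1 : R^o) \in w_closure C ->
  (forall c, (c : R^o) \in C -> mul_inv_witness I a c) -> w_invertible X.
Proof.
move=> rega /w_closureP[G gG GC] CI; apply/seteqP; split=> // s _.
exists (preim_ideal e' G); first exact: preim_ideal_GV.
move=> r; rewrite mem_preim_ideal => rG.
have cG : (e' (r * s) : R^o) \in C.
  have /GC : (e' (r * s) : R^o) \in G by rewrite rmorphM mulrC; apply: (rpredZ (e' s) rG).
  by rewrite -[_ *: _]/(e' (r * s) * 1) mulr1.
have [n [m [p [mI cE pI]]]] := CI _ cG.
have rege : e a \in regulars R'.
  by apply/regularP => y ay; rewrite -[y]e'K (rega (e' y)) ?rmorph0 // -[a]eK -rmorphM ay rmorph0.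
pose u : total_ring R' := rfrac 1 (Denom rege).
have au : rloc_rmorphism R' (e a) * u = 1.
  rewrite [LHS]rmulE; apply/rfracP; exists (denom1 _) => /=; ring.
exists n, (fun i => e (m i)), (fun i => rloc_rmorphism R' (e (p i)) * u); split.
- by move=> i; exists (m i) => //; exact: mI.
- move=> i _ [x xI <-]; have [y py] := pI i x xI; exists (e y) => //.
  rewrite -[LHS]/(rloc_rmorphism R' (e y)) -[RHS]/(rloc_rmorphism R' (e x) * _).
  rewrite mulrA -!rmorphM [x * _]mulrC py !rmorphM /= mulrAC au.
  by rewrite mul1r.
- rewrite -[LHS]/(rloc_rmorphism R' (r * s)) -[LHS]mulr1 -au mulrA -rmorphM.
  rewrite -{1}[r * s]e'K -rmorphM cE !rmorph_sum mulr_suml; apply: eq_bigr => i _.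
  by rewrite !rmorphM mulrA.
Qed.

End InvertibleTrace.

(** * From flatness of ideals to invertibility *)

Section IdealTensor.
Variable R : comNzRingType.
Hypothesis prN : prime_ideal (nilradical R).

(** J (x) I -> R is injective up to GV-torsion; this symmetric condition says that
    both Tor_1(R/J, I) and Tor_1(R/I, J) are GV-torsion. *)
Definition gv_flat_pair (J I : ideal R) := forall l : seq (submod J * submod I),
  \sum_(p <- l) (val p.1 : R) * (val p.2 : R) = 0 ->
  forall (Q : lmodType R) (b : submod J -> submod I -> Q), bilinear b ->
    \sum_(p <- l) b p.1 p.2 \in gv_null Q.

Lemma prime_nilradical (P : ideal R) (x : R) : prime_ideal P ->
  (x : R^o) \in nilradical R -> (x : R^o) \in P.
Proof.
move=> [P1 prP] /asboolP[n xn].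
have {xn} : (x ^+ n : R) \in (P : {pred R}) by rewrite xn; exact: rpred0.
elim: n => [|n IH]; first by rewrite expr0 (negPf P1).
by rewrite exprS => /prP/orP[].
Qed.

(** If x y = 0 with x nonnil, then 1 is in the closure of ann x + ann y, where
    ann x is nil; a maximal w-ideal containing ann y would contain both. *)
Lemma gv_flat_pair_regular :
  (forall I J : ideal R, nonnil I -> fg_submod I -> gv_flat_pair J I) ->
  nonnil_regular R.
Proof.
move=> flatI x xN y xy.
pose I : ideal R := submod_span [set x : R^o].
pose J : ideal R := submod_span [set y : R^o].
have xI : (x : R^o) \in I by exact: mem_span.
have yJ : (y : R^o) \in J by exact: mem_span.
have /choice[cx cxP] : forall z : submod I, exists a : R, (val z : R) = a * x.
  by move=> z; apply/mem_span1; exact: valP.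
have /choice[cy cyP] : forall z : submod J, exists a : R, (val z : R) = a * y.
  by move=> z; apply/mem_span1; exact: valP.
pose W : ideal R := submod_span [set z : R^o | (z : R) * x = 0 \/ (z : R) * y = 0].
have piW (c d a : R) : (c - d) * x = 0 \/ (c - d) * y = 0 ->
    lmod_pi W (c * a : R^o) = lmod_pi W (d * a : R^o).
  move=> cd; apply/lmod_pi_eq; rewrite -[_ - _]mulrBl mulrC.
  by apply: (rpredZ (a : R)); exact: mem_span.
pose b (z : submod J) (t : submod I) : lmod_quot W := lmod_pi W (cy z * cx t : R^o).
have hb : bilinear b.
  split=> [t|z] a u v; rewrite /b.
    rewrite (piW _ (a * cy u + cy v)); last first.
      by right; rewrite mulrBl -cyP linearP mulrDl -mulrA -!cyP subrr.
    by rewrite mulrDl -mulrA linearP.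
  rewrite mulrC (piW (cx (a *: u + v)) (a * cx u + cx v)); last first.
    by left; rewrite mulrBl -cxP linearP mulrDl -mulrA -!cxP subrr.
  by rewrite mulrDl -mulrA linearP ![cx _ * _]mulrC.
have W1 : (1 : R^o) \in w_closure W.
  have nI : nonnil I by exists x.
  have := flatI I J nI (span1_fg x) [:: (Submod yJ, Submod xI)].
  rewrite big_seq1 /= [y * x]mulrC => /(_ xy _ _ hb); rewrite big_seq1 /b /=.
  rewrite (piW _ 1); last first.
    by right; rewrite mulrBl -cyP /= mul1r subrr.
  rewrite mulrC (piW _ 1); last by left; rewrite mulrBl -cxP /= mul1r subrr.
  by rewrite mul1r => /gv_null_quot.
pose C := preim_submod (scale_at (y : R^o)) (zero_submod R^o).
have CP (c : R) : (c : R^o) \in C <-> c * y = 0 by exact: mem_zero_submod.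
suff /CP : (1 : R^o) \in C by rewrite mul1r.
have clC (c : R^o) : c \in w_closure C -> c \in C.
  move=> cC; apply/CP/gv_null_ring; move: cC.
  by apply: (w_closure_map (f := scale_at (y : R^o))) => z zC; apply: sub_w_closure.
apply: contraT => C1.
have [|P [prP [wP notP1 _] CsubP]] := @w_Max_exists R C.
  by apply: contra C1; apply: clC.
case/negP: notP1; apply: (w_ideal_closed wP); move: W1; apply: w_closure_idem.
apply: span_sub => z [zx|zy]; apply: sub_w_closure; last by apply/CsubP/CP.
apply: prime_nilradical prP _.
have : (z * x : R) \in (nilradical R : {pred R}) by rewrite zx; exact: rpred0.
by move=> /prN.2/orP[//|xN']; rewrite xN' in xN.
Qed.

Section Relations.
Variables (n : nat) (I : ideal R) (m : 'rV[R]_n).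
Hypothesis Im : forall x : R, (x : R^o) \in I <-> exists c : 'cV_n, x = (m *m c) 0 0.
Hypothesis flatI : forall J, gv_flat_pair J I.

Lemma generator_mem i : (m 0 i : R^o) \in I.
Proof.
apply/Im; exists (delta_mx i 0); rewrite mxE (bigD1 i) //= big1 => [|j ji].
  by rewrite mxE !eqxx mulr1 addr0.
by rewrite mxE (negPf ji) mulr0.
Qed.

(** The equational form of flatness: a relation between the generators of I
    becomes trivial, up to a w-dense set of multiples. *)
Definition trivializer_pred (rs : seq 'cV[R]_n) : {pred R^o} := fun c =>
  `[< exists A : 'M_n, m *m A = (c : R) *: m /\ forall r, r \in rs -> A *m r = 0 >].
Lemma trivializer_closed rs : submod_closed (trivializer_pred rs).
Proof.
split=> [|a x y /asboolP[A [mA Ar]] /asboolP[B [mB Br]]]; apply/asboolP.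
  by exists 0; rewrite mulmx0 scale0r; split=> // r _; rewrite mul0mx.
exists (a *: A + B); split=> [|r rrs].
  by rewrite mulmxDr -scalemxAr mA mB scalerA -scalerDl.
by rewrite mulmxDl -scalemxAl Ar // Br // scaler0 addr0.
Qed.
Definition trivializer rs : ideal R := to_submod (trivializer_closed rs).

Lemma trivializerP rs (c : R) : (c : R^o) \in trivializer rs <->
  exists A : 'M_n, m *m A = c *: m /\ forall r, r \in rs -> A *m r = 0.
Proof. by split=> /asboolP. Qed.

Lemma trivialize_relation (r : 'cV_n) : m *m r = 0 -> (1 : R^o) \in w_closure (trivializer [:: r]).
Proof.
move=> mr; pose J : ideal R := submod_span [set z : R^o | exists i, z = r i 0].
have rJ i : (r i 0 : R^o) \in J by apply: mem_span; exists i.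
have /choice[al alP] : forall z : submod J, exists k : 'rV[R]_n, (k *m r) 0 0 = val z.
  case=> z zJ /=; move: z zJ; apply: (span_ind
    (Q := fun z : R^o => exists k : 'rV[R]_n, (k *m r) 0 0 = z)) => [_ [i ->]||a u v [k <-] [k' <-]].
  - by exists (delta_mx 0 i); rewrite -rowE mxE.
  - by exists 0; rewrite mul0mx mxE.
  - by exists (a *: k + k'); rewrite mulmxDl -scalemxAl !mxE.
pose L := submod_span [set w : 'rV[R]_n | exists (x : R) (k : 'rV[R]_n),
  [/\ (x : R^o) \in I, (k *m r) 0 0 = 0 & w = x *: k]].
have piL (x : R) (k k' : 'rV[R]_n) : (x : R^o) \in I -> (k *m r) 0 0 = (k' *m r) 0 0 ->
    lmod_pi L (x *: k) = lmod_pi L (x *: k').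
  move=> xI kk; apply/lmod_pi_eq; rewrite -scalerBr; apply: mem_span.
  by exists x, (k - k'); split=> //; rewrite mulmxBl mxE [X in _ + X]mxE kk subrr.
pose b (z : submod J) (x : submod I) := lmod_pi L ((val x : R) *: al z).
have hb : bilinear b.
  split=> [x|z] a u v; rewrite /b.
    rewrite (piL _ _ (a *: al u + al v) (valP x)); last first.
      by rewrite alP linearP mulmxDl -scalemxAl mxE [X in _ = X + _]mxE !alP.
    by rewrite scalerDr scalerA mulrC -scalerA linearP.
  by rewrite -linearP -[val (a *: u + v)]/(a * (val u : R) + val v) scalerDl scalerA.
pose gen i : submod I := Submod (generator_mem i).
pose l := [seq (Submod (rJ i) : submod J, gen i) | i <- enum 'I_n].
have l0 : \sum_(p <- l) (val p.1 : R) * (val p.2 : R) = 0.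
  rewrite big_map big_enum /=; have := congr1 (fun M : 'M_1 => M 0 0) mr.
  by rewrite !mxE => mr0; rewrite -[RHS]mr0; apply: eq_bigr => i _; rewrite mulrC.
have := flatI l0 hb; rewrite big_map big_enum /= /b /=.
under eq_bigr => i _.
  rewrite (piL _ _ (delta_mx 0 i) (generator_mem i)); last by rewrite alP -rowE mxE.
  over.
rewrite -linear_sum -row_sum_delta => /gv_null_quot/w_closureP[G gG GL].
apply/w_closureP; exists G => // g /GL {GL}.
rewrite -[g *: (1 : R^o)]/(g * 1) mulr1 => gm.
suff [A [mA Ar]] : exists A : 'M_n, m *m A = g *: m /\ A *m r = 0.
  by apply/trivializerP; exists A; split=> // r'; rewrite inE => /eqP ->.
move: gm; apply: (span_ind (Q := fun w : 'rV_n => exists A : 'M_n, m *m A = w /\ A *m r = 0)).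
- move=> _ [x [k [/Im[c ->] kr ->]]]; exists (c *m k); split.
    by rewrite mulmxA [m *m c in LHS]mx11_scalar mul_scalar_mx.
  by rewrite -mulmxA [k *m r]mx11_scalar kr raddf0 mulmx0.
- by exists 0; rewrite mulmx0 mul0mx.
- move=> a u v [A [<- Ar]] [B [<- Br]]; exists (a *: A + B).
  by rewrite mulmxDr -scalemxAr mulmxDl -scalemxAl Ar Br scaler0 addr0.
Qed.

(** Relations are trivialized one after the other: if A trivializes rs with
    multiplier c, then A r is again a relation. *)
Lemma trivialize_relations (rs : seq 'cV_n) : (forall r, r \in rs -> m *m r = 0) ->
  (1 : R^o) \in w_closure (trivializer rs).
Proof.
elim: rs => [_|r rs IH mrs].
  apply/sub_w_closure/trivializerP; exists 1%:M; rewrite mulmx1 scale1r; split=> //.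
have {}IH : (1 : R^o) \in w_closure (trivializer rs).
  by apply: IH => r' h; apply: mrs; rewrite inE h orbT.
apply: (w_closure_dense IH) => c /trivializerP[A [mA Ar]].
have mAr : m *m (A *m r) = 0 by rewrite mulmxA mA -scalemxAl mrs ?mem_head // scaler0.
have := trivialize_relation mAr.
have -> : c *: (1 : R^o) = scale_at (c : R^o) (1 : R^o).
  by rewrite -[LHS]/(c * 1) mulrC.
apply: w_closure_map => d /trivializerP[B [mB BAr]]; apply: sub_w_closure.
rewrite /= /scale_at -[d *: _]/((d : R) * c); apply/trivializerP.
exists (B *m A); split=> [|r'].
  by rewrite mulmxA mB -scalemxAl mA scalerA.
rewrite inE -mulmxA => /predU1P[->|/Ar ->]; last by rewrite mulmx0.
by apply: BAr; rewrite mem_head.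
Qed.

(** The relations a m_i - m_i a, where a = m v, are trivialized by a matrix A
    with a A_li = (A v)_l m_i; so the (A v)_l / a lie in I^-1, and the sum of the
    m_l (A v)_l is c a. *)
Lemma gv_flat_mul_inv (a : R) : (a : R^o) \in I ->
  exists2 C : ideal R, (1 : R^o) \in w_closure C &
    forall c, (c : R^o) \in C -> mul_inv_witness I a c.
Proof.
move=> /Im[v av]; pose rel i := a *: delta_mx i 0 - m 0 i *: v.
have mv : m *m v = a%:M by rewrite [LHS]mx11_scalar -av.
exists (trivializer [seq rel i | i <- enum 'I_n]).
  apply: trivialize_relations => _ /mapP[i _ ->].
  rewrite mulmxBr -!scalemxAr mv -colE; apply/matrixP => j k; rewrite !ord1 !mxE eqxx.
  by rewrite mulr1n mulrC subrr.
move=> c /trivializerP[A [mA Arel]].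
have Ap l i : (A *m v) l 0 * m 0 i = a * A l i.
  have /Arel : rel i \in [seq rel i | i <- enum 'I_n] by apply: map_f; rewrite mem_enum.
  rewrite mulmxBr -!scalemxAr -colE => /matrixP/(_ l 0); rewrite !mxE.
  by move/eqP; rewrite subr_eq0 => /eqP ->; rewrite mulrC.
exists n, (fun l => m 0 l), (fun l => (A *m v) l 0); split.
- by move=> l; exact: generator_mem.
- have : m *m (A *m v) = c *: a%:M by rewrite mulmxA mA -scalemxAl mv.
  by move=> /matrixP/(_ 0 0); rewrite [LHS]mxE [RHS]mxE [X in _ * X]mxE eqxx mulr1n => <-.
- move=> l x /Im[d ->]; exists ((A *m d) l 0).
  rewrite [(m *m d) 0 0]mxE [(A *m d) l 0]mxE !mulr_sumr.
  by apply: eq_bigr => i _; rewrite !mulrA Ap.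
Qed.

End Relations.

Lemma fg_generators (I : ideal R) : fg_submod I -> exists (n : nat) (m : 'rV[R]_n),
  forall x : R, (x : R^o) \in I <-> exists c : 'cV_n, x = (m *m c) 0 0.
Proof.
move=> [s sI]; exists (size s), (\row_i (s`_i : R)) => x; rewrite sI; split.
  apply: (span_ind (Q := fun x : R^o => exists c : 'cV_(size s), (x : R) = (_ *m c) 0 0)).
  - move=> y /= ys; have ilt : (index y s < size s)%N by rewrite index_mem.
    exists (delta_mx (Ordinal ilt) 0); rewrite -colE !mxE /=.
    by rewrite (nth_index (0 : R^o) ys).
  - by exists 0; rewrite mulmx0 mxE.
  - move=> a u v [c ->] [d ->]; exists (a *: c + d).
    by rewrite mulmxDr -scalemxAr !mxE.
move=> [c ->]; rewrite mxE; apply: rpred_sum => i _; rewrite mxE mulrC.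
by apply: (rpredZ (c i 0)); apply: mem_span; exact: mem_nth.
Qed.

End IdealTensor.

(** * The equivalences *)

Section Equivalences.
Variables (R : comNzRingType) (hR : phi_ring R).
Let prN : prime_ideal (nilradical R) := proj1 hR.

Lemma strongly_phi_ringP : strongly_phi_ring R <-> nonnil_regular R.
Proof.
split=> [[_ ZN] x xN y xy|reg].
  apply: contrapT => /eqP y0; case/negP: xN.
  by have : zero_divisors x by [exists y]; rewrite ZN.
split=> //; apply/seteqP; split=> x /=.
  by move=> [y /eqP y0 xy]; apply: contraT => xN; case: y0; apply: (reg x).
move=> xN; apply: contrapT => xZ; have /(regular_nonnil prN) : x \in regulars R by apply/asboolP.
by rewrite inE xN.
Qed.

(** When the nonnil elements are regular, R -> phi(R) is an isomorphism. *)
Section PhiIsomorphism.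
Hypothesis reg : nonnil_regular R.

Lemma to_phiR_subproof (x : R) : phi prN (rloc (regulars R) x) \in phi_image (prN := prN).
Proof. by apply/asboolP; exists x. Qed.
Definition to_phiR (x : R) : phiR prN := PhiR (to_phiR_subproof x).

Lemma to_phiR_zmod_morphism : zmod_morphism to_phiR.
Proof. by move=> x y; apply: val_inj; rewrite /= rlocB rmorphB. Qed.
Lemma to_phiR_monoid_morphism : monoid_morphism to_phiR.
Proof.
split=> [|x y]; apply: val_inj; last by rewrite /= rlocM rmorphM.
exact: (rmorph1 (phi prN)).
Qed.
HB.instance Definition _ := GRing.isZmodMorphism.Build R (phiR prN) to_phiR to_phiR_zmod_morphism.
HB.instance Definition _ := GRing.isMonoidMorphism.Build R (phiR prN) to_phiR to_phiR_monoid_morphism.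

Lemma to_phiR_inj : injective to_phiR.
Proof.
move=> x y /(congr1 val) /=; rewrite /rloc !phiE => /rfracP[u /= e].
apply/subr0_eq; apply: (reg (x := dval u)); first by have := dvalP u; rewrite inE.
by rewrite mulrBr -[dval u]mulr1 e subrr.
Qed.

Lemma to_phiR_surj y : exists x, to_phiR x = y.
Proof. by have /asboolP[x xy] := phiR_valP y; exists x; apply: val_inj. Qed.

Lemma from_phiR_exists : exists e' : {rmorphism phiR prN -> R},
  cancel to_phiR e' /\ cancel e' to_phiR.
Proof.
have [e' e'K] := choice to_phiR_surj.
have eK : cancel to_phiR e' by move=> x; apply: to_phiR_inj; rewrite e'K.
have zm : zmod_morphism e'.
  by move=> x y; apply: to_phiR_inj; rewrite e'K rmorphB /= !e'K.
have mm : monoid_morphism e'.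
  split=> [|x y]; apply: to_phiR_inj; first by rewrite e'K rmorph1.
  by rewrite e'K rmorphM /= !e'K.
pose f : {rmorphism phiR prN -> R} := HB.pack e'
  (GRing.isZmodMorphism.Build _ _ _ zm) (GRing.isMonoidMorphism.Build _ _ _ mm).
by exists f.
Qed.

Lemma phi_idealE (I : ideal R) :
  phi_ideal prN I = [set to_phiR x | x in [set x : R | (x : R^o) \in I]].
Proof.
apply/seteqP; split=> y [x xI xy]; first by exists x => //; apply: val_inj.
by exists x => //; rewrite -xy.
Qed.
End PhiIsomorphism.

Definition traces_dense := forall I : ideal R, nonnil I -> fg_submod I -> trace_dense I.

Lemma phi_PvMR_trace : nonnil_regular R -> phi_PvMR hR -> traces_dense.
Proof.
move=> reg PvMR I nI fgI; have [e' [eK e'K]] := from_phiR_exists reg.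
by have := PvMR I nI fgI; rewrite phi_idealE; apply: (invertible_trace_dense (e' := e')).
Qed.

Lemma gv_flat_pair_PvMR :
  (forall I J : ideal R, nonnil I -> fg_submod I -> gv_flat_pair J I) ->
  strongly_phi_ring R /\ phi_PvMR hR.
Proof.
move=> flatI; have reg := gv_flat_pair_regular prN flatI.
split=> [|I nI fgI]; first exact/strongly_phi_ringP.
have [n [m Im]] := fg_generators fgI; have [a aI aN] := nI.
have [C C1 CP] := gv_flat_mul_inv Im (fun J => flatI I J nI fgI) aI.
have [e' [eK e'K]] := from_phiR_exists reg.
by rewrite phi_idealE; apply: (trace_invertible (e' := e') eK e'K (reg a aN) C1).
Qed.

Lemma all_ideals_strongly_PvMR :
  (forall J : ideal R, strongly_phi_w_flat (submod J)) -> strongly_phi_ring R /\ phi_PvMR hR.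
Proof.
move=> sfl; apply: gv_flat_pair_PvMR => I J nI fgI l l0 Q b hb.
have /strongly_phi_w_flatP/(_ _ (phi_torsion_quot nI) 0)/Tor_GV_torsionP tor := sfl J.
have hb' : bilinear (fun y x => b x y) by split; [exact: hb.2 | exact: hb.1].
have := Tor1_quotient tor (l := [seq (p.2, p.1) | p <- l]).
rewrite big_map => /(_ _ _ _ hb'); rewrite big_map; apply.
apply: val_inj; rewrite linear_sum -[RHS]l0; apply: eq_bigr => p _.
exact: mulrC.
Qed.

Lemma fg_finite_type (I : ideal R) : fg_submod I -> finite_type (submod I).
Proof.
move=> /fg_generators[n [m Im]].
have gI (v : 'rV[R]_n) : ((v *m m^T) 0 0 : R^o) \in I.
  by apply/Im; exists v^T; rewrite -[v *m _]trmxK trmx_mul trmxK mxE.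
have glin : linear (fun v => Submod (gI v)).
  by move=> a u v; apply: val_inj; rewrite /= mulmxDl -scalemxAl !mxE.
exists n, (to_linear glin); apply: w_exact_of_exact => y; split=> // _.
have /Im[c yc] := valP y; apply/limgP; exists c^T; apply: val_inj.
by rewrite /= yc -trmx_mul mxE.
Qed.

Lemma fg_nonnil_w_flat_PvMR :
  (forall I : ideal R, nonnil I -> finite_type (submod I) -> w_flat (submod I)) ->
  strongly_phi_ring R /\ phi_PvMR hR.
Proof.
move=> wfl; apply: gv_flat_pair_PvMR => I J nI fgI l l0 Q b hb.
apply: (Tor1_quotient (wfl I nI (fg_finite_type fgI) (lmod_quot J))) => //.
by apply: val_inj; rewrite linear_sum -[RHS]l0; apply: eq_bigr.
Qed.

(** A w-exact sequence 0 -> F_1 -> F_0 -> R/J -> 0 makes Tor_n(T, R/J) GV-torsion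
    for n >= 2, and Tor_n(T, J) = Tor_(n+1)(T, R/J) for n >= 1. *)
Lemma wgldim_all_ideals : enat_le (phi_w_wgldim R) (Some 1) ->
  forall J : ideal R, strongly_phi_w_flat (submod J).
Proof.
move=> /enat_inf_leP[k k1 dimk] J; apply/strongly_phi_w_flatP => T tT n.
have /enat_inf_leP[i ik [F [d [e [sF F0 eM d0e dd]]]]] := dimk (lmod_quot J).
have {}ik : (i <= 1)%N := leq_trans ik k1.
have torF j : (j <= 1)%N -> forall n, tor_null n T (F j).
  move=> j1 n'; have [ji|ij] := leqP j i; first by have /strongly_phi_w_flatP := sF j ji; apply.
  (* If the resolution has length i = 0, then F_1 is zero. *)
  have jE : j = i.+1 by apply/eqP; rewrite eqn_leq ij (leq_trans j1).
  move=> z _; suff -> : z = 0 by exact: rpred0.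
  rewrite jE in z *; apply: (tensor_ext (f := idfun) (g := \0)) => x y /=.
  by rewrite [y]F0 tmul0r.
have injd : gv_injective (d 0).
  case: (i) ik F0 dd => [|[|//]] _ F0 dd x.
    by move=> _; rewrite [x]F0; exact: rpred0.
  have [ex _] := w_exact_gv (dd 0 isT).
  by move=> /ex; apply: w_closure_idem => _ /limgP[y <-]; rewrite [y]F0 raddf0 rpred0.
have [ex0 null0] := w_exact_gv d0e; have [exe _] := w_exact_gv eM.
have torX : tor_null n.+1 T (lmod_quot J).
  apply: (tor_null_quot injd ex0 _ null0); last 2 first.
  - exact: torF.
  - exact: torF.
  - by move=> y; apply: exe; exact: rpred0.
apply: (tor_null_sub (f := (val : {linear submod J -> R^o}))
  (g := (lmod_pi J : {linear R^o -> lmod_quot J})) _ _ _ _ _ torX).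
- exact: gv_injective_val.
- move=> y /gv_null_quot; apply: w_closure_idem => x xJ.
  by apply: sub_w_closure; exact: mem_limg_val.
- by apply: gv_surjective_of_surjective => y; have [x ->] := lmod_pi_surj y; exists x.
- move=> x; rewrite -[RHS](linear0 (lmod_pi J)); apply/lmod_pi_eq; rewrite subr0; exact: valP.
- exact: tor_null_regular.
Qed.

Section PvMR.
Hypotheses (reg : nonnil_regular R) (trR : traces_dense).

Lemma nonnil_torsion_free_freeg (S : choiceType) : nonnil_torsion_free {freeg S / R}.
Proof.
apply: nonnil_torsion_freeW => r x rN rx; suff -> : x = 0 by exact: rpred0.
apply/eqP/freeg_eqP => s; rewrite raddf0; apply: (reg rN).
by rewrite -coeffZ rx raddf0.
Qed.

(** Induction on n by dimension shifting; the case n = 1 is the elimination. *)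
Lemma torsion_free_strongly (M : lmodType R) :
  nonnil_torsion_free M -> strongly_phi_w_flat M.
Proof.
move=> tfM; apply/strongly_phi_w_flatP => T tT n; elim: n M tfM => [|n IH] M tfM; last first.
  apply/tor_null_syzygy/IH/nonnil_torsion_free_sub; exact: nonnil_torsion_free_freeg.
apply/Tor_GV_torsionP/Tor1_GV_torsionP => l l0 Q b hb.
apply: (@eliminate R _ _ M Q b hb tfM trR _ (flatten [seq dom (val p.1) | p <- l])).
- move=> t; have [I [r rI rN] It] := tT t; exists r => //.
  by apply/mem_lker; rewrite linearZ_LR /= /free_cover free_liftU; exact: It.
- move=> p s pl sD; apply: coeff_outdom; apply: contra sD => sp.
  by apply/flattenP; exists (dom (val p.1)) => //; apply/mapP; exists p.
move=> s; have := congr1 (tcoeff s) l0; rewrite linear_sum raddf0 => e.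
suff -> : \sum_(p <- l) coeff s (val p.1) *: p.2 = 0 by exact: rpred0.
by rewrite -[RHS]e; apply: eq_bigr => p _; rewrite /= tcoeff_tmul.
Qed.

Lemma strongly_torsion_free (M : lmodType R) :
  strongly_phi_w_flat M -> nonnil_torsion_free M.
Proof.
move=> /strongly_phi_w_flatP sfl; apply: Tor1_nonnil_torsion_free => // I nI.
by apply/Tor_GV_torsionP/sfl; exact: phi_torsion_quot.
Qed.

Lemma strongly_sub (M : lmodType R) (N : submodClosed M) :
  nonnil_torsion_free M -> strongly_phi_w_flat (submod N).
Proof. by move=> tfM; apply/torsion_free_strongly/nonnil_torsion_free_sub. Qed.

Lemma wgldim_le1 : enat_le (phi_w_wgldim R) (Some 1).
Proof.
apply/enat_inf_leP; exists 1 => // M; apply/enat_inf_leP; exists 1 => //.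
pose K : submodClosed {freeg M / R} := lker (@free_cover R M).
pose F (i : nat) : lmodType R :=
  match i with 0 => {freeg M / R} | 1 => submod K | _ => 'rV[R]_0 end.
pose d (i : nat) : {linear F i.+1 -> F i} :=
  match i return {linear F i.+1 -> F i} with
  | 0 => (val : {linear submod K -> {freeg M / R}})
  | 1 => (\0 : {linear 'rV[R]_0 -> submod K})
  | _ => (\0 : {linear 'rV[R]_0 -> 'rV[R]_0})
  end.
exists F, d, (@free_cover R M : {linear F 0 -> M}); split.
- move=> [|[|//]] _.
  + by apply: torsion_free_strongly; exact: nonnil_torsion_free_freeg.
  + by apply: strongly_sub; exact: nonnil_torsion_free_freeg.
- by move=> x; apply/rowP => -[].
- apply: w_exact_of_exact => y; split=> // _; apply/limgP; exists << y >>.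
  exact: free_liftU.
- apply: w_exact_of_exact => y; split=> [y0|/limgP[x <-]].
    by apply: mem_limg_val; apply/mem_lker.
  exact/mem_lker/(valP x).
- move=> [|//] _; apply: w_exact_of_exact => y; split=> [y0|/limgP[x <-]].
    by apply/limgP; exists 0; apply: val_inj; exact: esym y0.
  by [].
Qed.

(** Tor_1(N, I) for an arbitrary module N, that is the kernel of K (x) I -> F
    for a presentation N = F / K with F free: multiplying sum k_j (x) x_j by
    h x, for a map h from (r, x_1, ..., x_p) to R, gives (sum h x_j k_j) (x) x,
    and r kills the sum in F. *)
Lemma nonnil_w_flat (I : ideal R) : nonnil I -> w_flat (submod I).
Proof.
move=> [r rI rN] N; apply/Tor1_GV_torsionP => l l0 Q b hb.
have rel : \sum_(p <- l) (val p.2 : R) *: val p.1 = 0 :> {freeg N / R}.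
  have hc : bilinear (fun (f : {freeg N / R}) (x : submod I) => (val x : R) *: f).
    split=> [x|f] a u v; first by rewrite scalerDr !scalerA mulrC.
    by rewrite linearP scalerDl scalerA.
  have := congr1 (tensor_lift hc) l0; rewrite raddf0 linear_sum => e.
  by rewrite -[RHS]e; apply: eq_bigr => p _; rewrite /= tensor_lift_tmul.
pose t : seq R^o := (r : R^o) :: [seq val p.2 : R^o | p <- l].
pose I' : ideal R := submod_span [set` t].
have It x : x \in t -> x \in I' by move=> xt; apply: mem_span.
have rI' : (r : R^o) \in I' by apply: It; rewrite mem_head.
have I'I x : x \in I' -> x \in I.
  apply: span_sub => y /=; rewrite in_cons => /predU1P[->|/mapP[p _ ->]] //.
  exact: valP.
have Idense : trace_dense I' by apply: trR; [exists r | exists t].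
apply: (w_closure_dense Idense).
apply: (span_ind (Q := fun a : R^o => (a : R) *: (\sum_(p <- l) b p.1 p.2) \in gv_null Q))
  => [_ [h [x ->]]||a x y hx hy].
- pose c (y : submod I) : submod I' := insubd 0 (val y).
  have cE p : p \in l -> val (c p.2) = val p.2.
    move=> pl; rewrite /c insubdK //; apply: It; rewrite in_cons; apply/orP; right.
    by apply/mapP; exists p.
  pose x' : submod I := Submod (I'I _ (valP x)).
  have -> : (h x : R) *: \sum_(p <- l) b p.1 p.2 = b (\sum_(p <- l) (h (c p.2) : R) *: p.1) x'.
    rewrite (bilinear_suml hb) scaler_sumr !big_seq; apply: eq_bigr => p pl.
    rewrite -(bilinearZr hb) (bilinearZl hb) -(bilinearZr hb); congr (b _ _).
    apply: val_inj; rewrite !linearZ_LR -[LHS]/((h x : R) * (val p.2 : R)) -cE //.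
    exact: (ideal_hom_swap h x (c p.2)).
  suff -> : \sum_(p <- l) (h (c p.2) : R) *: p.1 = 0 by rewrite (bilinear0l hb) rpred0.
  apply: val_inj; set k := \sum_(p <- l) _.
  have rk : r *: val k = 0.
    have -> : val k = \sum_(p <- l) (h (c p.2) : R) *: val p.1.
      exact: (big_morph val (fun _ _ => erefl) erefl).
    transitivity ((h (Submod rI') : R) *: \sum_(p <- l) (val p.2 : R) *: val p.1).
      rewrite !scaler_sumr !big_seq; apply: eq_bigr => p pl; rewrite !scalerA.
      by congr (_ *: _); rewrite -cE // -ideal_hom_swap mulrC.
    by rewrite rel scaler0.
  apply/eqP/freeg_eqP => s; rewrite [RHS]raddf0; apply: (reg rN).
  by rewrite -coeffZ rk raddf0.
- by rewrite scale0r rpred0.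
- have -> : (a *: x + y : R^o) *: \sum_(p <- l) b p.1 p.2 =
      a *: ((x : R) *: \sum_(p <- l) b p.1 p.2) + (y : R) *: \sum_(p <- l) b p.1 p.2.
    by rewrite scalerDl -scalerA.
  by apply: rpredD => //; apply: rpredZ.
Qed.

End PvMR.
End Equivalences.

Theorem theorem2p8 (R : comNzRingType) (hR : phi_ring R) :
  [<-> strongly_phi_ring R /\ phi_PvMR hR;
       enat_le (phi_w_wgldim R) (Some 1);
       forall M : lmodType R, strongly_phi_w_flat M ->
         forall N : submodClosed M, strongly_phi_w_flat (submod N);
       forall M : lmodType R, w_flat M ->
         forall N : submodClosed M, strongly_phi_w_flat (submod N);
       forall M : lmodType R, flat M ->
         forall N : submodClosed M, strongly_phi_w_flat (submod N);
       forall I : ideal R, strongly_phi_w_flat (submod I);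
       forall I : ideal R, nonnil I -> w_flat (submod I);
       forall I : ideal R, nonnil I -> finite_type (submod I) ->
         w_flat (submod I)].
Proof.
have PvMR : strongly_phi_ring R /\ phi_PvMR hR -> nonnil_regular R /\ traces_dense R.
  by move=> [/(strongly_phi_ringP hR) reg /(phi_PvMR_trace reg)].
have regular_strongly : strongly_phi_w_flat (R^o : lmodType R).
  by apply/strongly_phi_w_flatP => T _ n; exact: tor_null_regular.
have regular_w_flat : w_flat (R^o : lmodType R).
  by move=> N; apply/Tor_GV_torsionP; exact: tor_null_regular.
tfae.
- by move=> /PvMR[reg trR]; exact: wgldim_le1.
- move=> /wgldim_all_ideals/(all_ideals_strongly_PvMR hR)/PvMR[reg trR] M sM N.
  by apply: strongly_sub => //; exact: strongly_torsion_free.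
- move=> subs; have /PvMR[reg trR] : strongly_phi_ring R /\ phi_PvMR hR.
    by apply: all_ideals_strongly_PvMR => J; apply: subs.
  move=> M wM N; apply: strongly_sub => //.
  by apply: Tor1_nonnil_torsion_free => // I _; exact: wM.
- move=> subs; have /PvMR[reg trR] : strongly_phi_ring R /\ phi_PvMR hR.
    by apply: all_ideals_strongly_PvMR => J; apply: subs.
  by move=> M fM N; apply: strongly_sub => //; exact: flat_nonnil_torsion_free.
- by move=> subs I; apply: subs; exact: flat_regular.
- move=> /(all_ideals_strongly_PvMR hR)/PvMR[reg trR] I.
  exact: nonnil_w_flat.
- by move=> wI I nI _; exact: wI.
- exact: fg_nonnil_w_flat_PvMR.
Qed.
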